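(* Let $\chi_0\in C_c^\infty(0,\infty)$ be not identically zero, $p\ge2$ and $0<c_0<1$. If $\alpha>\min\{1/2,3/p\}$, then $f\mapsto\chi_0(t)\,\mathcal A_t^{c_0t}f$ (regarded as a function of $(x,t)\in\mathbb R^3\times\mathbb R$) fails to be bounded from $L^p(\mathbb R^3)$ to $L^p_\alpha(\mathbb R^4)$.
   Context: For $0<s<t$ set $\Phi_t^s(\theta,\phi)=\big((t+s\cos\theta)\cos\phi,\,(t+s\cos\theta)\sin\phi,\,s\sin\theta\big)$, a parametrization of the torus $\mathbb T_t^s\subset\mathbb R^3$. The measure $\sigma_t^s$ is defined by $\langle f,\sigma_t^s\rangle=\int_{[0,2\pi)^2}f(\Phi_t^s(\theta,\phi))\,d\theta\,d\phi$, and $\mathcal A_t^sf=f*\sigma_t^s$, i.e. $\mathcal A_t^sf(x)=\int_{[0,2\pi)^2}f(x-\Phi_t^s(\theta,\phi))\,d\theta\,d\phi$; $\mathcal A_t^{c_0t}$ is this operator with $s=c_0t$. $L^p_\alpha(\mathbb R^d)$ is the $L^p$ Sobolev (Bessel potential) space of order $\alpha$, with norm $\|\mathcal F^{-1}((1+|\zeta|^2)^{\alpha/2}\mathcal FF)\|_{L^p(\mathbb R^d)}$. *)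

(* Defs.v *)
From HB Require Import structures.
From mathcomp Require Import all_boot all_order all_algebra.
From mathcomp Require Import complex.
From mathcomp Require Import all_classical all_reals all_analysis.
Set Implicit Arguments.
Unset Strict Implicit.
Unset Printing Implicit Defensive.
Import Order.TTheory GRing.Theory Num.Theory.
Import numFieldNormedType.Exports.
Local Open Scope classical_set_scope.
Local Open Scope ring_scope.

(* R^3 is R * R * R, and R^4, with points (x, t), is R * R * R * R.  The library
   puts the max norm on these products; wherever the Euclidean structure
   matters it is written out with dot4. *)

Section ComplexValued.
Context {R : realType}.

Definition cis (x : R) : R[i] := Complex (cos x) (sin x).

Section Integration.
Context d (T : measurableType d).
Variable mu : {measure set T -> \bar R}.
Implicit Types f : T -> R[i].

Definition cmeasurable f :=
  measurable_fun [set: T] (fun x => complex.Re (f x)) /\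
  measurable_fun [set: T] (fun x => complex.Im (f x)).

Definition cintegrable f :=
  mu.-integrable [set: T] (fun x => (complex.Re (f x))%:E) /\
  mu.-integrable [set: T] (fun x => (complex.Im (f x))%:E).

Definition cintegral (D : set T) f : R[i] :=
  Complex (Rintegral mu D (fun x => complex.Re (f x)))
          (Rintegral mu D (fun x => complex.Im (f x))).

Definition cLnorm (p : \bar R) f : \bar R :=
  Lnorm mu p (fun x => (Normc.normc (f x))%:E).

Definition inLp (p : \bar R) f := cmeasurable f /\ (cLnorm p f < +oo)%E.

End Integration.

Section Smoothness.
Variable V : normedModType R.

Fixpoint iter_derive (vs : seq V) (f : V -> R) : V -> R :=
  if vs is v :: vs' then (fun x => 'D_v (iter_derive vs' f) x) else f.

Definition smooth (f : V -> R) :=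
  forall (vs : seq V) (x : V), differentiable (iter_derive vs f) x.

Definition csmooth (f : V -> R[i]) :=
  smooth (fun x => complex.Re (f x)) /\ smooth (fun x => complex.Im (f x)).

End Smoothness.

(* The class C_c^oo(0, oo), its members being extended by 0 to the line. *)
Definition Cc_smooth_pos (chi : R -> R[i]) :=
  [/\ csmooth chi,
      compact (closure [set t | chi t != 0]) &
      closure [set t | chi t != 0] `<=` [set t | 0 < t] ].

End ComplexValued.

Section Euclidean.
Context {R : realType}.

Definition leb2 := (@lebesgue_measure R \x @lebesgue_measure R)%E.
Definition leb3 := (leb2 \x @lebesgue_measure R)%E.
Definition leb4 := (leb3 \x @lebesgue_measure R)%E.

Definition dot4 (x y : R * R * R * R) : R :=
  x.1.1.1 * y.1.1.1 + x.1.1.2 * y.1.1.2 + x.1.2 * y.1.2 + x.2 * y.2.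

Definition schwartz_real (f : R * R * R * R -> R) :=
  smooth f /\
  forall (k : nat) (vs : seq (R * R * R * R)), exists C : R,
    forall x, (1 + dot4 x x) ^+ k * `|iter_derive vs f x| <= C.

Definition schwartz (phi : R * R * R * R -> R[i]) :=
  schwartz_real (fun x => complex.Re (phi x)) /\
  schwartz_real (fun x => complex.Im (phi x)).

Definition fourier (phi : R * R * R * R -> R[i]) (z : R * R * R * R) : R[i] :=
  cintegral leb4 [set: _] (fun x => phi x * cis (- dot4 x z)).

Definition fourier_inv (phi : R * R * R * R -> R[i]) (x : R * R * R * R)
    : R[i] :=
  real_complex R ((2 * pi) ^- 4) *
  cintegral leb4 [set: _] (fun z => phi z * cis (dot4 x z)).

(* Tempered distributions are represented by their values on test functions,
   and the operations on them are the transposes of those on test functions.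
   Only the values on Schwartz functions are meaningful. *)
Definition functional := (R * R * R * R -> R[i]) -> R[i].

Definition functional_of (F : R * R * R * R -> R[i]) : functional :=
  fun phi => cintegral leb4 [set: _] (fun x => F x * phi x).

Definition tfourier (T : functional) : functional := fun phi => T (fourier phi).

Definition tfourier_inv (T : functional) : functional :=
  fun phi => T (fourier_inv phi).

Definition tmul (m : R * R * R * R -> R[i]) (T : functional) : functional :=
  fun phi => T (fun z => m z * phi z).

Definition bessel_symbol (alpha : R) (z : R * R * R * R) : R[i] :=
  real_complex R ((1 + dot4 z z) `^ (alpha / 2)).

Definition bessel (alpha : R) (T : functional) : functional :=
  tfourier_inv (tmul (bessel_symbol alpha) (tfourier T)).

(* A function F for which all these integrals converge absolutely is measurable
   and automatically defines a continuous functional on the Schwartz space. *)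
Definition tempered (F : R * R * R * R -> R[i]) :=
  forall phi, schwartz phi -> cintegrable leb4 (fun x => F x * phi x).

(* The norm of L^p_alpha(R^4), equal to +oo off the space: the infimum is over
   the representatives G of a single almost-everywhere class, or over the empty
   set. *)
Definition sobolev_norm (p : \bar R) (alpha : R) (F : R * R * R * R -> R[i])
    : \bar R :=
  ereal_inf [set cLnorm leb4 p G | G in
    [set G | [/\ tempered F, inLp leb4 p G &
      forall phi, schwartz phi ->
        bessel alpha (functional_of F) phi = functional_of G phi] ] ].

Definition torus_param (s t theta phi : R) : R * R * R :=
  ((t + s * cos theta) * cos phi, (t + s * cos theta) * sin phi, s * sin theta).

Definition torus_avg (s t : R) (f : R * R * R -> R[i]) (x : R * R * R) : R[i] :=
  cintegral leb2 (`[0, 2 * pi[ `*` `[0, 2 * pi[)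
    (fun w => f (x - torus_param s t w.1 w.2)).

Definition bounded_Lp_sobolev (p : \bar R) (alpha : R)
    (Op : (R * R * R -> R[i]) -> (R * R * R * R -> R[i])) :=
  exists C : R, forall f, inLp leb3 p f ->
    (sobolev_norm p alpha (Op f) <= C%:E * cLnorm leb3 p f)%E.

End Euclidean.

(* Main.v *)
(* Boundedness gives, for each f, a function G in L^p with |G|_p <= C |f|_p that
   represents the Bessel potential of F = chi0 A f.  Pairing G with Gaussians of
   width sqrt u modulated by a frequency zeta, and integrating over the heat
   time u, where int_0^oo u^(alpha/2 - 1) e^(-u (1 + |z|^2)) du is a multiple of
   (1 + |z|^2)^(-alpha/2), bounds the integral of F against a Gaussian of
   variance tau at frequency zeta by C tau^2 |f|_p times an integral which decays
   in zeta and grows slowly as tau tends to 0.  Only Hoelder's inequality is used.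

   For alpha > 3/p, take for f the indicator of a neighbourhood of width
   delta = sqrt tau of the reflected torus: A f is of size 1 near (0, t0) while
   |f|_p is of size delta^(1/p).

   For alpha > 1/2, take f = e^(i lambda x_3) on a large box, tested at the
   frequency lambda (0, 0, 1, - c0) and at the point (0, 0, c0 t0, t0).  The
   phase lambda c0 t (1 - sin theta) is stationary at theta = pi/2.  Summing over
   lambda = j - k with j, k < n turns the integrand into the nonnegative square
   of a Dirichlet kernel, of size n^2 on an interval of length n^(-1/2), so the
   sum is at least of order n^(3/2), up to powers of tau.  The upper bounds sum
   to n^(2 - g) with g > 1/2, and tau = n^(-epsilon) gives a contradiction. *)

Require Import Defs.
From HB Require Import structures.
From mathcomp Require Import all_boot all_order all_algebra.
From mathcomp Require Import complex.
From mathcomp Require Import all_classical all_reals all_analysis.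
From mathcomp Require Import measurable_realfun ring lra zify.
Import Order.TTheory GRing.Theory Num.Theory.
Import numFieldNormedType.Exports.
Set Implicit Arguments.
Unset Strict Implicit.
Unset Printing Implicit Defensive.
Local Open Scope classical_set_scope.
Local Open Scope ring_scope.

(** * Complex-valued integrals *)

(** The Sobolev norm is defined through functionals, so nothing is known of [G] beyond its norm and
    its pairings with Schwartz functions. Gaussians keep these pairings explicit: a product of two
    Gaussians is a Gaussian, and completing the square leaves a factor
    [exp (- tau u / (tau + u) |zeta|^2)], the source of all decay in the frequency.

    Exponents: at heat time [u] Hoelder's inequality costs [(tau + u)^(-2/p)], at most
    [tau^(-A) u^(-B)] with [A + B = 2/p], and the Gamma integral tolerates [B < alpha/2]. The
    indicator has norm of order [tau^(1/(2p))], so a contradiction needs [A < 1/(2p)], hence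
    [B > 3/(2p)]: this is the threshold [3/p]. For the waves the norm does not depend on [lambda]
    and the bound decays like [|lambda|^(-2b)] with [b < alpha/2], against an oscillatory integral
    of size [|lambda|^(-1/2)]: this is the threshold [1/2].

    A single [lambda] would require stationary phase asymptotics, uniform in [x]. After the
    summation the integrand is nonnegative, and one region where the kernel is large suffices. *)

Section ComplexModulus.
Context {R : realType}.
Implicit Types z w : R[i].

Lemma cReM z w : complex.Re (z * w) =
  complex.Re z * complex.Re w - complex.Im z * complex.Im w.
Proof. by case: z w => [a b] [c d]. Qed.

Lemma cImM z w : complex.Im (z * w) =
  complex.Re z * complex.Im w + complex.Im z * complex.Re w.
Proof. by case: z w => [a b] [c d]. Qed.

Lemma cReD z w : complex.Re (z + w) = complex.Re z + complex.Re w.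
Proof. by case: z w => [a b] [c d]. Qed.

Lemma cImD z w : complex.Im (z + w) = complex.Im z + complex.Im w.
Proof. by case: z w => [a b] [c d]. Qed.

Lemma normc_sqrtE z :
  Normc.normc z = Num.sqrt (complex.Re z ^+ 2 + complex.Im z ^+ 2).
Proof. by case: z. Qed.

Lemma normc_ge0 z : 0 <= Normc.normc z.
Proof. by rewrite normc_sqrtE sqrtr_ge0. Qed.

Lemma normc_Re z : `|complex.Re z| <= Normc.normc z.
Proof.
by rewrite normc_sqrtE -sqrtr_sqr ler_wsqrtr// lerDl sqr_ge0.
Qed.

Lemma normc_Im z : `|complex.Im z| <= Normc.normc z.
Proof.
by rewrite normc_sqrtE -sqrtr_sqr ler_wsqrtr// lerDr sqr_ge0.
Qed.

Lemma normc_le_ReIm z :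
  Normc.normc z <= `|complex.Re z| + `|complex.Im z|.
Proof.
rewrite normc_sqrtE -[leRHS]ger0_norm ?addr_ge0// -sqrtr_sqr ler_wsqrtr//.
rewrite sqrrD !real_normK ?num_real// lerD2r lerDl.
by rewrite mulrn_wge0// mulr_ge0.
Qed.

Lemma normc_real (x : R) : Normc.normc (real_complex R x) = `|x|.
Proof. by rewrite normc_sqrtE/= expr0n/= addr0 sqrtr_sqr. Qed.

Lemma normc_cis (x : R) : Normc.normc (cis x) = 1.
Proof. by rewrite normc_sqrtE/= cos2Dsin2 sqrtr1. Qed.

Lemma cisD (x y : R) : cis (x + y) = cis x * cis y.
Proof.
apply/eqP; rewrite eq_complex cReM cImM/= sinD cosD eqxx/=.
by rewrite [X in _ == X]addrC.
Qed.

Lemma cis0 : cis (0 : R) = 1.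
Proof. by rewrite /cis cos0 sin0. Qed.

End ComplexModulus.

Section ComplexIntegral.
Context {R : realType} d (T : measurableType d) (mu : {measure set T -> \bar R}).
Implicit Types (f g : T -> R[i]) (h : T -> R).

Lemma cmeasurableM f g :
  cmeasurable f -> cmeasurable g -> cmeasurable (fun x => f x * g x).
Proof.
move=> [f1 f2] [g1 g2]; split.
- under eq_fun do rewrite cReM.
  by apply: measurable_funB; exact: measurable_funM.
- under eq_fun do rewrite cImM.
  by apply: measurable_funD; exact: measurable_funM.
Qed.

Lemma cmeasurable_cst (c : R[i]) : cmeasurable (fun _ : T => c).
Proof. by split; exact: measurable_cst. Qed.

Lemma cmeasurable_real h :
  measurable_fun [set: T] h -> cmeasurable (fun x => real_complex R (h x)).
Proof. by move=> mh; split => //=; exact: measurable_cst. Qed.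

Lemma cmeasurable_cis h :
  measurable_fun [set: T] h -> cmeasurable (fun x => cis (h x)).
Proof.
move=> mh; split => /=.
- apply: (measurableT_comp _ mh); apply: continuous_measurable_fun.
  exact: continuous_cos.
- apply: (measurableT_comp _ mh); apply: continuous_measurable_fun.
  exact: continuous_sin.
Qed.

Lemma cmeasurable_normc f :
  cmeasurable f -> measurable_fun [set: T] (fun x => Normc.normc (f x)).
Proof.
move=> [f1 f2]; under eq_fun do rewrite normc_sqrtE.
apply: (measurableT_comp (continuous_measurable_fun (@sqrt_continuous R))).
by apply: measurable_funD; exact: measurable_funX.
Qed.

Lemma cmeasurable_comp d' (T' : measurableType d') (k : T' -> T) f :
  measurable_fun [set: T'] k -> cmeasurable f -> cmeasurable (f \o k).
Proof.
move=> mk [f1 f2]; split.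
- exact: (measurableT_comp f1 mk).
- exact: (measurableT_comp f2 mk).
Qed.

Lemma cintegrable_measurable f : cintegrable mu f -> cmeasurable f.
Proof.
by case=> /measurable_int/measurable_EFinP f1 /measurable_int/measurable_EFinP.
Qed.

Lemma integrable_le h (g : T -> R) : measurable_fun [set: T] h ->
  (forall x, `|h x| <= g x) -> mu.-integrable setT (EFin \o g) ->
  mu.-integrable setT (EFin \o h).
Proof.
move=> mh hg ig; apply: (le_integrable measurableT _ _ ig) => [|x _ /=].
  exact/measurable_EFinP.
by rewrite lee_fin (le_trans (hg x))// ler_norm.
Qed.

Lemma cintegrable_le f (g : T -> R) : cmeasurable f ->
  (forall x, Normc.normc (f x) <= g x) -> mu.-integrable setT (EFin \o g) ->
  cintegrable mu f.
Proof.
move=> [f1 f2] fg ig; split.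
- by apply: (integrable_le f1 _ ig) => x; exact: le_trans (normc_Re _) (fg x).
- by apply: (integrable_le f2 _ ig) => x; exact: le_trans (normc_Im _) (fg x).
Qed.

Lemma cintegrable_normc f : cintegrable mu f ->
  mu.-integrable setT (EFin \o (fun x => Normc.normc (f x))).
Proof.
move=> fi; have [fi1 fi2] := fi.
apply: (@integrable_le _ (fun x => `|complex.Re (f x)| + `|complex.Im (f x)|)).
- exact/cmeasurable_normc/cintegrable_measurable.
- by move=> x; rewrite ger0_norm ?normc_ge0// normc_le_ReIm.
- have := integrableD measurableT (integrable_norm fi1) (integrable_norm fi2).
  by apply: eq_integrable.
Qed.

Lemma cintegrable_real h : mu.-integrable setT (EFin \o h) ->
  cintegrable mu (fun x => real_complex R (h x)).
Proof. by move=> ih; split => //=; exact: integrable0. Qed.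

Lemma cintegrableZl (c : R[i]) f :
  cintegrable mu f -> cintegrable mu (fun x => c * f x).
Proof.
move=> fi; apply: (@cintegrable_le _ (fun x => Normc.normc c * Normc.normc (f x))).
- exact/cmeasurableM/cintegrable_measurable/fi/cmeasurable_cst.
- by move=> x; rewrite Normc.normcM.
- have := integrableZl measurableT (Normc.normc c) (cintegrable_normc fi).
  by apply: eq_integrable.
Qed.

Lemma cintegralZl (c : R[i]) f :
  cintegrable mu f ->
  cintegral mu setT (fun x => c * f x) = c * cintegral mu setT f.
Proof.
move=> fi; have [fi1 fi2] := fi; apply/eqP; rewrite eq_complex cReM cImM/=.
apply/andP; split; apply/eqP.
- under eq_Rintegral do rewrite cReM.
  rewrite RintegralB//; last 2 first.
  - by have := integrableZl measurableT (complex.Re c) fi1; apply: eq_integrable.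
  - by have := integrableZl measurableT (complex.Im c) fi2; apply: eq_integrable.
  by rewrite !RintegralZl.
- under eq_Rintegral do rewrite cImM.
  rewrite RintegralD//; last 2 first.
  - by have := integrableZl measurableT (complex.Re c) fi2; apply: eq_integrable.
  - by have := integrableZl measurableT (complex.Im c) fi1; apply: eq_integrable.
  by rewrite !RintegralZl.
Qed.

Lemma cintegrableD f g : cintegrable mu f -> cintegrable mu g ->
  cintegrable mu (fun x => f x + g x).
Proof.
move=> [f1 f2] [g1 g2]; split.
- under eq_fun do rewrite cReD.
  by have := integrableD measurableT f1 g1; apply: eq_integrable.
- under eq_fun do rewrite cImD.
  by have := integrableD measurableT f2 g2; apply: eq_integrable.
Qed.

Lemma cintegralD f g : cintegrable mu f -> cintegrable mu g ->
  cintegral mu setT (fun x => f x + g x) =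
  cintegral mu setT f + cintegral mu setT g.
Proof.
move=> [f1 f2] [g1 g2]; apply/eqP; rewrite eq_complex cReD cImD/=.
apply/andP; split; apply/eqP.
- by under eq_Rintegral do rewrite cReD; rewrite RintegralD.
- by under eq_Rintegral do rewrite cImD; rewrite RintegralD.
Qed.

Lemma eq_cintegral (D : set T) f g : {in D, f =1 g} ->
  cintegral mu D f = cintegral mu D g.
Proof.
by move=> fg; rewrite /cintegral; congr Complex;
  apply: eq_Rintegral => x xD; rewrite fg.
Qed.

Lemma cintegral_real (D : set T) h :
  cintegral mu D (fun x => real_complex R (h x)) =
  real_complex R (Rintegral mu D h).
Proof.
rewrite /cintegral/=; congr Complex.
by rewrite /Rintegral integral0_eq.
Qed.

Lemma cintegrable_sum (I : Type) (s : seq I) (F : I -> T -> R[i]) :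
  (forall i, cintegrable mu (F i)) ->
  cintegrable mu (fun x => \sum_(i <- s) F i x).
Proof.
move=> iF; elim: s => [|i s ih].
  under eq_fun do rewrite big_nil.
  by split; exact: integrable0.
by under eq_fun do rewrite big_cons; exact: cintegrableD.
Qed.

Lemma cintegral_sum (I : Type) (s : seq I) (F : I -> T -> R[i]) :
  (forall i, cintegrable mu (F i)) ->
  cintegral mu setT (fun x => \sum_(i <- s) F i x) =
  \sum_(i <- s) cintegral mu setT (F i).
Proof.
move=> iF; elim: s => [|i s ih].
  rewrite big_nil; under eq_cintegral do rewrite big_nil.
  by rewrite (cintegral_real setT (fun=> 0)) /Rintegral integral0.
rewrite big_cons -ih -cintegralD//; last exact: cintegrable_sum.
by apply: eq_cintegral => x _; rewrite big_cons.
Qed.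

(** Real and imaginary parts are estimated separately, whence the factor 2; constants are irrelevant
    for what follows. *)
Lemma le_normc_cintegral f (g : T -> R) : cmeasurable f ->
  (forall x, Normc.normc (f x) <= g x) -> mu.-integrable setT (EFin \o g) ->
  Normc.normc (cintegral mu setT f) <= 2 * Rintegral mu setT g.
Proof.
move=> mf fg ig; have [f1 f2] := cintegrable_le mf fg ig.
apply: le_trans (normc_le_ReIm _) _; rewrite mulr_natl mulr2n/=.
apply: lerD; apply: le_trans (le_normr_Rintegral measurableT _) _ => //;
  apply: le_Rintegral => //; try exact: integrable_norm.
- by move=> x _; exact: le_trans (normc_Re _) (fg x).
- by move=> x _; exact: le_trans (normc_Im _) (fg x).
Qed.

Lemma cintegral_mkcond (D : set T) f :
  cintegral mu D f = cintegral mu setT (fun x => real_complex R (\1_D x) * f x).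
Proof.
rewrite /cintegral; congr Complex; rewrite Rintegral_mkcond;
  apply: eq_Rintegral => x _; rewrite ?cReM ?cImM/= mul0r ?subr0 ?addr0;
  by rewrite patchE indicE; case: ifP => _; rewrite ?mul1r ?mul0r.
Qed.

End ComplexIntegral.

Lemma le_fine_abse (R : realType) (x : \bar R) : (`|(fine x)%:E| <= `|x|)%E.
Proof. by case: x => [r| |]//=; rewrite ?normr0 ?leey. Qed.

(** * Fubini's theorem for complex-valued functions *)

Section ComplexFubini.
Context {R : realType} d1 d2 (T1 : measurableType d1) (T2 : measurableType d2).
Variables (m1 : {sigma_finite_measure set T1 -> \bar R}).
Variables (m2 : {sigma_finite_measure set T2 -> \bar R}).

(** Almost every section is integrable, so [fine] loses nothing there; on the exceptional null set
    the inner integral is a mere convention. *)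
Let Rfubini_ae (h : T1 * T2 -> R) :
  (m1 \x m2)%E.-integrable setT (EFin \o h) ->
  {ae m1, forall x, fubini_F m2 (EFin \o h) x =
     (Rintegral m2 setT (fun y => h (x, y)))%:E}.
Proof.
move=> ih; have := ae_integrable1 ih.
apply: filterS => x ix; rewrite /Rintegral fineK//.
exact: integrable_fin_num ix.
Qed.

Let Rfubini_ae2 (h : T1 * T2 -> R) :
  (m1 \x m2)%E.-integrable setT (EFin \o h) ->
  {ae m2, forall y, fubini_G m1 (EFin \o h) y =
     (Rintegral m1 setT (fun x => h (x, y)))%:E}.
Proof.
move=> ih; have := ae_integrable2 ih.
apply: filterS => x ix; rewrite /Rintegral fineK//.
exact: integrable_fin_num ix.
Qed.

Lemma measurable_Rfubini1 (h : T1 * T2 -> R) :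
  (m1 \x m2)%E.-integrable setT (EFin \o h) ->
  measurable_fun setT (fun x => Rintegral m2 setT (fun y => h (x, y))).
Proof.
move=> ih; apply: (measurableT_comp (@fine_measurable R setT measurableT)).
exact: measurable_fubini_F ih.
Qed.

Lemma measurable_Rfubini2 (h : T1 * T2 -> R) :
  (m1 \x m2)%E.-integrable setT (EFin \o h) ->
  measurable_fun setT (fun y => Rintegral m1 setT (fun x => h (x, y))).
Proof.
move=> ih; apply: (measurableT_comp (@fine_measurable R setT measurableT)).
exact: measurable_fubini_G ih.
Qed.

Lemma integrable_Rfubini1 (h : T1 * T2 -> R) :
  (m1 \x m2)%E.-integrable setT (EFin \o h) ->
  m1.-integrable setT (EFin \o (fun x => Rintegral m2 setT (fun y => h (x, y)))).
Proof.
move=> ih; apply: (le_integrable measurableT _ _ (integrable_fubini_F ih)).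
- exact/measurable_EFinP/measurable_Rfubini1.
- by move=> x _; exact: le_fine_abse.
Qed.

Lemma integrable_Rfubini2 (h : T1 * T2 -> R) :
  (m1 \x m2)%E.-integrable setT (EFin \o h) ->
  m2.-integrable setT (EFin \o (fun y => Rintegral m1 setT (fun x => h (x, y)))).
Proof.
move=> ih; apply/integrableP; split.
  exact/measurable_EFinP/measurable_Rfubini2.
have mh := measurable_int _ ih.
apply: le_lt_trans ((integrable21ltyP m1 m2 mh).1 ih).
apply: ge0_le_integral => //.
- by apply: measurableT_comp => //; exact/measurable_EFinP/measurable_Rfubini2.
- have := @measurable_fun_fubini_tonelli_G _ _ T1 T2 R m1 (abse \o (EFin \o h)).
  apply; first exact: (measurableT_comp (@abse_measurable R _) mh).
  by move=> x; exact: abse_ge0.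
- move=> y _; apply: le_trans (le_fine_abse _) _.
  by apply: le_abse_integral => //; apply: (measurableT_comp mh).
Qed.

Lemma Rfubini1 (h : T1 * T2 -> R) :
  (m1 \x m2)%E.-integrable setT (EFin \o h) ->
  Rintegral m1 setT (fun x => Rintegral m2 setT (fun y => h (x, y))) =
  Rintegral (m1 \x m2)%E setT h.
Proof.
move=> ih; congr fine; rewrite -integral12_prod_meas1//.
apply: ae_eq_integral => //.
- exact/measurable_EFinP/measurable_Rfubini1.
- exact: (measurable_fubini_F ih).
- by apply: filterS (Rfubini_ae ih) => x <-.
Qed.

Lemma Rfubini2 (h : T1 * T2 -> R) :
  (m1 \x m2)%E.-integrable setT (EFin \o h) ->
  Rintegral m2 setT (fun y => Rintegral m1 setT (fun x => h (x, y))) =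
  Rintegral (m1 \x m2)%E setT h.
Proof.
move=> ih; congr fine; rewrite -integral21_prod_meas1//.
apply: ae_eq_integral => //.
- exact/measurable_EFinP/measurable_Rfubini2.
- exact: (measurable_fubini_G ih).
- by apply: filterS (Rfubini_ae2 ih) => x <-.
Qed.

Variable f : T1 * T2 -> R[i].
Hypothesis fi : cintegrable (m1 \x m2)%E f.

Lemma cintegrable_fubini1 :
  cintegrable m1 (fun x => cintegral m2 setT (fun y => f (x, y))).
Proof.
case: fi => f1 f2; split.
- exact: (integrable_Rfubini1 f1).
- exact: (integrable_Rfubini1 f2).
Qed.

Lemma cintegrable_fubini2 :
  cintegrable m2 (fun y => cintegral m1 setT (fun x => f (x, y))).
Proof.
case: fi => f1 f2; split.
- exact: (integrable_Rfubini2 f1).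
- exact: (integrable_Rfubini2 f2).
Qed.

Lemma cfubini1 :
  cintegral m1 setT (fun x => cintegral m2 setT (fun y => f (x, y))) =
  cintegral (m1 \x m2)%E setT f.
Proof.
by case: fi => f1 f2; rewrite /cintegral/= (Rfubini1 f1) (Rfubini1 f2).
Qed.

Lemma cfubini2 :
  cintegral m2 setT (fun y => cintegral m1 setT (fun x => f (x, y))) =
  cintegral (m1 \x m2)%E setT f.
Proof.
by case: fi => f1 f2; rewrite /cintegral/= (Rfubini2 f1) (Rfubini2 f2).
Qed.

Lemma cfubini :
  cintegral m1 setT (fun x => cintegral m2 setT (fun y => f (x, y))) =
  cintegral m2 setT (fun y => cintegral m1 setT (fun x => f (x, y))).
Proof. by rewrite cfubini1 cfubini2. Qed.

End ComplexFubini.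

Section ProductFunctions.
Context {R : realType} d1 d2 (T1 : measurableType d1) (T2 : measurableType d2).
Variables (m1 : {sigma_finite_measure set T1 -> \bar R}).
Variables (m2 : {sigma_finite_measure set T2 -> \bar R}).

Lemma integrable_prodM (f : T1 -> R) (g : T2 -> R) :
  m1.-integrable setT (EFin \o f) -> m2.-integrable setT (EFin \o g) ->
  (m1 \x m2)%E.-integrable setT (EFin \o (fun x => f x.1 * g x.2)).
Proof.
move=> fi gi.
have mf : measurable_fun setT f by exact/measurable_EFinP/(measurable_int _ fi).
have mg : measurable_fun setT g by exact/measurable_EFinP/(measurable_int _ gi).
apply/integrable12ltyP.
  by apply/measurable_EFinP/measurable_funM; exact: measurableT_comp.
have -> : (\int[m1]_x \int[m2]_y `|(EFin \o (fun x => f x.1 * g x.2)%R) (x, y)|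
    = \int[m1]_x (`|(f x)%:E| * \int[m2]_y `|(g y)%:E|))%E.
  apply: eq_integral => x _ /=; rewrite -ge0_integralZl//=.
  - by apply: eq_integral => y _; rewrite normrM EFinM.
  - exact/measurable_EFinP/measurableT_comp.
have [_ gfin] := integrableP _ _ _ gi.
have [_ ffin] := integrableP _ _ _ fi.
rewrite ge0_integralZr//; last 2 first.
- exact/measurable_EFinP/measurableT_comp.
- exact: integral_ge0.
by rewrite lte_mul_pinfty// ?integral_ge0// ge0_fin_numE// integral_ge0.
Qed.

Lemma cintegrable_prodM (f : T1 -> R[i]) (g : T2 -> R[i]) :
  cintegrable m1 f -> cintegrable m2 g ->
  cintegrable (m1 \x m2)%E (fun x => f x.1 * g x.2).
Proof.
move=> fi gi.
apply: (@cintegrable_le _ _ _ _ _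
  (fun x => Normc.normc (f x.1) * Normc.normc (g x.2))).
- apply: cmeasurableM.
  + apply: (@cmeasurable_comp _ _ _ _ _ fst) => //.
    exact: cintegrable_measurable fi.
  + apply: (@cmeasurable_comp _ _ _ _ _ snd) => //.
    exact: cintegrable_measurable gi.
- by move=> x; rewrite Normc.normcM.
- exact: (integrable_prodM (cintegrable_normc fi) (cintegrable_normc gi)).
Qed.

Lemma cintegral_prodM (f : T1 -> R[i]) (g : T2 -> R[i]) :
  cintegrable m1 f -> cintegrable m2 g ->
  cintegral (m1 \x m2)%E setT (fun x => f x.1 * g x.2) =
  cintegral m1 setT f * cintegral m2 setT g.
Proof.
move=> fi gi; rewrite -cfubini1/=; last exact: cintegrable_prodM.
under eq_cintegral do rewrite cintegralZl//.
under eq_cintegral do rewrite mulrC.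
by rewrite cintegralZl// mulrC.
Qed.

End ProductFunctions.

(** * Gaussians and their Fourier transforms *)

Section Gauss1D.
Context {R : realType}.
Notation mu := (@lebesgue_measure R).

Definition gauss_ker (a y x : R) : R := expR (- (a * (x - y) ^+ 2)).

Lemma gauss_ker_ge0 a y x : 0 <= gauss_ker a y x.
Proof. exact: expR_ge0. Qed.

(** A multiple of the normal density of mean [y] and variance [1 / (2 a)]: integrability and the
    mass [sqrt (pi / a)] are inherited from it. *)
Let gauss_ker_normal (a y : R) : 0 < a ->
  gauss_ker a y = (fun x => Num.sqrt (pi / a) * normal_pdf y (Num.sqrt (2 * a)^-1) x).
Proof.
move=> a0; apply/funext => x.
have s0 : Num.sqrt (2 * a)^-1 != 0 by rewrite gt_eqF// sqrtr_gt0 invr_gt0 mulr_gt0.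
have sq : Num.sqrt (2 * a)^-1 ^+ 2 = (2 * a)^-1.
  by rewrite sqr_sqrtr// invr_ge0 mulr_ge0// ltW.
rewrite normal_pdfE// /normal_peak /normal_fun sq.
have -> : (2 * a)^-1 * pi *+ 2 = pi / a.
  by rewrite -mulr_natr; field; rewrite gt_eqF.
rewrite mulrA divff ?mul1r; last by rewrite gt_eqF// sqrtr_gt0 divr_gt0// pi_gt0.
by congr expR; rewrite -mulr_natr; field; rewrite gt_eqF.
Qed.

Lemma continuous_gauss_ker (a y : R) : continuous (gauss_ker a y).
Proof.
move=> x; apply: continuous_comp; last exact: continuous_expR.
apply: continuousN; apply: continuousM; first exact: cst_continuous.
apply: (@continuous_comp _ _ _ (fun x => x - y) (fun x => x ^+ 2)).
  by apply: cvgB; [exact: cvg_id|exact: cvg_cst].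
exact: exprn_continuous.
Qed.

Lemma integrable_gauss_ker (a y : R) : 0 < a ->
  mu.-integrable setT (EFin \o gauss_ker a y).
Proof.
move=> a0; rewrite gauss_ker_normal//.
have := integrableZl measurableT (Num.sqrt (pi / a)) (integrable_normal_pdf y (Num.sqrt (2 * a)^-1)).
by apply: eq_integrable.
Qed.

Lemma Rintegral_gauss_ker (a y : R) : 0 < a ->
  Rintegral mu setT (gauss_ker a y) = Num.sqrt (pi / a).
Proof.
move=> a0; rewrite gauss_ker_normal// RintegralZl//; last first.
  exact: integrable_normal_pdf.
by rewrite /Rintegral integral_normal_pdf mulr1.
Qed.

Lemma Rintegral_translate (G : R -> R) (h : R) : continuous G ->
  (forall x, 0 <= G x) ->
  Rintegral mu setT (fun x => G (x + h)) = Rintegral mu setT G.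
Proof.
move=> cG G0; rewrite /Rintegral; congr fine.
have dF : forall x : R, is_derive x 1 (fun x => x + h) 1.
  by move=> x; apply: is_derive_eq; rewrite addr0.
have dF1 : (fun x : R => x + h)^`()%classic = cst 1.
  by apply/funext => x; rewrite derive1E derive_val.
rewrite (@increasing_ge0_integration_by_substitutionT R (fun x => x + h) G)//=.
- by apply: eq_integral => x _; rewrite dF1 /= mulr1.
- by move=> x y; rewrite ltrD2r.
- by rewrite dF1; exact: cst_continuous.
- by rewrite dF1; exact: is_cvg_cst.
- by rewrite dF1; exact: is_cvg_cst.
- exact: cvg_addrr_Ny.
- exact: cvg_addrr.
Qed.


(** Half of the exponent pays for the linear factor, by [|t| <= (1 + t^2) / 2] and [1 + s <= e^s].
    This provides the dominating functions for differentiation under the integral sign. *)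
Lemma gauss_ker_linear_le (a K x y : R) : 0 < a -> 0 <= K ->
  (1 + K * `|x - y|) * gauss_ker a y x
  <= (1 + K) * (1 + a^-1) * gauss_ker (a / 2) y x.
Proof.
move=> a0 K0; set t := x - y.
have -> : gauss_ker a y x = expR (- (a / 2 * t ^+ 2)) * gauss_ker (a / 2) y x.
  by rewrite /gauss_ker -expRD; congr expR; rewrite /t; field.
rewrite mulrA ler_wpM2r ?gauss_ker_ge0// expRN ler_pdivrMr ?expR_gt0//.
have t2 : a / 2 * t ^+ 2 + 1 <= expR (a / 2 * t ^+ 2).
  by rewrite addrC; exact: expR_ge1Dx.
have tn : `|t| <= (1 + t ^+ 2) / 2.
  have := sqr_ge0 (`|t| - 1); rewrite sqrrB1 real_normK ?num_real//; lra.
have n0 := normr_ge0 t.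
have A0 : 0 < a^-1 by rewrite invr_gt0.
have h : (1 + t ^+ 2) / 2 <= (1 + a^-1) * (a / 2 * t ^+ 2 + 1).
  have -> : (1 + a^-1) * (a / 2 * t ^+ 2 + 1) =
    a / 2 * t ^+ 2 + 1 + (t ^+ 2 / 2 + a^-1).
    by field; rewrite gt_eqF.
  have := sqr_ge0 t => t20.
  have : 0 <= a / 2 * t ^+ 2 by rewrite mulr_ge0// ltW// divr_gt0.
  lra.
have h1 : 1 <= (1 + a^-1) * (a / 2 * t ^+ 2 + 1).
  rewrite -[leLHS]mulr1 ler_pM//; first by rewrite lerDl ltW.
  by rewrite lerDr mulr_ge0 ?sqr_ge0// ltW// divr_gt0.
apply: (@le_trans _ _ ((1 + K) * ((1 + a^-1) * (a / 2 * t ^+ 2 + 1)))).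
  rewrite mulrDl mul1r lerD// ler_wpM2l//.
  exact: le_trans tn h.
rewrite -[leRHS]mulrA ler_wpM2l ?addr_ge0// ler_wpM2l// addr_ge0// ltW//.
Qed.

Section ODE.
Variables (a y c : R).
Hypothesis a0 : 0 < a.

Let g (b : R) := Rintegral mu setT (fun x => gauss_ker a y x * cos (b * (x - y) + c)).

Lemma continuous_gauss_cos (b e : R) :
  continuous (fun x => gauss_ker a y x * cos (b * (x - y) + e)).
Proof.
move=> x; apply: cvgM; first exact: continuous_gauss_ker.
apply: (@continuous_comp _ _ _ (fun x => b * (x - y) + e) cos).
  apply: cvgD; last exact: cvg_cst.
  apply: cvgM; first exact: cvg_cst.
  by apply: cvgB; [exact: cvg_id|exact: cvg_cst].
exact: continuous_cos.
Qed.

Lemma continuous_gauss_sin (b e : R) :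
  continuous (fun x => gauss_ker a y x * sin (b * (x - y) + e)).
Proof.
move=> x; apply: cvgM; first exact: continuous_gauss_ker.
apply: (@continuous_comp _ _ _ (fun x => b * (x - y) + e) sin).
  apply: cvgD; last exact: cvg_cst.
  apply: cvgM; first exact: cvg_cst.
  by apply: cvgB; [exact: cvg_id|exact: cvg_cst].
exact: continuous_sin.
Qed.

Lemma integrable_gauss_cos (b e : R) :
  mu.-integrable setT (EFin \o (fun x => gauss_ker a y x * cos (b * (x - y) + e))).
Proof.
apply: (integrable_le _ _ (integrable_gauss_ker y a0)).
  by apply: continuous_measurable_fun; exact: continuous_gauss_cos.
move=> x; rewrite normrM ger0_norm ?gauss_ker_ge0// ler_piMr ?gauss_ker_ge0//.
by rewrite cos_max.
Qed.

Lemma integrable_gauss_sin (b e : R) :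
  mu.-integrable setT (EFin \o (fun x => gauss_ker a y x * sin (b * (x - y) + e))).
Proof.
apply: (integrable_le _ _ (integrable_gauss_ker y a0)).
  by apply: continuous_measurable_fun; exact: continuous_gauss_sin.
move=> x; rewrite normrM ger0_norm ?gauss_ker_ge0// ler_piMr ?gauss_ker_ge0//.
by rewrite sin_max.
Qed.

Lemma integrable_xgauss_sin (b e : R) : mu.-integrable setT
  (EFin \o (fun x => (x - y) * gauss_ker a y x * sin (b * (x - y) + e))).
Proof.
have a20 : 0 < a / 2 by rewrite divr_gt0.
apply: (@integrable_le _ _ _ mu _ (fun x => (1 + 1) * (1 + a^-1) * gauss_ker (a / 2) y x)).
- under eq_fun do rewrite -mulrA.
  apply: continuous_measurable_fun => x.
  apply: cvgM; first by apply: cvgB; [exact: cvg_id|exact: cvg_cst].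
  exact: continuous_gauss_sin.
- move=> x; apply: le_trans (gauss_ker_linear_le x y a0 ler01).
  rewrite !normrM (ger0_norm (gauss_ker_ge0 _ _ _)).
  apply: (@le_trans _ _ (`|x - y| * gauss_ker a y x)).
    by rewrite ler_piMr ?sin_max// mulr_ge0 ?gauss_ker_ge0.
  by rewrite ler_wpM2r ?gauss_ker_ge0// mul1r lerDr.
- have := integrableZl measurableT ((1 + 1) * (1 + a^-1)) (integrable_gauss_ker y a20).
  by apply: eq_integrable.
Qed.

Let is_derive_gauss_sin (b e x h : R) :
  is_derive h 1 (fun h => gauss_ker a y (x + h) * sin (b * (x + h - y) + e))
   (gauss_ker a y (x + h) * (b * cos (b * (x + h - y) + e)
     - 2 * a * (x + h - y) * sin (b * (x + h - y) + e))).
Proof.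
have d1 : is_derive h 1 (fun h : R => x + h - y) 1.
  by apply: is_derive_eq; ring.
have d2 : is_derive h 1 (fun h : R => - (a * (x + h - y) ^+ 2)) (- (2 * a * (x + h - y))).
  by apply: is_derive_eq; rewrite /GRing.scale/=; ring.
have d3 := is_derive1_comp (is_derive_expR _) d2.
have d4 : is_derive h 1 (fun h : R => b * (x + h - y) + e) b.
  by apply: is_derive_eq; rewrite /GRing.scale/=; ring.
have d5 := is_derive1_comp (is_derive_sin _) d4.
have := is_deriveM d3 d5.
rewrite /gauss_ker /comp /= => d; apply: (is_derive_eq d).
rewrite /GRing.scale/=; ring.
Qed.

Let is_derive_gauss_cos (b x : R) :
  is_derive b 1 (fun b => gauss_ker a y x * cos (b * (x - y) + c))
   (- ((x - y) * gauss_ker a y x * sin (b * (x - y) + c))).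
Proof.
have d4 : is_derive b 1 (fun b : R => b * (x - y) + c) (x - y).
  by apply: is_derive_eq; rewrite /GRing.scale/=; ring.
have d5 := is_derive1_comp (is_derive_cos _) d4.
have := is_deriveZ (gauss_ker a y x) d5.
rewrite /comp/= => d; apply: (is_derive_eq d).
rewrite /GRing.scale/=; ring.
Qed.

(** Completing the square. The domination of a translated integrand has to be uniform in [h] near
    0. *)
Lemma gauss_ker_shift_le (x h : R) : `|h| <= 1 ->
  gauss_ker (a / 2) y (x + h) <= expR (a / 2) * gauss_ker (a / 4) y x.
Proof.
move=> h1; rewrite /gauss_ker -expRD ler_expR.
have h2 : h ^+ 2 <= 1 by rewrite -real_normK ?num_real// expr_le1.
have -> : a / 2 + - (a / 4 * (x - y) ^+ 2) =
   - (a / 2 * (x + h - y) ^+ 2) + a / 4 * ((x - y + 2 * h) ^+ 2 + 2 * (1 - h ^+ 2)).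
  by field.
by rewrite lerDl mulr_ge0// ?divr_ge0 ?(ltW a0)// addr_ge0 ?sqr_ge0// mulr_ge0// subr_ge0.
Qed.

(* The derivative at h = 0 of the integral of H (x + h), which does not depend on
   h, replaces an integration by parts on the whole line. *)
Let gauss_by_parts (b e : R) :
  2 * a * Rintegral mu setT (fun x => (x - y) * gauss_ker a y x * sin (b * (x - y) + e)) =
  b * Rintegral mu setT (fun x => gauss_ker a y x * cos (b * (x - y) + e)).
Proof.
pose H x := gauss_ker a y x * sin (b * (x - y) + e).
pose H' x := gauss_ker a y x * (b * cos (b * (x - y) + e)
     - 2 * a * (x - y) * sin (b * (x - y) + e)).
have trans h : Rintegral mu setT (fun x => H (x + h)) = Rintegral mu setT H.
  have cH := @continuous_gauss_sin b e.
  have iH := @integrable_gauss_sin b e.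
  (* The translation rule is for nonnegative functions: the Gaussian, which dominates [|H|], is
     added, and its own translate is subtracted afterwards. *)
  have cS : continuous (fun x => H x + gauss_ker a y x).
    by move=> x; apply: cvgD; [exact: cH|exact: continuous_gauss_ker].
  have S0 x : 0 <= H x + gauss_ker a y x.
    rewrite -lerBlDr sub0r; apply: lerNnormlW.
    rewrite normrM ger0_norm ?gauss_ker_ge0// ler_piMr ?gauss_ker_ge0//.
    by rewrite sin_max.
  have e1 := Rintegral_translate h cS S0.
  have e2 := Rintegral_translate h (@continuous_gauss_ker a y) (gauss_ker_ge0 a y).
  have gE : (fun x => gauss_ker a y (x + h)) = gauss_ker a (y - h).
    by apply/funext => x; rewrite /gauss_ker opprB addrA.
  have ig := integrable_gauss_ker y a0.
  have igh := integrable_gauss_ker (y - h) a0.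
  rewrite -gE in igh.
  move: e1; rewrite RintegralD//.
  rewrite RintegralD//; first by rewrite e2 => /addIr.
  apply: (@integrable_le _ _ _ mu _ _ _ _ igh).
    apply: continuous_measurable_fun => x.
    apply: (@continuous_comp _ _ _ (fun x => x + h) H); last exact: cH.
    by apply: cvgD; [exact: cvg_id|exact: cvg_cst].
  move=> x; rewrite normrM ger0_norm ?gauss_ker_ge0// ler_piMr ?gauss_ker_ge0//.
  by rewrite sin_max.
have dH h x : partial1of2 (fun h x => H (x + h)) h x = H' (x + h).
  by rewrite partial1of2E; have d := is_derive_gauss_sin b e x h; rewrite derive_val.
pose K := 2 * a + `|b|.
pose M := (`|b| + 1 + K) * (1 + a^-1) * expR (a / 2).
have K0 : 0 <= K by rewrite addr_ge0// mulr_ge0// ltW.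
have a20 : 0 < a / 2 by rewrite divr_gt0.
have a40 : 0 < a / 4 by rewrite divr_gt0.
(* Dominates [H'] at all shifts [|h| <= 1]: absorbing the linear factor halves the rate, absorbing
   the shift halves it again. *)
pose G x := (`|b| + 1) * ((1 + 2 * a) * (1 + a^-1) * (expR (a / 2) * gauss_ker (a / 4) y x)).
have HG h x : `|h| <= 1 -> `|H' (x + h)| <= G x.
  move=> h1; rewrite /H' normrM ger0_norm ?gauss_ker_ge0//.
  have sb : `|b * cos (b * (x + h - y) + e) - 2 * a * (x + h - y) * sin (b * (x + h - y) + e)|
     <= (`|b| + 1) * (1 + 2 * a * `|x + h - y|).
    apply: le_trans (ler_normB _ _) _; rewrite !normrM (ger0_norm (ltW a0)) normr_nat.
    apply: (@le_trans _ _ (`|b| + 2 * a * `|x + h - y|)).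
      apply: lerD; first by rewrite ler_piMr// cos_max.
      by rewrite ler_piMr ?sin_max// mulr_ge0// mulr_ge0// ltW.
    have : 0 <= `|b| by [].
    have : 0 <= `|b| * (2 * a * `|x + h - y|) by rewrite !mulr_ge0// ltW.
    by move=> p1 p2; rewrite mulrDr mulr1 mulrDl mul1r; lra.
  apply: (@le_trans _ _ (gauss_ker a y (x + h) * ((`|b| + 1) * (1 + 2 * a * `|x + h - y|)))).
    by rewrite ler_wpM2l ?gauss_ker_ge0.
  rewrite mulrCA ler_wpM2l ?addr_ge0// mulrC.
  have a2_ge0 : 0 <= 2 * a by rewrite mulr_ge0// ltW.
  apply: le_trans (gauss_ker_linear_le (x + h) y a0 a2_ge0) _.
  rewrite ler_wpM2l ?gauss_ker_shift_le// mulr_ge0// addr_ge0//.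
  by rewrite invr_ge0 ltW.
have iG : mu.-integrable setT (EFin \o G).
  have := integrableZl measurableT ((`|b| + 1) * ((1 + 2 * a) * (1 + a^-1) * expR (a / 2)))
    (integrable_gauss_ker y a40).
  by apply: eq_integrable => // x _ /=; rewrite -EFinM /G !mulrA.
have I0 : (`](-1)%R, 1%R[%classic : set R) 0 by rewrite /= in_itv/= ltrN10 ltr01.
have iHh h : mu.-integrable setT (EFin \o (fun x => H (x + h))).
  have := @integrable_gauss_ker _ (y - h) a0.
  have gE : (fun x => gauss_ker a y (x + h)) = gauss_ker a (y - h).
    by apply/funext => x; rewrite /gauss_ker opprB addrA.
  rewrite -gE => igh.
  apply: (@integrable_le _ _ _ mu _ _ _ _ igh).
    apply: continuous_measurable_fun => x.
    apply: (@continuous_comp _ _ _ (fun x => x + h) H); last exact: continuous_gauss_sin.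
    by apply: cvgD; [exact: cvg_id|exact: cvg_cst].
  move=> x; rewrite normrM ger0_norm ?gauss_ker_ge0// ler_piMr ?gauss_ker_ge0//.
  by rewrite sin_max.
have := @differentiation_under_integral R _ _ mu (fun h x => H (x + h)) setT measurableT
  0 (-1) 1 I0 (fun h _ => iHh h).
move=> /(_ _ G).
have -> : (fun h => Rintegral mu setT (fun x => H (x + h))) = cst (Rintegral mu setT H).
  by apply/funext => h; rewrite trans.
rewrite derive1_cst.
have -> : (fun x => partial1of2 (fun h x => H (x + h)) 0 x) = H'.
  by apply/funext => x; rewrite dH addr0.
move=> /(_ _ _ iG) => D.
have : 0 = Rintegral mu setT H'.
  apply: D.
  - by move=> h x _ _; have d := is_derive_gauss_sin b e x h.
  - move=> x; rewrite /G !mulr_ge0 ?addr_ge0 ?expR_ge0 ?mulr_ge0 ?invr_ge0 ?(ltW a0)//.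
  - move=> h x hI _; rewrite dH; apply: HG.
    by move: hI; rewrite /= in_itv/= ler_norml => /andP[/ltW -> /ltW ->].
have -> : H' = (fun x => b * (gauss_ker a y x * cos (b * (x - y) + e))
    - 2 * a * ((x - y) * gauss_ker a y x * sin (b * (x - y) + e))).
  by apply/funext => x; rewrite /H'; ring.
rewrite RintegralB//; last 2 first.
- have := integrableZl measurableT b (@integrable_gauss_cos b e).
  by apply: eq_integrable.
- have := integrableZl measurableT (2 * a) (@integrable_xgauss_sin b e).
  by apply: eq_integrable.
rewrite !RintegralZl//; last 2 first.
- exact: integrable_xgauss_sin.
- exact: integrable_gauss_cos.
by move=> /eqP; rewrite eq_sym subr_eq0 => /eqP.
Qed.

(** Differentiation under the integral produces the sine integral with a factor [x - y], which
    [gauss_by_parts] turns back into [g]. *)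
Let is_derive_g (b : R) : is_derive b 1 g (- (b / (2 * a)) * g b).
Proof.
have a20 : 0 < a / 2 by rewrite divr_gt0.
pose f (b : R) (x : R) := gauss_ker a y x * cos (b * (x - y) + c).
have df b' x : partial1of2 f b' x = - ((x - y) * gauss_ker a y x * sin (b' * (x - y) + c)).
  by rewrite partial1of2E; have d := is_derive_gauss_cos b' x; rewrite derive_val.
pose G x := 2 * (1 + a^-1) * gauss_ker (a / 2) y x.
have iG : mu.-integrable setT (EFin \o G).
  have := integrableZl measurableT (2 * (1 + a^-1)) (integrable_gauss_ker y a20).
  by apply: eq_integrable.
have G0 x : 0 <= G x.
  by rewrite /G !mulr_ge0 ?gauss_ker_ge0 ?addr_ge0 ?invr_ge0 ?(ltW a0).
have Ib : (`](b - 1)%R, (b + 1)%R[%classic : set R) b.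
  by rewrite /= in_itv/= gtrBl ltrDl ltr01.
have fG b' x : (`](b - 1)%R, (b + 1)%R[%classic : set R) b' -> setT x -> `|partial1of2 f b' x| <= G x.
  move=> _ _; rewrite df normrN !normrM (ger0_norm (gauss_ker_ge0 _ _ _)).
  apply: (@le_trans _ _ (`|x - y| * gauss_ker a y x)).
    by rewrite ler_piMr ?sin_max// mulr_ge0 ?gauss_ker_ge0.
  apply: le_trans (gauss_ker_linear_le x y a0 ler01).
  by rewrite ler_wpM2r ?gauss_ker_ge0// mul1r lerDr.
have derf b' x : (`](b - 1)%R, (b + 1)%R[%classic : set R) b' -> setT x -> derivable (f ^~ x) b' 1.
  by move=> _ _; have d := is_derive_gauss_cos b' x.
have intf b' : (`](b - 1)%R, (b + 1)%R[%classic : set R) b' ->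
    mu.-integrable setT (EFin \o f b').
  by move=> _; exact: integrable_gauss_cos.
have D := derivable_under_integral measurableT Ib intf derf G0 iG fG.
have E := differentiation_under_integral measurableT Ib intf derf G0 iG fG.
apply: DeriveDef; first exact: D.
rewrite -derive1E E.
have -> : (fun x => partial1of2 f b x) =
  (fun x => (-1) * ((x - y) * gauss_ker a y x * sin (b * (x - y) + c))).
  by apply/funext => x; rewrite df mulN1r.
rewrite RintegralZl//; last exact: integrable_xgauss_sin.
have := gauss_by_parts b c; rewrite -/(g b) => /eqP; rewrite -subr_eq0 => /eqP h.
apply/eqP; rewrite -subr_eq0.
set S := Rintegral _ _ _ in h *.
have -> : -1 * S - - (b / (2 * a)) * g b = - (2 * a * S - b * g b) / (2 * a).
  by field; rewrite gt_eqF.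
by rewrite h oppr0 mul0r.
Qed.

(** By the differential equation for [g], the product [g b * exp (b^2 / (4 a))] is constant, and at
    [b = 0] it is the Gaussian mass times [cos c]. The free phase [c] covers cosine and sine at
    once: [c = 0] and [c = - pi / 2]. *)
Lemma Rintegral_gauss_cos (b : R) :
  Rintegral mu setT (fun x => gauss_ker a y x * cos (b * (x - y) + c)) =
  Num.sqrt (pi / a) * cos c * expR (- (b ^+ 2 / (4 * a))).
Proof.
pose q (b : R) := g b * expR (b ^+ 2 / (4 * a)).
have dq (b' : R) : is_derive b' 1 q 0.
  have d2 : is_derive b' 1 (fun b : R => b ^+ 2 / (4 * a)) (2 * b' / (4 * a)).
    by apply: is_derive_eq; rewrite /GRing.scale/=; ring.
  have d3 := is_derive1_comp (is_derive_expR _) d2.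
  have := is_deriveM (is_derive_g b') d3.
  rewrite /q /comp/= => d; apply: (is_derive_eq d).
  by rewrite /GRing.scale/=; field; rewrite gt_eqF.
have q0 := is_derive_0_is_cst b 0 dq.
have -> : Num.sqrt (pi / a) * cos c = q 0.
  rewrite /q /g expr0n/= mul0r expR0 mulr1.
  under eq_Rintegral do rewrite mul0r add0r.
  rewrite RintegralZr//; last exact: integrable_gauss_ker.
  by rewrite Rintegral_gauss_ker.
by rewrite -q0 /q expRN mulfK// gt_eqF// expR_gt0.
Qed.

End ODE.
End Gauss1D.

Section GaussFourier1D.
Context {R : realType}.
Notation mu := (@lebesgue_measure R).
Variables (a y b : R).
Hypothesis a0 : 0 < a.

Let gE : (fun x => cis ((x - y) * b) * real_complex R (gauss_ker a y x)) =
  (fun x => Complex (gauss_ker a y x * cos (b * (x - y) + 0))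
                    (gauss_ker a y x * cos (b * (x - y) - pi / 2))).
Proof.
apply/funext => x; apply/eqP; rewrite eq_complex cReM cImM/= !mulr0 subr0 add0r addr0.
by rewrite (mulrC b) cosB cos_pihalf sin_pihalf mulr0 add0r mulr1 !(mulrC (gauss_ker a y x)) !eqxx.
Qed.

Lemma cintegrable_gauss_cis :
  cintegrable mu (fun x => cis ((x - y) * b) * real_complex R (gauss_ker a y x)).
Proof. by rewrite gE; split; exact: integrable_gauss_cos. Qed.

Lemma cintegral_gauss_cis :
  cintegral mu setT (fun x => cis ((x - y) * b) * real_complex R (gauss_ker a y x)) =
  real_complex R (Num.sqrt (pi / a) * expR (- (b ^+ 2 / (4 * a)))).
Proof.
rewrite gE; apply/eqP; rewrite eq_complex/= !Rintegral_gauss_cos//.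
by rewrite cos0 mulr1 cosN cos_pihalf mulr0 mul0r !eqxx.
Qed.

End GaussFourier1D.

(** * Products of Lebesgue measures and Gaussians on them *)

Section SigmaFiniteProduct.
Context {R : realType} d1 d2 (T1 : measurableType d1) (T2 : measurableType d2).
Variables (m1 : {sigma_finite_measure set T1 -> \bar R}).
Variables (m2 : {sigma_finite_measure set T2 -> \bar R}).

(* The library's canonical sigma-finite structure on products only covers
   subprobabilities, hence this alias. *)
Definition sf_prod : set (T1 * T2)%type -> \bar R := (m1 \x m2)%E.

HB.instance Definition _ := Measure.copy sf_prod (m1 \x m2)%E.

Let sf_prod_sigma_finite : sigma_finite setT sf_prod.
Proof.
have /sigma_finiteP[F [TF ndF Foo]] := sigma_finiteT m1.
have /sigma_finiteP[G [TG ndG Goo]] := sigma_finiteT m2.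
exists (fun n => F n `*` G n) => [|n].
  rewrite -setXTT TF TG predeqE => -[x y]; split.
    move=> [/= [n _ Fnx] [k _ Gky]]; exists (maxn n k) => //; split.
    - by move: x Fnx; exact/subsetPset/ndF/leq_maxl.
    - by move: y Gky; exact/subsetPset/ndG/leq_maxr.
  by move=> [n _ []/= ? ?]; split; exists n.
have [mF Fn] := Foo n; have [mG Gn] := Goo n.
split; first exact: measurableX.
by rewrite /sf_prod product_measure1E// lte_mul_pinfty// ge0_fin_numE.
Qed.

HB.instance Definition _ := Measure_isSigmaFinite.Build _ _ _ sf_prod
  sf_prod_sigma_finite.

End SigmaFiniteProduct.

Section LebesgueProducts.
Context {R : realType}.
Notation V := (R * R * R * R)%type.
Notation mu := (@lebesgue_measure R).

Definition sleb2 : {sigma_finite_measure set _ -> \bar R} := sf_prod mu mu.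
Definition sleb3 : {sigma_finite_measure set _ -> \bar R} := sf_prod sleb2 mu.
Definition sleb4 : {sigma_finite_measure set _ -> \bar R} := sf_prod sleb3 mu.

(** True by conversion; rewriting with it equips [leb4] with the sigma-finite structure that
    Fubini's theorem asks for. *)
Lemma leb4E : (leb4 : {measure set _ -> \bar R}) = sleb4.
Proof. by []. Qed.

Lemma cintegrable_prod4 (f1 f2 f3 f4 : R -> R[i]) :
  cintegrable mu f1 -> cintegrable mu f2 -> cintegrable mu f3 -> cintegrable mu f4 ->
  cintegrable leb4 (fun x : V => f1 x.1.1.1 * f2 x.1.1.2 * f3 x.1.2 * f4 x.2).
Proof.
move=> i1 i2 i3 i4.
have i12 := @cintegrable_prodM R _ _ _ _ mu mu _ _ i1 i2.
have i123 := @cintegrable_prodM R _ _ _ _ sleb2 mu _ _ i12 i3.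
exact: (@cintegrable_prodM R _ _ _ _ sleb3 mu _ _ i123 i4).
Qed.

Lemma cintegral_prod4 (f1 f2 f3 f4 : R -> R[i]) :
  cintegrable mu f1 -> cintegrable mu f2 -> cintegrable mu f3 -> cintegrable mu f4 ->
  cintegral leb4 setT (fun x : V => f1 x.1.1.1 * f2 x.1.1.2 * f3 x.1.2 * f4 x.2) =
  cintegral mu setT f1 * cintegral mu setT f2 * cintegral mu setT f3 * cintegral mu setT f4.
Proof.
move=> i1 i2 i3 i4.
have i12 := @cintegrable_prodM R _ _ _ _ mu mu _ _ i1 i2.
have i123 := @cintegrable_prodM R _ _ _ _ sleb2 mu _ _ i12 i3.
have e1 := @cintegral_prodM R _ _ _ _ mu mu _ _ i1 i2.
have e2 := @cintegral_prodM R _ _ _ _ sleb2 mu _ _ i12 i3.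
have e3 := @cintegral_prodM R _ _ _ _ sleb3 mu _ _ i123 i4.
by rewrite -e1 -e2 -e3.
Qed.
End LebesgueProducts.

Section Gauss4D.
Context {R : realType}.
Notation V := (R * R * R * R)%type.
Notation mu := (@lebesgue_measure R).
Implicit Types (a : R) (x y z b : V).

Lemma dot4_ge0 x : 0 <= dot4 x x.
Proof. by rewrite /dot4 -!expr2 !addr_ge0 ?sqr_ge0. Qed.

Definition gauss4 a y x : R := expR (- (a * dot4 (x - y) (x - y))).

Lemma gauss4_ge0 a y x : 0 <= gauss4 a y x.
Proof. exact: expR_ge0. Qed.

Lemma gauss4E a y x : gauss4 a y x =
  gauss_ker a y.1.1.1 x.1.1.1 * gauss_ker a y.1.1.2 x.1.1.2 *
  gauss_ker a y.1.2 x.1.2 * gauss_ker a y.2 x.2.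
Proof. by rewrite /gauss4 /gauss_ker -!expRD /dot4/=; congr expR; ring. Qed.

Let gauss4_cisE a y b :
  (fun x => cis (dot4 (x - y) b) * real_complex R (gauss4 a y x)) =
  (fun x => (cis ((x.1.1.1 - y.1.1.1) * b.1.1.1) * real_complex R (gauss_ker a y.1.1.1 x.1.1.1)) *
            (cis ((x.1.1.2 - y.1.1.2) * b.1.1.2) * real_complex R (gauss_ker a y.1.1.2 x.1.1.2)) *
            (cis ((x.1.2 - y.1.2) * b.1.2) * real_complex R (gauss_ker a y.1.2 x.1.2)) *
            (cis ((x.2 - y.2) * b.2) * real_complex R (gauss_ker a y.2 x.2))).
Proof.
apply/funext => x; rewrite gauss4E !rmorphM /dot4 /= !cisD.
ring.
Qed.

Lemma cintegrable_gauss4 a y b : 0 < a ->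
  cintegrable leb4 (fun x => cis (dot4 (x - y) b) * real_complex R (gauss4 a y x)).
Proof.
move=> a0; rewrite gauss4_cisE.
have i (y' b' : R) := @cintegrable_gauss_cis R a y' b' a0.
exact: (cintegrable_prod4 (i _ _) (i _ _) (i _ _) (i _ _)).
Qed.

Lemma cintegral_gauss4 a y b : 0 < a ->
  cintegral leb4 setT (fun x => cis (dot4 (x - y) b) * real_complex R (gauss4 a y x)) =
  real_complex R ((pi / a) ^+ 2 * expR (- (dot4 b b / (4 * a)))).
Proof.
move=> a0; rewrite gauss4_cisE.
have i (y' b' : R) := @cintegrable_gauss_cis R a y' b' a0.
rewrite (cintegral_prod4 (i _ _) (i _ _) (i _ _) (i _ _)).
rewrite !cintegral_gauss_cis// -!rmorphM; congr (real_complex R _).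
have -> : - (dot4 b b / (4 * a)) = - (b.1.1.1 ^+ 2 / (4 * a)) + - (b.1.1.2 ^+ 2 / (4 * a))
    + - (b.1.2 ^+ 2 / (4 * a)) + - (b.2 ^+ 2 / (4 * a)).
  by rewrite /dot4; field; rewrite gt_eqF.
rewrite !expRD; set s := Num.sqrt _.
have -> : (pi / a) ^+ 2 = s ^+ 2 * s ^+ 2.
  by rewrite sqr_sqrtr ?expr2// divr_ge0 ?pi_ge0// ltW.
ring.
Qed.

Lemma dot40r x : dot4 x 0 = 0.
Proof. by rewrite /dot4/= !mulr0 !addr0. Qed.

Let gauss4_cis0 a y :
  (fun x => cis (dot4 (x - y) 0) * real_complex R (gauss4 a y x)) =
  (fun x => real_complex R (gauss4 a y x)).
Proof. by apply/funext => x; rewrite dot40r cis0 mul1r. Qed.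

Lemma integrable_gauss4 a y : 0 < a -> leb4.-integrable setT (EFin \o gauss4 a y).
Proof. by move=> a0; have := @cintegrable_gauss4 a y 0 a0; rewrite gauss4_cis0 => -[]. Qed.

Lemma Rintegral_gauss4 a y : 0 < a -> Rintegral leb4 setT (gauss4 a y) = (pi / a) ^+ 2.
Proof.
move=> a0; have := @cintegral_gauss4 a y 0 a0; rewrite gauss4_cis0.
by rewrite dot40r mul0r oppr0 expR0 mulr1 => -[].
Qed.

Lemma measurable_dot4 d (T : measurableType d) (f g : T -> V) :
  measurable_fun setT f -> measurable_fun setT g ->
  measurable_fun setT (fun t => dot4 (f t) (g t)).
Proof.
move=> mf mg.
have m1 (h : T -> V) : measurable_fun setT h -> measurable_fun setT (fun t => (h t).1).
  by move=> mh; exact: (measurableT_comp measurable_fst mh).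
have m2 (h : T -> V) : measurable_fun setT h -> measurable_fun setT (fun t => (h t).1.1).
  by move=> mh; exact: (measurableT_comp measurable_fst (m1 _ mh)).
rewrite /dot4; apply: measurable_funD; first apply: measurable_funD; first apply: measurable_funD.
- apply: measurable_funM.
  + exact: (measurableT_comp measurable_fst (m2 _ mf)).
  + exact: (measurableT_comp measurable_fst (m2 _ mg)).
- apply: measurable_funM.
  + exact: (measurableT_comp measurable_snd (m2 _ mf)).
  + exact: (measurableT_comp measurable_snd (m2 _ mg)).
- apply: measurable_funM.
  + exact: (measurableT_comp measurable_snd (m1 _ mf)).
  + exact: (measurableT_comp measurable_snd (m1 _ mg)).
- apply: measurable_funM.
  + exact: (measurableT_comp measurable_snd mf).
  + exact: (measurableT_comp measurable_snd mg).
Qed.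

Lemma measurable_sub4 d (T : measurableType d) (f g : T -> V) :
  measurable_fun setT f -> measurable_fun setT g ->
  measurable_fun setT (fun t => f t - g t : V).
Proof.
move=> mf mg.
have m1 (h : T -> V) : measurable_fun setT h -> measurable_fun setT (fun t => (h t).1).
  by move=> mh; exact: (measurableT_comp measurable_fst mh).
have m2 (h : T -> V) : measurable_fun setT h -> measurable_fun setT (fun t => (h t).1.1).
  by move=> mh; exact: (measurableT_comp measurable_fst (m1 _ mh)).
apply: measurable_fun_pair => /=; first apply: measurable_fun_pair => /=; first apply: measurable_fun_pair => /=.
- apply: measurable_funB.
  + exact: (measurableT_comp measurable_fst (m2 _ mf)).
  + exact: (measurableT_comp measurable_fst (m2 _ mg)).
- apply: measurable_funB.
  + exact: (measurableT_comp measurable_snd (m2 _ mf)).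
  + exact: (measurableT_comp measurable_snd (m2 _ mg)).
- apply: measurable_funB.
  + exact: (measurableT_comp measurable_snd (m1 _ mf)).
  + exact: (measurableT_comp measurable_snd (m1 _ mg)).
- apply: measurable_funB.
  + exact: (measurableT_comp measurable_snd mf).
  + exact: (measurableT_comp measurable_snd mg).
Qed.

(* Peetre's inequality absorbed into a Gaussian. *)
Lemma japanese_le_exp (k : R) y : 0 < k ->
  exists2 K : R, 1 <= K & forall x, 1 + dot4 x x <= K * expR (k * dot4 (x - y) (x - y)).
Proof.
move=> k0; exists (1 + 2 * dot4 y y + 2 / k) => [|x].
  have := dot4_ge0 y; have : 0 < 2 / k by rewrite divr_gt0.
  by lra.
set t := dot4 (x - y) (x - y).
have t0 : 0 <= t by exact: dot4_ge0.
have e1 : 1 + k * t <= expR (k * t) by exact: expR_ge1Dx.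
have h : dot4 x x <= 2 * dot4 y y + 2 * t.
  have -> : 2 * dot4 y y + 2 * t = dot4 x x + dot4 (x - y - y) (x - y - y).
    by rewrite /t /dot4/=; ring.
  by rewrite lerDl dot4_ge0.
have kt : 2 * t = 2 / k * (k * t) by field; rewrite gt_eqF.
have yy := dot4_ge0 y.
have kt0 : 0 <= k * t by rewrite mulr_ge0// ltW.
have k20 : 0 <= 2 / k by rewrite divr_ge0// ltW.
apply: (@le_trans _ _ ((1 + 2 * dot4 y y + 2 / k) * (1 + k * t))); last first.
  by rewrite ler_wpM2l//; lra.
rewrite mulrDl mulrDr mulr1.
have : 0 <= (1 + 2 * dot4 y y) * (k * t) by rewrite mulr_ge0//; lra.
rewrite (mulrDr (2 / k)) -kt mulr1; lra.
Qed.

End Gauss4D.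

(** * Gaussians as test functions *)

Section Schwartz.
Context {R : realType}.
Notation V := (R * R * R * R)%type.

(** A class of coefficients that contains the real and imaginary parts of characters, is stable
    under directional derivatives and grows at most polynomially. All iterated derivatives of a
    member times a Gaussian are again of this form, which gives the Schwartz bounds of every order
    by one induction. *)
Inductive tempered_poly : (V -> R) -> Prop :=
| tp_cst c : tempered_poly (fun=> c)
| tp_dot y b : tempered_poly (fun x => dot4 (x - y) b)
| tp_cos y b : tempered_poly (fun x => cos (dot4 (x - y) b))
| tp_sin y b : tempered_poly (fun x => sin (dot4 (x - y) b))
| tp_add f g : tempered_poly f -> tempered_poly g ->
    tempered_poly (fun x => f x + g x)
| tp_mul f g : tempered_poly f -> tempered_poly g ->
    tempered_poly (fun x => f x * g x).

Definition dot4r (b x : V) : R := dot4 x b.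

Fact dot4r_is_linear (b : V) : linear (dot4r b).
Proof. by move=> k u v; rewrite /dot4r /dot4 /= /GRing.scale /=; ring. Qed.

HB.instance Definition _ (b : V) :=
  GRing.isLinear.Build R V R *:%R (dot4r b) (dot4r_is_linear b).

Lemma continuous_dot4r (b : V) : continuous (dot4r b).
Proof.
have c1 : continuous (fun x : V => x.1) by move=> x; exact: cvg_fst.
have c2 : continuous (fun x : V => x.1.1).
  by move=> x; apply: continuous_comp; [exact: c1|exact: cvg_fst].
move=> x; rewrite /dot4r /dot4.
apply: cvgD; first apply: cvgD; first apply: cvgD; apply: cvgM; try exact: cvg_cst.
- by apply: (@continuous_comp _ _ _ (fun x : V => x.1.1) fst); [exact: c2|exact: cvg_fst].
- by apply: (@continuous_comp _ _ _ (fun x : V => x.1.1) snd); [exact: c2|exact: cvg_snd].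
- by apply: (@continuous_comp _ _ _ (fun x : V => x.1) snd); [exact: c1|exact: cvg_snd].
- exact: cvg_snd.
Qed.

Lemma differentiable_dot4 (y b x : V) : differentiable (fun x : V => dot4 (x - y) b : R) x.
Proof.
have -> : (fun x : V => dot4 (x - y) b : R) = dot4r b - cst (dot4 y b).
  by apply/funext => z; rewrite !fctE /dot4r /dot4 /=; ring.
apply: differentiableB; last exact: differentiable_cst.
apply: (@linear_differentiable _ _ _ (dot4r b)).
exact: continuous_dot4r.
Qed.

Lemma derive_dot4 (y b v x : V) : 'D_v (fun x : V => dot4 (x - y) b : R) x = dot4 v b.
Proof.
have d : differentiable (dot4r b) x.
  apply: (@linear_differentiable _ _ _ (dot4r b)).
  exact: continuous_dot4r.
have -> : (fun x : V => dot4 (x - y) b : R) = dot4r b - cst (dot4 y b).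
  by apply/funext => z; rewrite !fctE /dot4r /dot4 /=; ring.
rewrite deriveB//; last exact: diff_derivable.
rewrite derive_cst subr0 deriveE//.
by rewrite (@diff_lin _ _ _ (dot4r b))//; exact: continuous_dot4r.
Qed.

Lemma derive_comp1 (f : V -> R) (g : R -> R) (dg : R) (x v : V) :
  differentiable f x -> is_derive (f x) 1 g dg ->
  differentiable (g \o f) x /\ 'D_v (g \o f) x = dg * 'D_v f x.
Proof.
move=> df dgf.
have dgx : differentiable g (f x) by apply/derivable1_diffP; case: dgf.
have dd := differentiable_comp df dgx; split => //.
rewrite deriveE// diff_comp//= diff1E// derive1E derive_val deriveE//.
by rewrite /GRing.scale/= mulrC.
Qed.

Lemma differentiable_tempered_poly f x : tempered_poly f -> differentiable f x.
Proof.
elim=> [c|y b|y b|y b|{}f g _ df _ dg|{}f g _ df _ dg].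
- exact: differentiable_cst.
- exact: differentiable_dot4.
- by case: (derive_comp1 0 (differentiable_dot4 y b x) (is_derive_cos _)).
- by case: (derive_comp1 0 (differentiable_dot4 y b x) (is_derive_sin _)).
- exact: differentiableD.
- exact: differentiableM.
Qed.

Let tp_ext f g : f =1 g -> tempered_poly g -> tempered_poly f.
Proof. by move=> /funext ->. Qed.

Lemma derive_tempered_poly f (v : V) :
  tempered_poly f -> tempered_poly (fun x => 'D_v f x).
Proof.
elim=> [c|y b|y b|y b|{}f g tf df tg dg|{}f g tf df tg dg].
- apply: tp_ext (tp_cst 0) => x; exact: derive_cst.
- apply: tp_ext (tp_cst (dot4 v b)) => x; exact: derive_dot4.
- apply: tp_ext (tp_mul (tp_cst (- dot4 v b)) (tp_sin y b)) => x.
  have [_ ->] := derive_comp1 v (differentiable_dot4 y b x) (is_derive_cos _).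
  by rewrite derive_dot4; ring.
- apply: tp_ext (tp_mul (tp_cst (dot4 v b)) (tp_cos y b)) => x.
  have [_ ->] := derive_comp1 v (differentiable_dot4 y b x) (is_derive_sin _).
  by rewrite derive_dot4; ring.
- apply: tp_ext (tp_add df dg) => x.
  by rewrite -deriveD//; apply/diff_derivable/differentiable_tempered_poly.
- apply: tp_ext (tp_add (tp_mul tf dg) (tp_mul tg df)) => x.
  by rewrite -deriveM//; apply/diff_derivable/differentiable_tempered_poly.
Qed.

(** From [|x - b|^2 >= 0] and [|x + b|^2 >= 0]: a weak Cauchy-Schwarz inequality whose right side is
    already a power of [1 + |x|^2]. *)
Lemma dot4_le (x b : V) : `|dot4 x b| <= (1 + dot4 x x) * (1 + dot4 b b).
Proof.
have x0 := dot4_ge0 x; have b0 := dot4_ge0 b.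
have h : dot4 x b *+ 2 <= dot4 x x + dot4 b b.
  have := dot4_ge0 (x - b); rewrite (_ : dot4 _ _ = dot4 x x + dot4 b b - dot4 x b *+ 2); first lra.
  by rewrite /dot4/= mulr2n; ring.
have h' : - dot4 x b *+ 2 <= dot4 x x + dot4 b b.
  have := dot4_ge0 (x + b); rewrite (_ : dot4 _ _ = dot4 x x + dot4 b b + dot4 x b *+ 2); first lra.
  by rewrite /dot4/= mulr2n; ring.
have xb := mulr_ge0 x0 b0.
have -> : (1 + dot4 x x) * (1 + dot4 b b) =
  1 + dot4 x x + dot4 b b + dot4 x x * dot4 b b by ring.
by rewrite ler_norml; apply/andP; split; lra.
Qed.

Lemma tempered_poly_bound f : tempered_poly f ->
  exists (C : R) (k : nat), 0 <= C /\ forall x, `|f x| <= C * (1 + dot4 x x) ^+ k.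
Proof.
elim=> [c|y b|y b|y b|{}f g _ [C [k [C0 fC]]] _ [D [l [D0 gD]]]|{}f g _ [C [k [C0 fC]]] _ [D [l [D0 gD]]]].
- by exists `|c|, 0; split => // x; rewrite expr0 mulr1.
- exists ((1 + dot4 b b) + `|dot4 y b|), 1; split=> [|x].
    by rewrite addr_ge0// addr_ge0// dot4_ge0.
  have -> : dot4 (x - y) b = dot4 x b - dot4 y b by rewrite /dot4/=; ring.
  apply: le_trans (ler_normB _ _) _; rewrite expr1 mulrDl.
  apply: lerD; first by rewrite mulrC dot4_le.
  by rewrite ler_peMr// lerDl dot4_ge0.
- exists 1, 0; split => // x; rewrite expr0 mulr1; exact: cos_max.
- exists 1, 0; split => // x; rewrite expr0 mulr1; exact: sin_max.
- exists (C + D), (k + l)%N; split; first exact: addr_ge0.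
  move=> x; apply: le_trans (ler_normD _ _) _; rewrite mulrDl.
  have h1 : 1 <= 1 + dot4 x x by rewrite lerDl dot4_ge0.
  apply: lerD.
    apply: le_trans (fC x) _; rewrite ler_wpM2l//.
    by rewrite ler_weXn2l// leq_addr.
  apply: le_trans (gD x) _; rewrite ler_wpM2l//.
  by rewrite ler_weXn2l// leq_addl.
- exists (C * D), (k + l)%N; split; first exact: mulr_ge0.
  move=> x; rewrite normrM exprD mulrACA.
  by apply: ler_pM.
Qed.

Section GaussianFactor.
Variables (a : R) (y : V).
Hypothesis a0 : 0 < a.

Let e1 : V := (1, 0, 0, 0). Let e2 : V := (0, 1, 0, 0).
Let e3 : V := (0, 0, 1, 0). Let e4 : V := (0, 0, 0, 1).

Let q (x : V) := - (a * dot4 (x - y) (x - y)).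

Let tp_q : tempered_poly q.
Proof.
(* The generators of the class are linear forms, so the quadratic exponent is expanded along the
   coordinate vectors. *)
rewrite (_ : q = fun x => (- a) * (((dot4 (x - y) e1 * dot4 (x - y) e1 + dot4 (x - y) e2 * dot4 (x - y) e2)
  + dot4 (x - y) e3 * dot4 (x - y) e3) + dot4 (x - y) e4 * dot4 (x - y) e4)).
  apply: tp_mul; first exact: tp_cst.
  by do 3?[apply: tp_add]; apply: tp_mul; exact: tp_dot.
by apply/funext => x; rewrite /q /dot4/=; ring.
Qed.

Let diff_gauss f x : tempered_poly f ->
  differentiable (fun x => f x * gauss4 a y x) x.
Proof.
move=> tf.
have dq := differentiable_tempered_poly x tp_q.
have [dg _] := derive_comp1 0 dq (is_derive_expR _).
exact: (differentiableM (differentiable_tempered_poly x tf) dg).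
Qed.

Let derive_gauss f v : tempered_poly f ->
  exists2 g, tempered_poly g &
  (fun x => 'D_v (fun x => f x * gauss4 a y x) x) = (fun x => g x * gauss4 a y x).
Proof.
move=> tf; exists (fun x => f x * 'D_v q x + 'D_v f x).
  apply: tp_add; last exact: derive_tempered_poly.
  by apply: tp_mul => //; exact: derive_tempered_poly.
apply/funext => x.
have dq := differentiable_tempered_poly x tp_q.
have [dg Dg] := derive_comp1 v dq (is_derive_expR _).
have df := differentiable_tempered_poly x tf.
rewrite [LHS](deriveM (@diff_derivable _ _ _ _ x v df) (@diff_derivable _ _ _ _ x v dg)).
by rewrite Dg /GRing.scale/= -/(gauss4 a y x); ring.
Qed.

Let iter_derive_gauss f vs : tempered_poly f ->
  exists2 g, tempered_poly g &
  iter_derive vs (fun x => f x * gauss4 a y x) = (fun x => g x * gauss4 a y x).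
Proof.
move=> tf; elim: vs => [|v vs [g tg gE]]; first by exists f.
by have [h th hE] := derive_gauss v tg; exists h => //=; rewrite gE hE.
Qed.

Lemma japanese_gauss_bounded (k : nat) :
  exists C : R, forall x, (1 + dot4 x x) ^+ k * gauss4 a y x <= C.
Proof.
(* At this rate the [k]-th power of the bound in [japanese_le_exp] grows like
   [exp (a k / (k + 1) * t)], which the Gaussian absorbs; [k + 1] rather than [k] also covers
   [k = 0]. *)
have k0 : 0 < a / k.+1%:R by rewrite divr_gt0.
have [K K1 hK] := japanese_le_exp y k0; exists (K ^+ k) => x.
have K0 : 0 <= K by exact: le_trans K1.
set t := dot4 (x - y) (x - y).
have t0 : 0 <= t by exact: dot4_ge0.
apply: (@le_trans _ _ ((K * expR (a / k.+1%:R * t)) ^+ k * gauss4 a y x)).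
  rewrite ler_wpM2r ?gauss4_ge0// lerXn2r// nnegrE.
    by rewrite addr_ge0// dot4_ge0.
  by rewrite mulr_ge0// expR_ge0.
rewrite exprMn -expRM_natl /gauss4 -/t -[leLHS]mulrA -expRD ler_piMr ?exprn_ge0//.
rewrite expR_le1 subr_le0 mulrA ler_wpM2r// mulrCA ler_piMr ?(ltW a0)//.
by rewrite ler_pdivrMr ?ltr0n// mul1r ler_nat.
Qed.

Lemma schwartz_real_gauss f : tempered_poly f ->
  schwartz_real (fun x => f x * gauss4 a y x).
Proof.
move=> tf; split=> [vs x|k vs].
  by have [g tg ->] := iter_derive_gauss vs tf; exact: diff_gauss.
have [g tg ->] := iter_derive_gauss vs tf.
have [C [l [C0 gC]]] := tempered_poly_bound tg.
have [D hD] := japanese_gauss_bounded (k + l).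
exists (C * D) => x.
rewrite normrM (ger0_norm (gauss4_ge0 _ _ _)).
have j0 : 0 <= 1 + dot4 x x by rewrite addr_ge0// dot4_ge0.
apply: (@le_trans _ _ ((1 + dot4 x x) ^+ k * (C * (1 + dot4 x x) ^+ l * gauss4 a y x))).
  by rewrite ler_wpM2l ?exprn_ge0// ler_wpM2r ?gauss4_ge0.
apply: le_trans (ler_wpM2l C0 (hD x)).
by rewrite exprD le_eqVlt; apply/orP; left; apply/eqP; ring.
Qed.

End GaussianFactor.

Lemma schwartz_gauss (a : R) (y b : V) : 0 < a ->
  schwartz (fun x => cis (dot4 (x - y) b) * real_complex R (gauss4 a y x)).
Proof.
move=> a0; split.
- under eq_fun do rewrite cReM/= mulr0 subr0.
  by apply: (schwartz_real_gauss y a0); exact: tp_cos.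
- under eq_fun do rewrite cImM/= mulr0 add0r.
  by apply: (schwartz_real_gauss y a0); exact: tp_sin.
Qed.

End Schwartz.

(** * The dual bound for the Bessel potential *)

Section ExponentialWeight.
Context {R : realType}.
Notation mu := (@lebesgue_measure R).

(* With u = e^v this is u^c e^{-w u} du/u, the integrand of the Gamma function;
   the exponential variable keeps it continuous on the whole line. *)
Definition wexp (c w v : R) : R := expR (c * v - w * expR v).

Lemma wexp_ge0 c w v : 0 <= wexp c w v.
Proof. exact: expR_ge0. Qed.

Lemma continuous_wexp c w : continuous (wexp c w).
Proof.
move=> v; apply: (@continuous_comp _ _ _ (fun v => c * v - w * expR v) expR);
  last exact: continuous_expR.
apply: cvgB; apply: cvgM; try exact: cvg_cst.
- exact: cvg_id.
- exact: continuous_expR.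
Qed.

Lemma measurable_wexp c w : measurable_fun setT (wexp c w).
Proof. by apply: continuous_measurable_fun; exact: continuous_wexp. Qed.

Lemma integrable_expR_abs (c : R) : 0 < c ->
  mu.-integrable setT (EFin \o (fun v => expR (- (c * `|v|)))).
Proof.
move=> c0; have cf : continuous (fun v : R => expR (- (c * `|v|))).
  move=> v; apply: (@continuous_comp _ _ _ (fun v : R => - (c * `|v|)) expR);
    last exact: continuous_expR.
  by apply: cvgN; apply: cvgM; [exact: cvg_cst|exact: norm_continuous].
apply/integrableP; split.
  by apply/measurable_EFinP; apply: continuous_measurable_fun.
under eq_integral do rewrite /= ger0_norm ?expR_ge0//.
rewrite (ge0_symfun_integralT (fun v => expR_ge0 _) cf); last first.
  by move=> v /=; rewrite normrN.
apply: (@le_lt_trans _ _ (2%:E * \int[mu]_v ((c^-1)%:E * (exponential_pdf c v)%:E))%E).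
  rewrite lee_wpmul2l//.
  rewrite integral_mkcond; apply: ge0_le_integral => //.
  - by move=> v _; rewrite erestrict_ge0// => ? _; rewrite lee_fin expR_ge0.
  - apply/(measurable_restrictT _ _).1 => //; first by rewrite -set_itvcy.
    apply: measurable_funTS; apply/measurable_EFinP.
    exact: continuous_measurable_fun.
  - apply/measurable_funeM/measurable_EFinP; exact: measurable_exponential_pdf.
  - move=> v _; rewrite patchE; case: ifPn => [|_].
      rewrite inE/= => v0; rewrite exponential_pdfE// lee_fin mulrA mulVf ?gt_eqF//.
      by rewrite mul1r ger0_norm// mulNr.
    by rewrite lee_fin mulr_ge0 ?invr_ge0 ?exponential_pdf_ge0 ?(ltW c0).
rewrite integralZl//; last exact: integrable_exponential_pdf.
by rewrite integral_exponential_pdf// mule1 -EFinM ltry.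
Qed.

Lemma integrable_wexp (c w : R) : 0 < c -> 0 < w ->
  mu.-integrable setT (EFin \o wexp c w).
Proof.
move=> c0 w0.
(* For [v < 0] the factor [e^(c v)] already is [e^(- c |v|)]. For [v >= 0] the double exponential
   wins through [e^v >= v^2 / 4], and [4 c^2 / w] is the constant left by completing the square in
   [2 c v - w v^2 / 4]. *)
apply: (@integrable_le _ _ _ mu _ (fun v => expR (4 * c ^+ 2 / w) * expR (- (c * `|v|)))).
- exact: measurable_wexp.
- move=> v; rewrite ger0_norm ?wexp_ge0// -expRD ler_expR.
  have ev := expR_ge0 v.
  have cw : 0 <= 4 * c ^+ 2 / w by rewrite divr_ge0// ?(ltW w0)// mulr_ge0// sqr_ge0.
  have [v0|v0] := leP 0 v; last first.
    have : 0 <= w * expR v by rewrite mulr_ge0// ltW.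
    rewrite ltr0_norm//; lra.
  have ev2 : v ^+ 2 / 4 <= expR v.
    have -> : expR v = expR (v / 2) ^+ 2 by rewrite expr2 -expRD; congr expR; field.
    have -> : v ^+ 2 / 4 = (v / 2) ^+ 2 by field.
    rewrite ler_sqr ?nnegrE ?expR_ge0 ?divr_ge0//.
    by apply: le_trans (expR_ge1Dx _); lra.
  have h : w * (v ^+ 2 / 4) <= w * expR v by rewrite ler_wpM2l// ltW.
  rewrite ger0_norm//.
  have sq : 0 <= w / 4 * (v - 4 * c / w) ^+ 2 by rewrite mulr_ge0 ?sqr_ge0// divr_ge0// ltW.
  have E : w / 4 * (v - 4 * c / w) ^+ 2 = w * (v ^+ 2 / 4) - 2 * c * v + 4 * c ^+ 2 / w.
    by field; rewrite gt_eqF.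
  by move: sq; rewrite E; lra.
- have := integrableZl measurableT (expR (4 * c ^+ 2 / w)) (integrable_expR_abs c0).
  by apply: eq_integrable.
Qed.

(** The scaling [u -> w u] of the Gamma integral, which in [v = ln u] is a translation by [ln w].
    The remaining integral of [wexp c 1] is Gamma at [c]. *)
Lemma Rintegral_wexp (c w : R) : 0 < c -> 0 < w ->
  Rintegral mu setT (wexp c w) = w `^ (- c) * Rintegral mu setT (wexp c 1).
Proof.
move=> c0 w0.
rewrite -(Rintegral_translate (ln w) (@continuous_wexp c 1) (wexp_ge0 c 1)).
have -> : (fun v => wexp c 1 (v + ln w)) = (fun v => w `^ c * wexp c w v).
  apply/funext => v; rewrite /wexp expRD lnK ?posrE// /powR (gt_eqF w0) -expRD.
  by congr expR; ring.
rewrite RintegralZl//; last exact: integrable_wexp.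
by rewrite mulrA powRN mulVf ?mul1r// gt_eqF// powR_gt0.
Qed.

Lemma Rintegral_wexp_gt0 (c w : R) : 0 < c -> 0 < w ->
  0 < Rintegral mu setT (wexp c w).
Proof.
move=> c0 w0.
have i01 : mu.-integrable setT (EFin \o (\1_(`[0, 1]%classic : set R) : R -> R)).
  apply/integrableP; split; first exact/measurable_EFinP/measurable_indic.
  under eq_integral do rewrite /= ger0_norm//.
  rewrite integral_indic// setIT [X in (X < _)%E]lebesgue_measure_itv/= lte_fin ltr01.
  by rewrite -EFinD ltry.
apply: (@lt_le_trans _ _ (Rintegral mu setT (fun v => expR (- (w * expR 1)) * \1_(`[0, 1]%classic : set R) v))).
  rewrite RintegralZl// /Rintegral integral_indic// setIT [X in fine X]lebesgue_measure_itv/=.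
  by rewrite lte_fin ltr01 /= subr0 mulr1 expR_gt0.
apply: le_Rintegral => //.
- have := integrableZl measurableT (expR (- (w * expR 1))) i01.
  by apply: eq_integrable.
- exact: integrable_wexp.
move=> v _; rewrite indicE; case: (boolP (v \in _)) => [|_]; last by rewrite mulr0 wexp_ge0.
rewrite inE/= in_itv/= => /andP[v0 v1]; rewrite mulr1 ler_expR.
have : w * expR v <= w * expR 1 by rewrite ler_wpM2l ?ler_expR// ltW.
have : 0 <= c * v by rewrite mulr_ge0// ltW.
lra.
Qed.

End ExponentialWeight.

Section GaussHoelder.
Context {R : realType}.
Notation V := (R * R * R * R)%type.

(** With the conjugate exponent [q = p / (p - 1)], the [q]-th power of the Gaussian of rate [k] is
    the one of rate [k q], of mass [(pi / (k q))^2]; the exponent [2 - 2 / p] is [2 / q]. *)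
Lemma hoelder_gauss4 (p k : R) (y : V) (G : V -> R[i]) : 1 < p -> 0 < k ->
  inLp leb4 p%:E G ->
  leb4.-integrable setT (EFin \o (fun x => Normc.normc (G x) * gauss4 k y x)) /\
  Rintegral leb4 setT (fun x => Normc.normc (G x) * gauss4 k y x) <=
  fine (cLnorm leb4 p%:E G) * (pi / (k * (p / (p - 1)))) `^ (2 - 2 / p).
Proof.
move=> p1 k0 [mG NG].
have p0 : 0 < p by lra.
set q := p / (p - 1).
have q0 : 0 < q by rewrite divr_gt0// subr_gt0.
have pq : p^-1 + q^-1 = 1 by rewrite /q; field; rewrite !gt_eqF ?subr_gt0.
have kq : 0 < k * q by rewrite mulr_gt0.
have mnG := cmeasurable_normc mG.
have /integrableP[/measurable_EFinP mg _] := integrable_gauss4 y k0.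
have := @hoelder _ _ _ leb4 _ _ p q mnG mg p0 q0 pq.
have -> : Lnorm leb4 q%:E (EFin \o gauss4 k y) =
    ((pi / (k * q)) `^ (2 - 2 / p))%:E.
  rewrite unlock.
  have -> : (\int[leb4]_x `|(EFin \o gauss4 k y) x| `^ q)%E = (((pi / (k * q)) ^+ 2)%:E)%E.
    rewrite -(Rintegral_gauss4 y kq) /Rintegral fineK; last first.
      by have := integrable_fin_num measurableT (integrable_gauss4 y kq).
    apply: eq_integral => x _ /=.
    rewrite ger0_norm ?gauss4_ge0// /gauss4 -expRM; congr (expR _)%:E; ring.
  rewrite poweR_EFin -powR_mulrn ?divr_ge0 ?pi_ge0 ?(ltW kq)// -powRrM; congr (_ `^ _)%:E.
  by rewrite /q; field; rewrite !gt_eqF ?subr_gt0.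
rewrite Lnorm1 => H.
have NGf : (cLnorm leb4 p%:E G = (fine (cLnorm leb4 p%:E G))%:E)%E.
  by rewrite fineK// ge0_fin_numE// Lnorm_ge0.
have H' : (\int[leb4]_x `|(EFin \o (fun x => Normc.normc (G x) * gauss4 k y x)%R) x|
  <= (fine (cLnorm leb4 p%:E G) * (pi / (k * q)) `^ (2 - 2 / p))%:E)%E.
  by rewrite EFinM -NGf.
have mf : measurable_fun setT (fun x => Normc.normc (G x) * gauss4 k y x).
  exact: measurable_funM.
have iG : leb4.-integrable setT (EFin \o (fun x => Normc.normc (G x) * gauss4 k y x)).
  by apply/integrableP; split; [exact/measurable_EFinP|apply: le_lt_trans H' _; rewrite ltry].
split => //; rewrite -lee_fin; apply: le_trans H'.
rewrite /Rintegral fineK; last exact: integrable_fin_num iG.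
apply: ge0_le_integral => //.
- by move=> x _; rewrite lee_fin mulr_ge0 ?normc_ge0 ?gauss4_ge0.
- exact/measurable_EFinP.
- by apply: measurableT_comp => //; exact/measurable_EFinP.
- by move=> x _; rewrite lee_fin ler_norm.
Qed.

End GaussHoelder.

(** * The multiplication formula and Bessel potentials tested on Gaussians *)

Section FourierPairingGeneric.
Context {R : realType} d (V : measurableType d).
Variable m : {sigma_finite_measure set V -> \bar R}.
Variables (F : V -> R[i]) (k : V -> V -> R).
Hypothesis mk : measurable_fun setT (fun w : V * V => k w.1 w.2).
Hypothesis iF : cintegrable m F.

Definition fourier_at_gen (z : V) : R[i] :=
  cintegral m setT (fun x => F x * cis (k x z)).

Let mF : cmeasurable F. Proof. exact: cintegrable_measurable iF. Qed.

Let cis1_integrable (b : V -> R) (x : V) : m.-integrable setT (EFin \o b) ->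
  cintegrable m (fun z => real_complex R (b z) * cis (k x z)).
Proof.
move=> ib.
have /integrableP[/measurable_EFinP mb _] := ib.
apply: (@cintegrable_le _ _ _ m _ (fun z => `|b z|)).
- apply: cmeasurableM; first exact: cmeasurable_real.
  apply: cmeasurable_cis; exact: (measurableT_comp mk (pair1_measurable x)).
- by move=> z; rewrite Normc.normcM normc_cis mulr1 normc_real.
- exact: integrable_norm.
Qed.

Let prod_integrable (b : V -> R) : m.-integrable setT (EFin \o b) ->
  cintegrable (m \x m)%E
    (fun w : V * V => F w.1 * (real_complex R (b w.2) * cis (k w.1 w.2))).
Proof.
move=> ib.
have /integrableP[/measurable_EFinP mb _] := ib.
apply: (@cintegrable_le _ _ _ (m \x m)%E _ (fun w => Normc.normc (F w.1) * `|b w.2|)).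
- apply: cmeasurableM; first exact: (cmeasurable_comp measurable_fst mF).
  apply: cmeasurableM.
    by apply: cmeasurable_real; exact: (measurableT_comp mb measurable_snd).
  exact: cmeasurable_cis.
- by move=> w; rewrite !Normc.normcM normc_cis mulr1 normc_real.
- exact: (@integrable_prodM R _ _ _ _ m m _ _ (cintegrable_normc iF) (integrable_norm ib)).
Qed.

Let inner1 (b : V -> R) (x : V) : m.-integrable setT (EFin \o b) ->
  cintegral m setT (fun z => F x * (real_complex R (b z) * cis (k x z))) =
  F x * cintegral m setT (fun z => real_complex R (b z) * cis (k x z)).
Proof. by move=> ib; rewrite cintegralZl//; exact: cis1_integrable. Qed.

Let inner2 (b : V -> R) (z : V) :
  cintegral m setT (fun x => F x * (real_complex R (b z) * cis (k x z))) =
  real_complex R (b z) * fourier_at_gen z.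
Proof.
under eq_cintegral do rewrite mulrCA.
rewrite cintegralZl//.
apply: (@cintegrable_le _ _ _ m _ (fun x => Normc.normc (F x))).
- apply: cmeasurableM => //; apply: cmeasurable_cis.
  exact: (measurableT_comp mk (pair2_measurable z)).
- by move=> x; rewrite Normc.normcM normc_cis mulr1.
- exact: cintegrable_normc.
Qed.

Lemma cintegrable_fourier_at_gen (b : V -> R) : m.-integrable setT (EFin \o b) ->
  cintegrable m (fun z => real_complex R (b z) * fourier_at_gen z).
Proof.
move=> ib; have := cintegrable_fubini2 (prod_integrable ib).
by under eq_fun do rewrite inner2.
Qed.

Lemma cintegrable_fourier_pairing_gen (b : V -> R) : m.-integrable setT (EFin \o b) ->
  cintegrable m (fun x => F x *
    cintegral m setT (fun z => real_complex R (b z) * cis (k x z))).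
Proof.
move=> ib; have := cintegrable_fubini1 (prod_integrable ib).
by under eq_fun do rewrite inner1//.
Qed.

Lemma fourier_pairing_gen (b : V -> R) : m.-integrable setT (EFin \o b) ->
  cintegral m setT (fun x => F x *
    cintegral m setT (fun z => real_complex R (b z) * cis (k x z))) =
  cintegral m setT (fun z => real_complex R (b z) * fourier_at_gen z).
Proof.
move=> ib; have := cfubini (prod_integrable ib).
under eq_cintegral do rewrite inner1//.
by move=> ->; apply: eq_cintegral => z _; rewrite inner2.
Qed.

End FourierPairingGeneric.

Section FourierPairing.
Context {R : realType}.
Notation V := (R * R * R * R)%type.
Variables (F : V -> R[i]) (y : V).
Hypothesis iF : cintegrable leb4 F.

(** The Fourier transform of [F] times the character [e^(i y . z)]: the centre [y] of the test
    Gaussian is built into the phase. *)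
Definition fourier_at (z : V) : R[i] :=
  cintegral leb4 setT (fun x => F x * cis (dot4 (y - x) z)).

Let mk : measurable_fun setT (fun w : V * V => dot4 (y - w.1) w.2).
Proof.
apply: measurable_dot4 => //.
apply: (@measurable_sub4 R _ _ (fun=> y)); first exact: measurable_cst.
exact: measurable_fst.
Qed.

Lemma cintegrable_fourier_at (b : V -> R) : leb4.-integrable setT (EFin \o b) ->
  cintegrable leb4 (fun z => real_complex R (b z) * fourier_at z).
Proof.
rewrite /fourier_at => ib; have := iF; move: ib; rewrite leb4E => ib jF.
exact (@cintegrable_fourier_at_gen R _ _ sleb4 F _ mk jF b ib).
Qed.

Lemma cintegrable_fourier_pairing (b : V -> R) : leb4.-integrable setT (EFin \o b) ->
  cintegrable leb4 (fun x => F x *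
    cintegral leb4 setT (fun z => real_complex R (b z) * cis (dot4 (y - x) z))).
Proof.
rewrite /fourier_at => ib; have := iF; move: ib; rewrite leb4E => ib jF.
exact (@cintegrable_fourier_pairing_gen R _ _ sleb4 F _ mk jF b ib).
Qed.

Lemma fourier_pairing (b : V -> R) : leb4.-integrable setT (EFin \o b) ->
  cintegral leb4 setT (fun x => F x *
    cintegral leb4 setT (fun z => real_complex R (b z) * cis (dot4 (y - x) z))) =
  cintegral leb4 setT (fun z => real_complex R (b z) * fourier_at z).
Proof.
rewrite /fourier_at => ib; have := iF; move: ib; rewrite leb4E => ib jF.
exact (@fourier_pairing_gen R _ _ sleb4 F _ mk jF b ib).
Qed.

(** Fubini gives measurability only after multiplication by an integrable weight; a Gaussian weight
    vanishes nowhere and can be divided out. *)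
Lemma cmeasurable_fourier_at : cmeasurable fourier_at.
Proof.
have i1 := @integrable_gauss4 R 1 0 ltr01.
have m1 := cintegrable_measurable (cintegrable_fourier_at i1).
have /integrableP[/measurable_EFinP mg _] := i1.
have -> : fourier_at = (fun z => real_complex R (gauss4 1 0 z)^-1 *
   (real_complex R (gauss4 1 0 z) * fourier_at z)).
  apply/funext => z; rewrite mulrA -rmorphM/= mulVf ?mul1r// gt_eqF// expR_gt0//.
apply: cmeasurableM => //; apply: cmeasurable_real.
rewrite /gauss4; under eq_fun do rewrite -expRN opprK mul1r.
apply: (measurableT_comp (@measurable_expR R)).
by apply: measurable_dot4; apply: measurable_sub4 => //; exact: measurable_cst.
Qed.

End FourierPairing.

Section BesselGauss.
Context {R : realType}.
Notation V := (R * R * R * R)%type.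
Notation mu := (@lebesgue_measure R).
Variable alpha : R.
Hypothesis alpha0 : 0 < alpha.

Lemma integrable_symbol_gauss (tau : R) (zeta : V) : 0 < tau ->
  leb4.-integrable setT (EFin \o
    (fun z => (1 + dot4 z z) `^ (alpha / 2) * gauss4 tau zeta z)).
Proof.
move=> t0; have t20 : 0 < tau / 2 by rewrite divr_gt0.
(* The rate [tau / alpha], raised to the power [alpha / 2], costs [tau / 2], half of the available
   Gaussian. *)
have [K K1 hK] := japanese_le_exp zeta (divr_gt0 t0 alpha0).
have K0 : 0 <= K by exact: le_trans K1.
have /integrableP[/measurable_EFinP mg _] := integrable_gauss4 zeta t0.
apply: (@integrable_le _ _ _ leb4 _ (fun z => K `^ (alpha / 2) * gauss4 (tau / 2) zeta z)).
- apply: measurable_funM => //.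
  apply: (measurableT_comp (@measurable_powR R _)); apply: measurable_funD => //.
  by apply: measurable_dot4.
- move=> z; rewrite ger0_norm ?mulr_ge0 ?powR_ge0 ?gauss4_ge0//.
  have -> : gauss4 (tau / 2) zeta z =
      expR (tau / alpha * dot4 (z - zeta) (z - zeta)) `^ (alpha / 2) * gauss4 tau zeta z.
    rewrite -expRM /gauss4 -expRD; congr expR; field; rewrite gt_eqF//.
  rewrite mulrA ler_wpM2r ?gauss4_ge0// -powRM ?expR_ge0//.
  apply: ge0_ler_powR; rewrite ?nnegrE.
  + by rewrite divr_ge0// ltW.
  + by rewrite addr_ge0// dot4_ge0.
  + by rewrite mulr_ge0// expR_ge0.
  + exact: hK.
- have := integrableZl measurableT (K `^ (alpha / 2)) (integrable_gauss4 zeta t20).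
  by apply: eq_integrable.
Qed.

(** Parametrised by the frequency side: its inverse Fourier transform is, up to a constant and the
    character of [y], the Gaussian of rate [s] about [eta]. *)
Definition modulated_gauss (s : R) (y eta : V) (x : V) : R[i] :=
  cis (dot4 (x - y) (- eta)) * real_complex R (gauss4 (4 * s)^-1 y x).

Lemma fourier_inv_gauss (s : R) (y eta z : V) : 0 < s ->
  fourier_inv (modulated_gauss s y eta) z =
  real_complex R ((2 * pi) ^- 4 * (4 * pi * s) ^+ 2 * gauss4 s eta z) * cis (dot4 y z).
Proof.
move=> s0; rewrite /fourier_inv.
have k0 : 0 < (4 * s)^-1 by rewrite invr_gt0 mulr_gt0.
have E x : modulated_gauss s y eta x * cis (dot4 z x) =
  cis (dot4 y z) * (cis (dot4 (x - y) (z - eta)) * real_complex R (gauss4 (4 * s)^-1 y x)).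
  rewrite /modulated_gauss mulrA -cisD mulrAC -cisD.
  by congr (cis _ * _); rewrite /dot4/=; ring.
under eq_cintegral do rewrite E.
rewrite cintegralZl; last exact: cintegrable_gauss4.
rewrite cintegral_gauss4//.
have -> : pi / (4 * s)^-1 = 4 * pi * s by rewrite invrK; ring.
have -> : dot4 (z - eta) (z - eta) / (4 * (4 * s)^-1) = s * dot4 (z - eta) (z - eta).
  by field; rewrite gt_eqF.
by rewrite -/(gauss4 s eta z) !rmorphM/=; ring.
Qed.

(** Unfolding the transposes leaves [F] integrated against the Fourier transform of symbol times
    Gaussian; the multiplication formula moves that transform onto [F]. *)
Lemma bessel_gauss (F : V -> R[i]) (s : R) (y eta : V) : 0 < s ->
  cintegrable leb4 F ->
  bessel alpha (functional_of F) (modulated_gauss s y eta) =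
  real_complex R ((2 * pi) ^- 4 * (4 * pi * s) ^+ 2) *
  cintegral leb4 setT (fun z =>
    real_complex R ((1 + dot4 z z) `^ (alpha / 2) * gauss4 s eta z) * fourier_at F y z).
Proof.
move=> s0 iF.
have isym := integrable_symbol_gauss eta s0.
rewrite /bessel /tfourier_inv /tmul /tfourier /functional_of.
set K := (2 * pi) ^- 4 * _.
rewrite -fourier_pairing// -cintegralZl; last exact: cintegrable_fourier_pairing.
apply: eq_cintegral => x _; rewrite [RHS]mulrCA; congr (_ * _).
rewrite /fourier -cintegralZl; last first.
  have /integrableP[/measurable_EFinP mb _] := isym.
  apply: (@cintegrable_le _ _ _ leb4 _ (fun z => `|(1 + dot4 z z) `^ (alpha / 2) * gauss4 s eta z|)).
  - apply: cmeasurableM; first exact: cmeasurable_real.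
    apply: cmeasurable_cis; apply: measurable_dot4; first exact: measurable_cst.
    exact: measurable_id.
  - by move=> z; rewrite Normc.normcM normc_cis mulr1 normc_real.
  - exact: integrable_norm isym.
apply: eq_cintegral => z _.
rewrite fourier_inv_gauss// -/K /bessel_symbol.
have -> : cis (dot4 (y - x) z) = cis (dot4 y z) * cis (- dot4 z x).
  by rewrite -cisD; congr cis; rewrite /dot4/=; ring.
rewrite !rmorphM/=; ring.
Qed.

End BesselGauss.

Section RealKernelFubini.
Context {R : realType} d1 d2 (T1 : measurableType d1) (T2 : measurableType d2).
Variables (m1 : {sigma_finite_measure set T1 -> \bar R}).
Variables (m2 : {sigma_finite_measure set T2 -> \bar R}).
Variables (h : T1 * T2 -> R) (H : T2 -> R[i]) (g1 : T1 -> R) (g2 : T2 -> R).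
Hypothesis mh : measurable_fun setT h.
Hypothesis mH : cmeasurable H.
Hypothesis ig1 : m1.-integrable setT (EFin \o g1).
Hypothesis ig2 : m2.-integrable setT (EFin \o g2).
Hypothesis hg : forall w, `|h w| * Normc.normc (H w.2) <= g1 w.1 * g2 w.2.
Hypothesis ih : forall z, m1.-integrable setT (EFin \o (fun v => h (v, z))).

Let iprod : cintegrable (m1 \x m2)%E (fun w => real_complex R (h w) * H w.2).
Proof.
apply: (@cintegrable_le _ _ _ (m1 \x m2)%E _ (fun w => g1 w.1 * g2 w.2)).
- apply: cmeasurableM; first exact: cmeasurable_real.
  exact: (cmeasurable_comp measurable_snd mH).
- by move=> w; rewrite Normc.normcM normc_real.
- exact: integrable_prodM.
Qed.

Lemma cintegrable_real_kernel :
  cintegrable m1 (fun v => cintegral m2 setT (fun z => real_complex R (h (v, z)) * H z)).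
Proof. exact: (cintegrable_fubini1 iprod). Qed.

Lemma cfubini_real_kernel :
  cintegral m1 setT (fun v => cintegral m2 setT (fun z => real_complex R (h (v, z)) * H z)) =
  cintegral m2 setT (fun z => real_complex R (Rintegral m1 setT (fun v => h (v, z))) * H z).
Proof.
have := cfubini iprod => /= ->; apply: eq_cintegral => z _.
under eq_cintegral do rewrite mulrC.
by rewrite cintegralZl ?cintegral_real 1?mulrC//; exact: cintegrable_real.
Qed.

End RealKernelFubini.

(** * Averaging the pairing over the heat time *)

Section DualBound.
Context {R : realType}.
Notation V := (R * R * R * R)%type.
Notation mu := (@lebesgue_measure R).

(** The size of the pairing at heat time [u = e^v], with [Z = |zeta|^2]. The power is what Hoelder
    leaves of a Gaussian of frequency rate [tau + u] once its normalisation [(tau + u)^2] has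
    cancelled; the exponential comes from [gauss4_square]. *)
Definition decay_weight (p tau Z v : R) : R :=
  (tau + expR v) `^ (- (2 / p)) * expR (- (tau * expR v / (tau + expR v) * Z)).

Definition decay_integral (a p tau Z : R) : R :=
  Rintegral mu setT (fun v => wexp a 1 v * decay_weight p tau Z v).

Lemma decay_weight_ge0 p tau Z v : 0 <= decay_weight p tau Z v.
Proof. by rewrite mulr_ge0 ?powR_ge0 ?expR_ge0. Qed.

Lemma measurable_decay_weight p tau Z : 0 < tau ->
  measurable_fun setT (decay_weight p tau Z).
Proof.
move=> t0; have mE := @measurable_expR R.
apply: measurable_funM.
  apply: (measurableT_comp (@measurable_powR R _)).
  by apply: measurable_funD.
apply: (measurableT_comp mE).
apply: measurableT_comp => //; apply: measurable_funM => //; apply: measurable_funM.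
  by apply: measurable_funM.
have -> : (fun v : R => (tau + expR v)^-1) = (fun v => (tau + expR v) `^ (-1)).
  by apply/funext => v; rewrite powR_inv1// addr_ge0 ?expR_ge0// ltW.
apply: (measurableT_comp (@measurable_powR R _)).
by apply: measurable_funD.
Qed.

Lemma decay_weight_le p tau Z v : 1 < p -> 0 < tau -> 0 <= Z ->
  decay_weight p tau Z v <= tau `^ (- (2 / p)).
Proof.
move=> p1 t0 Z0; have ev := expR_gt0 v.
rewrite /decay_weight -[leRHS]mulr1 ler_pM ?powR_ge0 ?expR_ge0//.
  rewrite !powRN lef_pV2 ?posrE ?powR_gt0 ?addr_gt0//.
  apply: ge0_ler_powR; rewrite ?nnegrE ?divr_ge0//; lra.
rewrite expR_le1 oppr_le0 mulr_ge0// divr_ge0 ?mulr_ge0 ?addr_ge0 ?ltW//.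
Qed.

Lemma integrable_decay (a p tau Z : R) : 0 < a -> 1 < p -> 0 < tau -> 0 <= Z ->
  mu.-integrable setT (EFin \o (fun v => wexp a 1 v * decay_weight p tau Z v)).
Proof.
move=> a0 p1 t0 Z0.
apply: (@integrable_le _ _ _ mu _ (fun v => tau `^ (- (2 / p)) * wexp a 1 v)).
- apply: measurable_funM; first exact: measurable_wexp.
  exact: measurable_decay_weight.
- move=> v; rewrite ger0_norm; last first.
    by apply: mulr_ge0; [exact: wexp_ge0|exact: decay_weight_ge0].
  rewrite mulrC.
  by rewrite ler_wpM2r ?wexp_ge0// decay_weight_le.
- have := integrableZl measurableT (tau `^ (- (2 / p))) (integrable_wexp a0 ltr01).
  by apply: eq_integrable.
Qed.

(** Completing the square: the heat factor moves the centre towards 0 and adds the rates, and the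
    misfit of the two centres appears as a scalar that is small for large [zeta]. *)
Lemma gauss4_square (tau u : R) (zeta z : V) : 0 < tau -> 0 < u ->
  gauss4 tau zeta z * expR (- (u * dot4 z z)) =
  expR (- (tau * u / (tau + u) * dot4 zeta zeta)) *
  gauss4 (tau + u) ((tau / (tau + u)) *: zeta) z.
Proof.
move=> t0 u0; rewrite /gauss4 -!expRD; congr expR.
rewrite /dot4/= /GRing.scale/=; field; rewrite gt_eqF// addr_gt0//.
Qed.

Variables (p alpha : R).
Hypothesis p1 : 1 < p.
Hypothesis alpha0 : 0 < alpha.
Let a := alpha / 2.
Let a0 : 0 < a. Proof. by rewrite divr_gt0. Qed.

Let sgauss (tau : R) (zeta z : V) := (1 + dot4 z z) `^ a * gauss4 tau zeta z.

Let sgauss_ge0 tau zeta z : 0 <= sgauss tau zeta z.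
Proof. by apply: mulr_ge0; [exact: powR_ge0|exact: gauss4_ge0]. Qed.

Section FixedFunction.
Variables (F G : V -> R[i]) (y zeta : V) (tau : R).
Hypothesis tau0 : 0 < tau.
Hypothesis iF : cintegrable leb4 F.
Hypothesis hG : inLp leb4 p%:E G.
Hypothesis FG : forall phi, schwartz phi ->
  bessel alpha (functional_of F) phi = functional_of G phi.

Let bker (v : R) (z : V) := sgauss tau zeta z * expR (- (expR v * dot4 z z)).

Let I (v : R) := cintegral leb4 setT
  (fun z => real_complex R (bker v z) * fourier_at F y z).

(** The 2 is the loss of [le_normc_cintegral], the quotient undoes the constant of
    [fourier_inv_gauss], and the last factor is the Hoelder constant of a Gaussian of rate
    [1 / (4 s)]; the powers of [s] go into [decay_weight]. *)
Let C1 := 2 * (2 * pi) ^+ 4 / (4 * pi) ^+ 2 * (4 * pi / (p / (p - 1))) `^ (2 - 2 / p) : R.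

Let N := fine (cLnorm leb4 p%:E G).

(** By [gauss4_square] the kernel is a symbol-weighted Gaussian of rate [s = tau + e^v]. Hence [I v]
    is a multiple of the Bessel potential of [F] tested on a modulated Gaussian, where [G] takes
    over and Hoelder's inequality applies. *)
Let normI v : Normc.normc (I v) <= C1 * N * decay_weight p tau (dot4 zeta zeta) v.
Proof.
have ev := expR_gt0 v.
set s := tau + expR v.
have s0 : 0 < s by rewrite addr_gt0.
set eta := (tau / s) *: zeta.
set E := expR (- (tau * expR v / s * dot4 zeta zeta)).
have k0 : 0 < (4 * s)^-1 by rewrite invr_gt0 mulr_gt0.
have IE : I v = real_complex R E * cintegral leb4 setT
    (fun z => real_complex R (sgauss s eta z) * fourier_at F y z).
  rewrite -cintegralZl; last first.
    exact: (cintegrable_fourier_at y iF (integrable_symbol_gauss alpha0 eta s0)).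
  apply: eq_cintegral => z _; rewrite mulrA -rmorphM/=; congr (real_complex R _ * _).
  by rewrite /bker /sgauss -mulrA gauss4_square// mulrCA.
have sch := schwartz_gauss y (- eta) k0.
have := FG sch; rewrite (@bessel_gauss R alpha alpha0 F s y eta s0 iF).
set K := (2 * pi) ^- 4 * (4 * pi * s) ^+ 2.
have K0 : 0 < K.
  by rewrite mulr_gt0 ?invr_gt0 ?exprn_gt0 ?mulr_gt0 ?pi_gt0.
rewrite -/sgauss => KI.
have [iGg NGg] := hoelder_gauss4 y p1 k0 hG.
have mG := hG.1.
have nG : Normc.normc (functional_of G (modulated_gauss s y eta)) <=
   2 * (N * (pi / ((4 * s)^-1 * (p / (p - 1)))) `^ (2 - 2 / p)).
  apply: le_trans (ler_wpM2l _ NGg) => //.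
  apply: le_normc_cintegral iGg.
    apply: cmeasurableM => //.
    exact: (cintegrable_measurable (cintegrable_gauss4 y (- eta) k0)).
  by move=> x; rewrite !Normc.normcM normc_cis mul1r normc_real ger0_norm ?gauss4_ge0.
rewrite -KI Normc.normcM normc_real (gtr0_norm K0) in nG.
rewrite IE Normc.normcM normc_real ger0_norm ?expR_ge0//.
have N0 : 0 <= N by rewrite fine_ge0// Lnorm_ge0.
have p0 : 0 < p by exact: lt_trans ltr01 p1.
have p10 : 0 < p - 1 by rewrite subr_gt0.
have q0 : 0 < p / (p - 1) by rewrite divr_gt0.
apply: (@le_trans _ _ (E * (K^-1 * (2 * (N * (pi / ((4 * s)^-1 * (p / (p - 1)))) `^ (2 - 2 / p)))))).
  by rewrite ler_wpM2l ?expR_ge0// ler_pdivlMl.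
have -> : pi / ((4 * s)^-1 * (p / (p - 1))) = (4 * pi / (p / (p - 1))) * s.
  by field; rewrite !gt_eqF.
rewrite powRM; [|by apply: divr_ge0; [rewrite mulr_ge0 ?pi_ge0|exact: ltW]|exact: ltW].
have -> : s `^ (2 - 2 / p) = s ^+ 2 * s `^ (- (2 / p)).
  by rewrite -powR_mulrn ?(ltW s0)// -powRD// (gt_eqF s0) implybT.
rewrite /decay_weight -/s -/E /C1 /K le_eqVlt; apply/orP; left; apply/eqP.
have pi0 : (pi : R) != 0 by rewrite gt_eqF// pi_gt0.
move: pi0 (lt0r_neq0 s0).
move: (_ `^ (2 - 2 / p)) (s `^ _) => A B.
by move: (pi : R) => P P0 sn0; field; rewrite P0.
Qed.

Let bker_ge0 v z : 0 <= bker v z.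
Proof. by apply: mulr_ge0; [exact: sgauss_ge0|exact: expR_ge0]. Qed.

Let bker_le v z : bker v z <= sgauss tau zeta z.
Proof.
rewrite ler_piMr ?sgauss_ge0//.
by rewrite expR_le1 oppr_le0 mulr_ge0 ?expR_ge0 ?dot4_ge0.
Qed.

Let bker_wexp v z : wexp a 1 v * bker v z =
  sgauss tau zeta z * wexp a (1 + dot4 z z) v.
Proof.
rewrite /bker mulrCA; congr (_ * _).
by rewrite /wexp -expRD; congr expR; ring.
Qed.

Let h (w : R * V) := sgauss tau zeta w.2 * wexp a (1 + dot4 w.2 w.2) w.1.

(** Fubini in [(v, z)]: integrating the weight over [v] gives a multiple of [(1 + |z|^2)^(-a)] and
    leaves the bare Gaussian. Absolute convergence holds because the heat factor is at most 1, as in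
    [bker_le]. *)
Let weighted_integral :
  cintegral mu setT (fun v => real_complex R (wexp a 1 v) * I v) =
  real_complex R (Rintegral mu setT (wexp a 1)) *
  cintegral leb4 setT (fun z => real_complex R (gauss4 tau zeta z) * fourier_at F y z) /\
  cintegrable mu (fun v => real_complex R (wexp a 1 v) * I v).
Proof.
have isg := integrable_symbol_gauss alpha0 zeta tau0.
have mf := cmeasurable_fourier_at y iF.
have ifa := cintegrable_fourier_at y iF isg.
have msg : measurable_fun setT (sgauss tau zeta).
  by case/integrableP : isg => /measurable_EFinP.
have IE v : real_complex R (wexp a 1 v) * I v =
    cintegral leb4 setT (fun z => real_complex R (h (v, z)) * fourier_at F y z).
  have ib : leb4.-integrable setT (EFin \o bker v).
    apply: (@integrable_le _ _ _ leb4 _ (sgauss tau zeta)) => //.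
    - apply: measurable_funM => //; apply: (measurableT_comp (@measurable_expR R)).
      apply: measurableT_comp => //; apply: measurable_funM => //.
      exact: measurable_dot4.
    - by move=> z; rewrite ger0_norm// bker_le.
  rewrite -cintegralZl; last exact: (cintegrable_fourier_at y iF ib).
  apply: eq_cintegral => z _; rewrite mulrA -rmorphM/=; congr (real_complex R _ * _).
  exact: bker_wexp.
have hz z : Rintegral mu setT (fun v => h (v, z)) =
    Rintegral mu setT (wexp a 1) * gauss4 tau zeta z.
  have z0 : 0 < 1 + dot4 z z by rewrite ltr_pwDl// dot4_ge0.
  transitivity (Rintegral mu setT (fun v => sgauss tau zeta z * wexp a (1 + dot4 z z) v)) => //.
  rewrite RintegralZl//; last exact: integrable_wexp.
  have := powR_gt0 a z0; rewrite Rintegral_wexp// /sgauss powRN => /lt0r_neq0.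
  move: (_ `^ a) (gauss4 _ _ _) (Rintegral _ _ _) => X g W X0.
  by field.
have ih z : mu.-integrable setT (EFin \o (fun v => h (v, z))).
  have z0 : 0 < 1 + dot4 z z by rewrite ltr_pwDl// dot4_ge0.
  have := integrableZl measurableT (sgauss tau zeta z) (integrable_wexp a0 z0).
  by apply: eq_integrable.
have mh : measurable_fun setT h.
  apply: measurable_funM.
    by apply: (measurableT_comp msg); exact: measurable_snd.
  apply: (measurableT_comp (@measurable_expR R)); apply: measurable_funB.
    by apply: measurable_funM => //; exact: measurable_fst.
  apply: measurable_funM.
    by apply: measurable_funD => //; apply: measurable_dot4; exact: measurable_snd.
  exact: (measurableT_comp (@measurable_expR R) measurable_fst).
have iw := integrable_wexp a0 (ltr01 : 0 < 1 :> R).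
have ig2 := cintegrable_normc ifa; rewrite leb4E in ig2.
have hg w : `|h w| * Normc.normc (fourier_at F y w.2) <= wexp a 1 w.1 *
    Normc.normc (real_complex R (sgauss tau zeta w.2) * fourier_at F y w.2).
  have sg0 := sgauss_ge0 tau zeta w.2.
  rewrite Normc.normcM normc_real (ger0_norm sg0) mulrA ler_wpM2r ?normc_ge0//.
  rewrite /h -bker_wexp ger0_norm; last by apply: mulr_ge0; [exact: wexp_ge0|exact: bker_ge0].
  by rewrite ler_wpM2l ?wexp_ge0// bker_le.
have E2 := @cfubini_real_kernel R _ _ _ _ mu sleb4 h _ _ _ mh mf iw ig2 hg ih.
have E3 := @cintegrable_real_kernel R _ _ _ _ mu sleb4 h _ _ _ mh mf iw ig2 hg.
have IE' v : real_complex R (wexp a 1 v) * I v =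
    cintegral sleb4 setT (fun z => real_complex R (h (v, z)) * fourier_at F y z).
  by rewrite IE leb4E.
split; last by rewrite (funext IE').
under eq_cintegral do rewrite IE'.
rewrite E2.
rewrite -cintegralZl; last exact: (cintegrable_fourier_at y iF (integrable_gauss4 zeta tau0)).
rewrite leb4E; apply: eq_cintegral => z _.
by rewrite hz rmorphM mulrA.
Qed.

(** The multiplication formula again, now back to physical space: rate [tau] in frequency becomes
    rate [1 / (4 tau)] about [y]. *)
Let gauss_fourier_at :
  cintegral leb4 setT (fun z => real_complex R (gauss4 tau zeta z) * fourier_at F y z) =
  real_complex R ((pi / tau) ^+ 2) *
  cintegral leb4 setT (fun x => F x *
    (cis (dot4 (y - x) zeta) * real_complex R (gauss4 (4 * tau)^-1 y x))).
Proof.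
have ig := integrable_gauss4 zeta tau0.
have k0 : 0 < (4 * tau)^-1 by rewrite invr_gt0 mulr_gt0.
rewrite -fourier_pairing// -cintegralZl; last first.
  apply: (@cintegrable_le _ _ _ leb4 _ (fun x => Normc.normc (F x))).
  - apply: cmeasurableM; first exact: cintegrable_measurable iF.
    apply: cmeasurableM.
      apply: cmeasurable_cis; apply: measurable_dot4; last exact: measurable_cst.
      by apply: measurable_sub4; [exact: measurable_cst|exact: measurable_id].
    apply: cmeasurable_real.
    by case/integrableP : (integrable_gauss4 y k0) => /measurable_EFinP.
  - move=> x; rewrite !Normc.normcM normc_cis mul1r normc_real ger0_norm ?gauss4_ge0//.
    rewrite ler_piMr ?normc_ge0// expR_le1 oppr_le0 mulr_ge0 ?dot4_ge0//.
    exact: ltW.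
  - exact: cintegrable_normc.
apply: eq_cintegral => x _; rewrite [RHS]mulrCA; congr (_ * _).
have E z : real_complex R (gauss4 tau zeta z) * cis (dot4 (y - x) z) =
   cis (dot4 (y - x) zeta) * (cis (dot4 (z - zeta) (y - x)) * real_complex R (gauss4 tau zeta z)).
  rewrite mulrA -cisD mulrC; congr (cis _ * _).
  by rewrite /dot4/=; ring.
under eq_cintegral do rewrite E.
rewrite cintegralZl; last exact: cintegrable_gauss4.
rewrite cintegral_gauss4// [RHS]mulrCA -rmorphM; congr (_ * real_complex R (_ * _)).
rewrite /gauss4; congr expR.
have -> : dot4 (y - x) (y - x) = dot4 (x - y) (x - y) by rewrite /dot4/=; ring.
by rewrite mulrC.
Qed.

Lemma dual_bound :
  Rintegral mu setT (wexp a 1) * (pi / tau) ^+ 2 *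
  Normc.normc (cintegral leb4 setT (fun x => F x *
    (cis (dot4 (y - x) zeta) * real_complex R (gauss4 (4 * tau)^-1 y x)))) <=
  2 * C1 * N * decay_integral a p tau (dot4 zeta zeta).
Proof.
have [WE iW] := weighted_integral.
have Z0 := dot4_ge0 zeta.
have C10 : 0 <= C1 by rewrite /C1 !mulr_ge0 ?powR_ge0 ?invr_ge0 ?exprn_ge0 ?mulr_ge0 ?pi_ge0.
have N0 : 0 <= N by rewrite fine_ge0// Lnorm_ge0.
have wgt0 := Rintegral_wexp_gt0 a0 (ltr01 : 0 < 1 :> R).
have pt0 : 0 <= (pi / tau) ^+ 2 by rewrite exprn_ge0 ?divr_ge0 ?pi_ge0 ?ltW.
have idec := integrable_decay a0 p1 tau0 Z0.
have -> : 2 * C1 * N * decay_integral a p tau (dot4 zeta zeta) =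
    2 * Rintegral mu setT (fun v => C1 * N * (wexp a 1 v * decay_weight p tau (dot4 zeta zeta) v)).
  by rewrite RintegralZl// !mulrA.
have ib : mu.-integrable setT (EFin \o
    (fun v => C1 * N * (wexp a 1 v * decay_weight p tau (dot4 zeta zeta) v))).
  by have := integrableZl measurableT (C1 * N) idec; apply: eq_integrable.
have := le_normc_cintegral (cintegrable_measurable iW) _ ib.
rewrite WE gauss_fourier_at !Normc.normcM !normc_real.
rewrite (gtr0_norm wgt0) (ger0_norm pt0) mulrA; apply => v.
rewrite Normc.normcM normc_real (ger0_norm (wexp_ge0 _ _ _)) mulrCA.
by rewrite ler_wpM2l ?wexp_ge0.
Qed.

End FixedFunction.

Definition dual_const : R := 2 * (2 * (2 * pi) ^+ 4 / (4 * pi) ^+ 2 *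
  (4 * pi / (p / (p - 1))) `^ (2 - 2 / p)) / (Rintegral mu setT (wexp a 1) * pi ^+ 2).

Lemma dual_const_ge0 : 0 <= dual_const.
Proof.
have wgt0 := Rintegral_wexp_gt0 a0 (ltr01 : 0 < 1 :> R).
by rewrite /dual_const divr_ge0 ?mulr_ge0 ?powR_ge0 ?invr_ge0 ?exprn_ge0 ?mulr_ge0 ?pi_ge0// ltW.
Qed.

(* The transpose of the Bessel potential is never inverted: the test functions
   are Gaussians, averaged over the heat flow u = e^v, and the Gamma integral of
   e^{-u(1+|z|^2)} cancels the symbol (1+|z|^2)^{alpha/2}. *)
Lemma sobolev_dual_bound (F G : V -> R[i]) (y zeta : V) (tau : R) : 0 < tau ->
  cintegrable leb4 F -> inLp leb4 p%:E G ->
  (forall phi, schwartz phi -> bessel alpha (functional_of F) phi = functional_of G phi) ->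
  Normc.normc (cintegral leb4 setT (fun x => F x *
    (cis (dot4 (y - x) zeta) * real_complex R (gauss4 (4 * tau)^-1 y x)))) <=
  dual_const * tau ^+ 2 * fine (cLnorm leb4 p%:E G) * decay_integral a p tau (dot4 zeta zeta).
Proof.
move=> t0 iF hG FG.
have := dual_bound y zeta t0 iF hG FG.
have wgt0 := Rintegral_wexp_gt0 a0 (ltr01 : 0 < 1 :> R).
have pi0 : 0 < (pi : R) by exact: pi_gt0.
rewrite -ler_pdivlMl; last by rewrite mulr_gt0// exprn_gt0// divr_gt0.
move=> /le_trans; apply; rewrite /dual_const le_eqVlt; apply/orP; left; apply/eqP.
set N := fine _; set D := decay_integral _ _ _ _; set W := Rintegral _ _ _ in wgt0 *.
move: (_ `^ (2 - 2 / p)) => B; move: (gt_eqF pi0) (gt_eqF t0) (gt_eqF wgt0).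
by move: (pi : R) => P P0 T0 W0; field; rewrite P0 T0 W0.
Qed.

End DualBound.

(** * Decay in the frequency and the heat time *)

Section DecayEstimates.
Context {R : realType}.
Notation mu := (@lebesgue_measure R).
Variables (a p tau : R).
Hypothesis a0 : 0 < a.
Hypothesis p1 : 1 < p.
Hypothesis tau0 : 0 < tau.

Let wexpM (b v : R) : wexp a 1 v * (expR v) `^ (- b) = wexp (a - b) 1 v.
Proof. by rewrite -expRM /wexp -expRD; congr expR; ring. Qed.

(** Splitting [(tau + u)^(-2/p) <= tau^(-A) u^(-B)] and discarding the exponential. The condition
    [B < a] keeps the remaining Gamma integral convergent at [u = 0]. *)
Lemma decay_integral_le (Z A B : R) : 0 <= Z -> 0 <= A -> 0 <= B ->
  A + B = 2 / p -> B < a ->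
  decay_integral a p tau Z <= tau `^ (- A) * Rintegral mu setT (wexp (a - B) 1).
Proof.
move=> Z0 A0 B0 AB Ba.
have aB : 0 < a - B by rewrite subr_gt0.
have iw := integrable_wexp aB (ltr01 : 0 < 1 :> R).
rewrite -RintegralZl//; apply: le_Rintegral => //.
- exact: integrable_decay.
- by have := integrableZl measurableT (tau `^ (- A)) iw; apply: eq_integrable.
move=> v _; rewrite -/(wexp (a - B) 1 v) -wexpM [leRHS]mulrCA ler_wpM2l ?wexp_ge0//.
have ev := expR_gt0 v.
have s0 : 0 < tau + expR v by rewrite addr_gt0.
rewrite /decay_weight -AB opprD powRD; last by rewrite (gt_eqF s0) implybT.
rewrite -[leRHS]mulr1; apply: ler_pM; rewrite ?mulr_ge0 ?powR_ge0 ?expR_ge0//.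
  apply: ler_pM; rewrite ?powR_ge0// !powRN lef_pV2 ?posrE ?powR_gt0//;
  by apply: ge0_ler_powR => //; rewrite ?nnegrE; apply/ltW => //; rewrite ?ltrDl ?ltrDr.
by rewrite expR_le1 oppr_le0 mulr_ge0// divr_ge0 ?mulr_ge0 ?ltW.
Qed.

Lemma expRN_le_powRN (x b : R) : 0 < x -> 0 < b <= 1 -> expR (- x) <= x `^ (- b).
Proof.
move=> x0 /andP[b0 b1]; rewrite expRN powRN lef_pV2 ?posrE ?expR_gt0 ?powR_gt0//.
apply: (@le_trans _ _ (1 + x)); last exact: expR_ge1Dx.
apply: (@le_trans _ _ ((1 + x) `^ b)).
  by apply: ge0_ler_powR; rewrite ?nnegrE ?(ltW b0) ?(ltW x0) ?addr_ge0 ?lerDr// ltW.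
by rewrite ler1_powR// lerDl ltW.
Qed.

(** The exponential is bounded by [x^(-b)] with [x = tau u Z / (tau + u)], which costs
    [tau^(-b) u^(-b)]. The numerator [(tau + u)^b] is at most [2 + u], hence the two Gamma integrals
    at [a - b] and [a - b + 1]. *)
Lemma decay_integral_freq_le (Z b : R) : tau <= 1 -> 0 < Z -> 0 < b <= 1 -> b < a ->
  decay_integral a p tau Z <= tau `^ (- (2 / p) - b) * Z `^ (- b) *
    (2 * Rintegral mu setT (wexp (a - b) 1) + Rintegral mu setT (wexp (a - b + 1) 1)).
Proof.
move=> t1 Z0 /andP[b0 b1] ba.
have ab : 0 < a - b by rewrite subr_gt0.
have ab1 : 0 < a - b + 1 by rewrite addr_gt0.
have iw := integrable_wexp ab (ltr01 : 0 < 1 :> R).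
have iw1 := integrable_wexp ab1 (ltr01 : 0 < 1 :> R).
have i2 : mu.-integrable setT (EFin \o (fun v => 2 * wexp (a - b) 1 v)).
  by have := integrableZl measurableT 2 iw; apply: eq_integrable.
have i3 : mu.-integrable setT (EFin \o (fun v => 2 * wexp (a - b) 1 v + wexp (a - b + 1) 1 v)).
  by have := integrableD measurableT i2 iw1; apply: eq_integrable.
rewrite -RintegralZl// -RintegralD// -RintegralZl//; apply: le_Rintegral => //.
- by apply: integrable_decay => //; exact: ltW.
- by have := integrableZl measurableT (tau `^ (- (2 / p) - b) * Z `^ (- b)) i3; apply: eq_integrable.
move=> v _; rewrite -/(wexp (a - b) 1 v) -/(wexp (a - b + 1) 1 v).
have ev := expR_gt0 v; set u := expR v in ev *.
have s0 : 0 < tau + u by rewrite addr_gt0.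
have -> : wexp (a - b + 1) 1 v = wexp (a - b) 1 v * u.
  by rewrite /wexp /u -expRD; congr expR; ring.
rewrite -wexpM -/u.
have x0 : 0 < tau * u / (tau + u) * Z by rewrite mulr_gt0// divr_gt0// mulr_gt0.
have b01 : 0 < b <= 1 by rewrite b0.
have h1 := expRN_le_powRN x0 b01.
have E : (tau * u / (tau + u) * Z) `^ (- b) =
    tau `^ (- b) * u `^ (- b) * (tau + u) `^ b * Z `^ (- b).
  rewrite !powRM ?divr_ge0 ?mulr_ge0 ?invr_ge0 ?(ltW x0) ?(ltW tau0) ?(ltW ev) ?(ltW s0) ?(ltW Z0)//.
  by rewrite -[in LHS](powR_inv1 (ltW s0)) -powRrM mulN1r opprK.
have h2 : (tau + u) `^ b <= 2 + u.
  apply: (@le_trans _ _ ((1 + (tau + u)) `^ b)).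
    by apply: ge0_ler_powR; rewrite ?nnegrE ?(ltW b0) ?(ltW s0) ?addr_ge0 ?lerDr ?(ltW tau0) ?(ltW ev).
  apply: (@le_trans _ _ (1 + (tau + u))); last by lra.
  by rewrite ler1_powR// lerDl ltW.
have h3 : (tau + u) `^ (- (2 / p)) <= tau `^ (- (2 / p)).
  rewrite !powRN lef_pV2 ?posrE ?powR_gt0//.
  apply: ge0_ler_powR; rewrite ?nnegrE ?(ltW tau0) ?(ltW s0) ?lerDl ?(ltW ev)//.
  by rewrite divr_ge0// ltW// (lt_trans ltr01).
have P0 := powR_ge0.
have W0 := wexp_ge0 a 1 v.
rewrite /decay_weight -/u.
apply: (@le_trans _ _ (wexp a 1 v * (tau `^ (- (2 / p)) *
   (tau `^ (- b) * u `^ (- b) * (2 + u) * Z `^ (- b))))).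
  rewrite ler_wpM2l//; apply: ler_pM; rewrite ?P0 ?expR_ge0//.
  apply: le_trans h1 _; rewrite E ler_wpM2r ?P0// ler_wpM2l//.
  by apply: mulr_ge0; exact: P0.
rewrite powRD; last by rewrite (gt_eqF tau0) implybT.
rewrite le_eqVlt; apply/orP; left; apply/eqP; ring.
Qed.

End DecayEstimates.

(** * Extracting a representative, and integrability of the output *)

Section Representatives.
Context {R : realType}.
Notation V := (R * R * R * R)%type.

(** The norm is an infimum; the strict inequality below [M] produces an element of the set without
    the infimum being attained. *)
Lemma bounded_representative (p alpha C : R) (F : V -> R[i]) (n M : \bar R) :
  (sobolev_norm p%:E alpha F <= C%:E * n)%E -> (C%:E * n < M)%E ->
  exists G : V -> R[i], [/\ tempered F, inLp leb4 p%:E G,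
    forall phi, schwartz phi -> bessel alpha (functional_of F) phi = functional_of G phi &
    (cLnorm leb4 p%:E G <= M)%E].
Proof.
move=> h1 h2; have := le_lt_trans h1 h2.
by move=> /ereal_inf_lt[_ /= [G [tF iG FG] <-]] GM; exists G; split => //; exact: ltW.
Qed.

(** Testing on a Gaussian makes [F] times that Gaussian integrable, and on the bounded support the
    Gaussian is at least [e^(-K)]. Measurability and integrability of the output of the operator
    thus come from finiteness of its Sobolev norm rather than from a study of the averages. *)
Lemma tempered_cintegrable (F : V -> R[i]) (K : R) : tempered F ->
  (forall x, K < dot4 x x -> F x = 0) -> cintegrable leb4 F.
Proof.
move=> tF FK.
have i1 := tF _ (schwartz_gauss 0 0 (ltr01 : 0 < 1 :> R)).
have gE (x : V) : cis (dot4 (x - 0) 0) * real_complex R (gauss4 1 0 x) =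
    real_complex R (expR (- dot4 x x)).
  by rewrite dot40r cis0 mul1r /gauss4 subr0 mul1r.
have FE (x : V) : F x = real_complex R (expR (dot4 x x)) *
   (F x * (cis (dot4 (x - 0) 0) * real_complex R (gauss4 1 0 x))).
  by rewrite gE mulrCA -rmorphM/= -expRD subrr expR0 mulr1.
apply: (@cintegrable_le _ _ _ leb4 _ (fun x => expR K * Normc.normc
   (F x * (cis (dot4 (x - 0) 0) * real_complex R (gauss4 1 0 x))))).
- rewrite (funext FE); apply: cmeasurableM; last exact: cintegrable_measurable i1.
  apply: cmeasurable_real; apply: (measurableT_comp (@measurable_expR R)).
  exact: measurable_dot4.
- move=> x; rewrite [in leLHS]FE Normc.normcM normc_real ger0_norm ?expR_ge0//.
  have [xK|/FK ->] := leP (dot4 x x) K; last by rewrite mul0r Normc.normc0 !mulr0.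
  by rewrite ler_wpM2r ?normc_ge0// ler_expR.
- have := integrableZl measurableT (expR K) (cintegrable_normc i1).
  by apply: eq_integrable.
Qed.

End Representatives.

(** * Lower bounds for Gaussian averages *)

Section Trigonometry.
Context {R : realType}.

Lemma lipschitz1_of_derive (f df : R -> R) : (forall x : R, is_derive x 1 f (df x)) ->
  (forall x, `|df x| <= 1) -> forall x y, `|f x - f y| <= `|x - y|.
Proof.
move=> fdf df1.
have main a b : a < b -> `|f b - f a| <= `|b - a|.
  move=> ab; have [c _ ->] := @MVT _ f df a b ab (fun x _ => fdf x)
    (continuous_subspaceT (fun x => differentiable_continuous
      ((derivable1_diffP _ _).1 (@ex_derive _ _ _ _ _ _ _ (fdf x))))).
  by rewrite normrM ler_piMl.
move=> x y; have [/main//|/main|->] := ltgtP y x; last by rewrite !subrr.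
by rewrite distrC (distrC y).
Qed.

Lemma sin_lipschitz (x y : R) : `|sin x - sin y| <= `|x - y|.
Proof.
by apply: (lipschitz1_of_derive (df := cos)) => z; exact: cos_max.
Qed.

Lemma cos_lipschitz (x y : R) : `|cos x - cos y| <= `|x - y|.
Proof.
apply: (lipschitz1_of_derive (df := fun z => - sin z)) => z.
by rewrite normrN sin_max.
Qed.

Lemma cos_ge_quad (x : R) : 1 - x ^+ 2 / 2 <= cos x.
Proof.
have sx : `|sin (x / 2)| <= `|x / 2| by have := sin_lipschitz (x / 2) 0; rewrite sin0 !subr0.
have s2 : sin (x / 2) ^+ 2 <= (x / 2) ^+ 2.
  by rewrite -[leLHS]real_normK ?num_real// -[leRHS]real_normK ?num_real// lerXn2r ?nnegrE.
have -> : cos x = 1 - 2 * sin (x / 2) ^+ 2.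
  have {1}-> : x = x / 2 + x / 2 by field.
  rewrite cosD -!expr2; have := cos2Dsin2 (x / 2); lra.
have -> : x ^+ 2 / 2 = 2 * (x / 2) ^+ 2 by field.
lra.
Qed.

End Trigonometry.

Section Cutoff.
Context {R : realType}.
Implicit Types (chi : R -> R[i]).

Let csmooth_continuous chi : csmooth chi ->
  continuous (fun t => complex.Re (chi t)) /\ continuous (fun t => complex.Im (chi t)).
Proof.
move=> [s1 s2]; split => t.
- exact: (differentiable_continuous (s1 [::] t)).
- exact: (differentiable_continuous (s2 [::] t)).
Qed.

Let bounded_of_compact (f : R -> R) (K : set R) : compact K -> continuous f ->
  exists M : R, forall t, K t -> `|f t| <= M.
Proof.
move=> cK cf.
have /compact_bounded[M [_ hM]] : compact (f @` K).
  by apply: continuous_compact => //; exact: continuous_subspaceT.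
(* Boundedness only provides the estimate for numbers strictly above [M]. *)
exists (M + 1) => t Kt.
by apply: (hM (M + 1)); [rewrite ltrDl|exists t].
Qed.

(** All that the examples use of the cutoff. Positivity near [t0] of a complex-valued [chi] is
    expressed by the real part of [conj (chi t0) * chi t], the right side of the last clause. *)
Lemma Cc_smooth_pos_cutoff chi : Cc_smooth_pos chi -> (exists t, chi t != 0) ->
  exists (t0 T M r : R), [/\ chi t0 != 0, 0 < t0, 0 < r, 0 <= M &
   [/\ forall t, chi t != 0 -> 0 < t <= T,
       forall t, Normc.normc (chi t) <= M &
       forall t, `|t - t0| < r ->
         Normc.normc (chi t0) ^+ 2 / 2 <=
         complex.Re (chi t0) * complex.Re (chi t) + complex.Im (chi t0) * complex.Im (chi t)]].
Proof.
move=> [/csmooth_continuous[c1 c2] cK Kpos] [t0 ct0].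
have inK t : chi t != 0 -> closure [set t | chi t != 0] t by move=> ?; exact: subset_closure.
have [M1 hM1] := bounded_of_compact cK c1.
have [M2 hM2] := bounded_of_compact cK c2.
have [T hT] := @bounded_of_compact id _ cK (fun x => cvg_id).
pose g t := complex.Re (chi t0) * complex.Re (chi t) + complex.Im (chi t0) * complex.Im (chi t).
have gt0E : g t0 = Normc.normc (chi t0) ^+ 2.
  by rewrite normc_sqrtE sqr_sqrtr ?addr_ge0 ?sqr_ge0// /g -!expr2.
have n0 : 0 < Normc.normc (chi t0) ^+ 2.
  rewrite exprn_gt0// lt_neqAle normc_ge0 andbT eq_sym.
  by apply: contra ct0 => /eqP/Normc.eq0_normc ->.
have cg : {for t0, continuous g}.
  by apply: cvgD; apply: cvgM; try exact: cvg_cst; [exact: c1|exact: c2].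
have : \forall t \near t0, g t0 / 2 < g t.
  have h : 0 < g t0 / 2 by rewrite gt0E; lra.
  move/cvgrPdist_lt : cg => /(_ _ h); apply: filterS => t.
  by rewrite ltr_distlC => /andP[+ _]; lra.
move=> /nbhs_ballP[r r0 hr].
exists t0, T, (`|M1| + `|M2|), r; split => //.
- by have := Kpos _ (inK _ ct0).
split.
- move=> t ct; rewrite (Kpos _ (inK _ ct))/=.
  by apply: le_trans (hT _ (inK _ ct)); exact: ler_norm.
- move=> t; have [->|ct] := eqVneq (chi t) 0; first by rewrite Normc.normc0 addr_ge0.
  apply: le_trans (normc_le_ReIm _) _; apply: lerD.
  + by apply: le_trans (hM1 _ (inK _ ct)) _; exact: ler_norm.
  + by apply: le_trans (hM2 _ (inK _ ct)) _; exact: ler_norm.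
- move=> t tr; rewrite -gt0E; apply/ltW/hr.
  by rewrite /ball/= distrC.
Qed.

End Cutoff.

Section LowerBound.
Context {R : realType}.
Notation V := (R * R * R * R)%type.
Notation mu := (@lebesgue_measure R).

Lemma Rintegral_indic_itv (a b : R) : a <= b ->
  mu.-integrable setT (EFin \o (\1_(`[a, b]%classic : set R) : R -> R)) /\
  Rintegral mu setT (\1_(`[a, b]%classic : set R)) = b - a.
Proof.
move=> ab.
have E : (\int[mu]_x (\1_(`[a, b]%classic : set R) x)%:E = (b - a)%:E)%E.
  rewrite integral_indic// setIT [LHS]lebesgue_measure_itv/= lte_fin.
  have [ab'|ba] := ltP a b; first by rewrite -EFinB.
  by have -> : b = a; [apply/eqP; rewrite eq_le ab ba|rewrite subrr].
split.
  apply/integrableP; split; first exact/measurable_EFinP/measurable_indic.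
  under eq_integral do rewrite /= ger0_norm//.
  by rewrite E ltry.
by rewrite /Rintegral E.
Qed.

Definition cube_indic (d : R) (y x : V) : R :=
  \1_(`[y.1.1.1 - d, y.1.1.1 + d]%classic : set R) x.1.1.1 *
  \1_(`[y.1.1.2 - d, y.1.1.2 + d]%classic : set R) x.1.1.2 *
  \1_(`[y.1.2 - d, y.1.2 + d]%classic : set R) x.1.2 *
  \1_(`[y.2 - d, y.2 + d]%classic : set R) x.2.

Lemma Rintegral_cube_indic (d : R) (y : V) : 0 <= d ->
  leb4.-integrable setT (EFin \o cube_indic d y) /\
  Rintegral leb4 setT (cube_indic d y) = (2 * d) ^+ 4.
Proof.
move=> d0.
have le (c : R) : c - d <= c + d by lra.
have i (c : R) := cintegrable_real (Rintegral_indic_itv (le c)).1.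
have := cintegrable_prod4 (i y.1.1.1) (i y.1.1.2) (i y.1.2) (i y.2).
have := cintegral_prod4 (i y.1.1.1) (i y.1.1.2) (i y.1.2) (i y.2).
have e (c : R) : Rintegral mu setT (\1_(`[c - d, c + d]%classic : set R)) = 2 * d.
  by rewrite (Rintegral_indic_itv (le c)).2; ring.
rewrite !cintegral_real !e -!rmorphM/=.
have E (x : V) : real_complex R (\1_(`[y.1.1.1 - d, y.1.1.1 + d]%classic : set R) x.1.1.1) *
  real_complex R (\1_(`[y.1.1.2 - d, y.1.1.2 + d]%classic : set R) x.1.1.2) *
  real_complex R (\1_(`[y.1.2 - d, y.1.2 + d]%classic : set R) x.1.2) *
  real_complex R (\1_(`[y.2 - d, y.2 + d]%classic : set R) x.2) = real_complex R (cube_indic d y x).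
  by rewrite /cube_indic !rmorphM.
rewrite (funext E) cintegral_real => -[h] [ic _]; split => //.
by rewrite h; ring.
Qed.

Lemma cube_indicP (d : R) (y x : V) :
  cube_indic d y x = 0 \/
  [/\ cube_indic d y x = 1, `|x.1.1.1 - y.1.1.1| <= d, `|x.1.1.2 - y.1.1.2| <= d,
      `|x.1.2 - y.1.2| <= d & `|x.2 - y.2| <= d].
Proof.
have key (c u : R) : \1_(`[c - d, c + d]%classic : set R) u = 0 :> R \/
    \1_(`[c - d, c + d]%classic : set R) u = 1 :> R /\ `|u - c| <= d.
  rewrite indicE; case: (boolP (u \in _)) => [|_]; last by left.
  by rewrite inE/= in_itv/= => h; right; rewrite ler_distl.
rewrite /cube_indic.
have [->|[-> h1]] := key y.1.1.1 x.1.1.1; first by left; rewrite !mul0r.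
have [->|[-> h2]] := key y.1.1.2 x.1.1.2; first by left; rewrite mulr0 !mul0r.
have [->|[-> h3]] := key y.1.2 x.1.2; first by left; rewrite mulr0 !mul0r.
have [->|[-> h4]] := key y.2 x.2; first by left; rewrite mulr0.
by right; rewrite !mulr1.
Qed.

Variables (chi : R -> R[i]) (t0 r Mchi : R).
Hypothesis chi_le : forall t, Normc.normc (chi t) <= Mchi.
Hypothesis chi_near : forall t, `|t - t0| < r ->
  Normc.normc (chi t0) ^+ 2 / 2 <=
  complex.Re (chi t0) * complex.Re (chi t) + complex.Im (chi t0) * complex.Im (chi t).

(** After multiplication by the conjugate of [chi t0] the integrand has nonnegative real part where
    [|x.2 - t0| < r]. On the cube of half side [sqrt tau], of volume [16 tau^2], one has
    [|x - y|^2 <= 4 tau], so the Gaussian is at least [e^(-1)]. Where [|x.2 - t0| >= r], half of the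
    exponent yields [exp (- r^2 / (8 tau))] and the other half is a Gaussian of mass
    [(8 pi tau)^2]. *)
Lemma gaussian_average_lower (B : V -> R) (y : V) (tau M cB : R) :
  y.2 = t0 -> 0 < tau -> Num.sqrt tau < r -> (forall x, 0 <= B x <= M) -> 0 <= cB ->
  (forall x, `|x.1.1.1 - y.1.1.1| <= Num.sqrt tau -> `|x.1.1.2 - y.1.1.2| <= Num.sqrt tau ->
     `|x.1.2 - y.1.2| <= Num.sqrt tau -> `|x.2 - y.2| <= Num.sqrt tau -> cB <= B x) ->
  cintegrable leb4 (fun x => chi x.2 * real_complex R (B x * gauss4 (4 * tau)^-1 y x)) ->
  cB * (Normc.normc (chi t0) ^+ 2 / 2) * expR (-1) * (16 * tau ^+ 2) -
  Normc.normc (chi t0) * Mchi * M * expR (- (r ^+ 2 / (8 * tau))) * (8 * pi * tau) ^+ 2 <=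
  Normc.normc (chi t0) * Normc.normc (cintegral leb4 setT
    (fun x => chi x.2 * real_complex R (B x * gauss4 (4 * tau)^-1 y x))).
Proof.
move=> yt0 tau0 taur B0M cB0 cB_le iF.
set n0 := Normc.normc (chi t0).
have n00 : 0 <= n0 := normc_ge0 _.
have k8 : 0 < (8 * tau)^-1 by rewrite invr_gt0 mulr_gt0.
set cc := Complex (complex.Re (chi t0)) (- complex.Im (chi t0)).
have ncc : Normc.normc cc = n0 by rewrite /n0 !normc_sqrtE/= sqrrN.
pose f x := complex.Re (cc * (chi x.2 * real_complex R (B x * gauss4 (4 * tau)^-1 y x))).
have iccF := cintegrableZl cc iF.
rewrite -[X in _ <= X * _]ncc -Normc.normcM -(cintegralZl cc iF).
apply: le_trans (normc_Re _); apply: le_trans (ler_norm _).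
have sq0 : 0 <= Num.sqrt tau := sqrtr_ge0 _.
have sq2 : Num.sqrt tau ^+ 2 = tau by rewrite sqr_sqrtr// ltW.
have [ic Ic] := Rintegral_cube_indic y sq0.
have ig := integrable_gauss4 y k8.
set A1 := cB * (n0 ^+ 2 / 2) * expR (-1).
set A2 := n0 * Mchi * M * expR (- (r ^+ 2 / (8 * tau))).
have E : A1 * (16 * tau ^+ 2) - A2 * (8 * pi * tau) ^+ 2 =
   Rintegral leb4 setT (fun x => A1 * cube_indic (Num.sqrt tau) y x - A2 * gauss4 (8 * tau)^-1 y x).
  rewrite RintegralB//; last 2 first.
  - by have := integrableZl measurableT A1 ic; apply: eq_integrable.
  - by have := integrableZl measurableT A2 ig; apply: eq_integrable.
  rewrite !RintegralZl// Ic Rintegral_gauss4//; congr (_ * _ - _ * _).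
    have -> : (2 * Num.sqrt tau) ^+ 4 = 16 * (Num.sqrt tau ^+ 2) ^+ 2 by ring.
    by rewrite sq2.
  by rewrite invrK; ring.
rewrite E; apply: le_Rintegral => //.
- have i1 : leb4.-integrable setT (EFin \o (fun x => A1 * cube_indic (Num.sqrt tau) y x)).
    by have := integrableZl measurableT A1 ic; apply: eq_integrable.
  have i2 : leb4.-integrable setT (EFin \o (fun x => A2 * gauss4 (8 * tau)^-1 y x)).
    by have := integrableZl measurableT A2 ig; apply: eq_integrable.
  by have := integrableB measurableT i1 i2; apply: eq_integrable.
- exact: iccF.1.
move=> x _.
have /andP[Bx0 BxM] := B0M x.
have Mchi0 : 0 <= Mchi := le_trans (normc_ge0 (chi 0)) (chi_le 0).
have M0 : 0 <= M := le_trans Bx0 BxM.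
have g0 := gauss4_ge0 (4 * tau)^-1 y x.
have A20 : 0 <= A2 by rewrite /A2 !mulr_ge0 ?expR_ge0.
have g80 := gauss4_ge0 (8 * tau)^-1 y x.
have [xr|xr] := ltP `|x.2 - t0| r.
  have -> : complex.Re (cc * (chi x.2 * real_complex R (B x * gauss4 (4 * tau)^-1 y x))) =
     (complex.Re (chi t0) * complex.Re (chi x.2) + complex.Im (chi t0) * complex.Im (chi x.2)) *
     (B x * gauss4 (4 * tau)^-1 y x).
    by rewrite !cReM !cImM/=; ring.
  have cn := chi_near xr; rewrite -/n0 in cn.
  have n20 : 0 <= n0 ^+ 2 / 2 by rewrite divr_ge0 ?sqr_ge0.
  apply: (@le_trans _ _ (n0 ^+ 2 / 2 * (B x * gauss4 (4 * tau)^-1 y x))); last first.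
    by rewrite ler_wpM2r// mulr_ge0.
  have bg0 : 0 <= B x * gauss4 (4 * tau)^-1 y x by rewrite mulr_ge0.
  have [->|[-> h1 h2 h3 h4]] := cube_indicP (Num.sqrt tau) y x.
    by rewrite mulr0 sub0r (@le_trans _ _ 0)// ?oppr_le0 mulr_ge0.
  rewrite mulr1 lerBlDr -[leLHS]addr0 lerD//; last by rewrite mulr_ge0.
  have -> : A1 = n0 ^+ 2 / 2 * (cB * expR (-1)) by rewrite /A1; ring.
  rewrite ler_wpM2l// ler_pM ?expR_ge0//; first exact: cB_le.
  have sqle (u : R) : `|u| <= Num.sqrt tau -> u * u <= tau.
    by move=> hu; rewrite -expr2 -real_normK ?num_real// -sq2 lerXn2r ?nnegrE.
  rewrite ler_expR lerN2 ler_pdivrMl ?mulr_gt0//.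
  rewrite mulr1 /dot4/=.
  have := sqle _ h1; have := sqle _ h2; have := sqle _ h3; have := sqle _ h4; lra.
have -> : cube_indic (Num.sqrt tau) y x = 0.
  have [->//|[_ _ _ _ h4]] := cube_indicP (Num.sqrt tau) y x.
  by rewrite yt0 in h4; have := lt_le_trans taur xr; rewrite ltNge h4.
rewrite mulr0 sub0r; apply: lerNnormlW; apply: le_trans (normc_Re _) _.
rewrite !Normc.normcM ncc normc_real ger0_norm ?mulr_ge0//.
rewrite /A2 -!mulrA ler_wpM2l//.
rewrite ler_pM ?normc_ge0 ?mulr_ge0// ler_pM//.
rewrite /gauss4 -expRD ler_expR -opprD lerN2.
have -> : (4 * tau)^-1 * dot4 (x - y) (x - y) =
  (8 * tau)^-1 * dot4 (x - y) (x - y) + (8 * tau)^-1 * dot4 (x - y) (x - y).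
  by field; rewrite gt_eqF.
rewrite lerD2r.
have -> : r * (r / (8 * tau)) = (8 * tau)^-1 * r ^+ 2 by ring.
rewrite ler_wpM2l ?(ltW k8)//.
apply: (@le_trans _ _ ((x.2 - t0) ^+ 2)).
  rewrite -[leRHS]real_normK ?num_real// lerXn2r ?nnegrE//.
  by apply: le_trans (sqrtr_ge0 tau) (ltW taur).
rewrite /dot4/= yt0 -!expr2 lerDr !addr_ge0 ?sqr_ge0//.
Qed.

End LowerBound.

(** * Averages over tori *)

Section TorusAverage.
Context {R : realType}.
Notation mu := (@lebesgue_measure R).
Notation W := (R * R * R)%type.

Definition angles : set (R * R) := `[0, 2 * pi[ `*` `[0, 2 * pi[.

Lemma measurable_angles : measurable angles.
Proof. exact: measurableX. Qed.

Lemma leb2_rect (a b c d : R) : a <= b -> c <= d ->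
  leb2 ((`[a, b[%classic : set R) `*` `[c, d[%classic) = ((b - a) * (d - c))%:E.
Proof.
move=> ab cd; rewrite /leb2 product_measure1E// EFinM; congr (_ * _)%E.
- rewrite [LHS]lebesgue_measure_itv/= lte_fin.
  have [ab'|ba] := ltP a b; first by rewrite -EFinB.
  by have -> : b = a; [apply/eqP; rewrite eq_le ab ba|rewrite subrr].
- rewrite [LHS]lebesgue_measure_itv/= lte_fin.
  have [ab'|ba] := ltP c d; first by rewrite -EFinB.
  by have -> : d = c; [apply/eqP; rewrite eq_le cd ba|rewrite subrr].
Qed.

Lemma leb2_angles : leb2 angles = ((2 * pi) ^+ 2)%:E.
Proof.
have p0 : 0 <= 2 * pi :> R by rewrite mulr_ge0// pi_ge0.
by rewrite [LHS](leb2_rect p0 p0) subr0 expr2.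
Qed.

Lemma integrable_angles (g : R * R -> R) (M : R) : measurable_fun setT g ->
  (forall w, `|g w| <= M) -> leb2.-integrable angles (EFin \o g).
Proof.
move=> mg gM; apply/integrableP; split.
  by apply/measurable_EFinP; exact: measurable_funTS.
apply: (@le_lt_trans _ _ (\int[leb2]_(w in angles) (M%:E))%E).
  apply: ge0_le_integral => //.
  - exact: measurable_angles.
  - by apply: measurableT_comp => //; apply/measurable_EFinP; exact: measurable_funTS.
  - by move=> w _; rewrite lee_fin.
rewrite integral_cst; last exact: measurable_angles.
by rewrite [X in (_ * X < _)%E]leb2_angles -EFinM ltry.
Qed.

Lemma Rintegral_angles_le (g : R * R -> R) (M : R) : measurable_fun setT g ->
  (forall w, `|g w| <= M) -> Rintegral leb2 angles g <= M * (2 * pi) ^+ 2.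
Proof.
move=> mg gM; have M0 : 0 <= M := le_trans (normr_ge0 _) (gM 0).
have -> : M * (2 * pi) ^+ 2 = Rintegral leb2 angles (fun=> M).
  rewrite Rintegral_cst; last exact: measurable_angles.
  by rewrite [X in fine X]leb2_angles.
apply: le_Rintegral; first exact: measurable_angles.
- exact: integrable_angles gM.
- by apply: (@integrable_angles (fun=> M) M) => // w; rewrite ger0_norm.
- by move=> w _; apply: le_trans (ler_norm _) (gM w).
Qed.

Lemma Rintegral_angles_ge (g : R * R -> R) (M c : R) (A : set (R * R)) : measurable_fun setT g ->
  (forall w, 0 <= g w <= M) -> measurable A -> A `<=` angles ->
  (forall w, A w -> c <= g w) -> c * fine (leb2 A) <= Rintegral leb2 angles g.
Proof.
move=> mg gM mA AD cg.
have gM' w : `|g w| <= M by have /andP[g0 gm] := gM w; rewrite ger0_norm.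
have mI : measurable_fun setT (fun w => c * \1_A w) by apply: measurable_funM.
have -> : c * fine (leb2 A) = Rintegral leb2 angles (fun w => c * \1_A w).
  rewrite RintegralZl; last 2 first.
  - exact: measurable_angles.
  - apply: (@integrable_angles (\1_A) 1) => // w.
    by rewrite indicE ger0_norm ?ler0n// lern1 leq_b1.
  rewrite /Rintegral integral_indic//; last exact: measurable_angles.
  by rewrite setIidl.
apply: le_Rintegral; first exact: measurable_angles.
- apply: (@integrable_angles _ `|c|) => // w.
  rewrite normrM ler_piMr// indicE ger0_norm ?ler0n// lern1 leq_b1//.
- exact: integrable_angles gM'.
- move=> w _; rewrite indicE; case: (boolP (w \in A)) => [|_].
    by rewrite inE mulr1 => /cg.
  by rewrite mulr0; case/andP : (gM w).
Qed.

Lemma measurable_torus (s t : R) (x : W) :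
  measurable_fun setT (fun w : R * R => x - torus_param s t w.1 w.2 : W).
Proof.
have mc (f : R * R -> R) : measurable_fun setT f -> measurable_fun setT (fun w => cos (f w)).
  by apply: measurableT_comp; apply: continuous_measurable_fun; exact: continuous_cos.
have ms (f : R * R -> R) : measurable_fun setT f -> measurable_fun setT (fun w => sin (f w)).
  by apply: measurableT_comp; apply: continuous_measurable_fun; exact: continuous_sin.
have m1 : measurable_fun setT (fun w : R * R => w.1) := measurable_fst.
have m2 : measurable_fun setT (fun w : R * R => w.2) := measurable_snd.
apply: measurable_fun_pair => /=; first apply: measurable_fun_pair => /=.
- apply: measurable_funB => //; apply: measurable_funM; last exact: mc.
  by apply: measurable_funD => //; apply: measurable_funM => //; exact: mc.
- apply: measurable_funB => //; apply: measurable_funM; last exact: ms.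
  by apply: measurable_funD => //; apply: measurable_funM => //; exact: mc.
- by apply: measurable_funB => //; apply: measurable_funM => //; exact: ms.
Qed.

Lemma torus_avg_eq0 (s t : R) (f : W -> R[i]) (x : W) :
  (forall w, f (x - torus_param s t w.1 w.2) = 0) -> torus_avg s t f x = 0.
Proof.
move=> f0; rewrite /torus_avg; under eq_cintegral do rewrite f0.
by rewrite (cintegral_real leb2 _ (fun=> 0)) /Rintegral integral0_eq.
Qed.

Lemma torus_param_le (s t T theta phi : R) : 0 <= s <= t -> t <= T ->
  [/\ `|(torus_param s t theta phi).1.1| <= 2 * T,
      `|(torus_param s t theta phi).1.2| <= 2 * T &
      `|(torus_param s t theta phi).2| <= 2 * T].
Proof.
move=> /andP[s0 st] tT; have t0 : 0 <= t := le_trans s0 st.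
have h : `|t + s * cos theta| <= 2 * T.
  apply: le_trans (ler_normD _ _) _; rewrite normrM (ger0_norm t0) (ger0_norm s0).
  have := cos_max theta => c1; have : s * `|cos theta| <= s by rewrite ler_piMr.
  lra.
rewrite /torus_param/=; split.
- by rewrite normrM; apply: le_trans h; rewrite ler_piMr// cos_max.
- by rewrite normrM; apply: le_trans h; rewrite ler_piMr// sin_max.
- rewrite normrM (ger0_norm s0); have := sin_max theta => s1.
  have : s * `|sin theta| <= s by rewrite ler_piMr.
  lra.
Qed.

Lemma torus_param_lipschitz (c t t' a a' b b' : R) : 0 <= c <= 1 -> 0 <= t' ->
  let d := 2 * `|t - t'| + t' * (`|a - a'| + 2 * `|b - b'|) in
  [/\ `|(torus_param (c * t) t a b).1.1 - (torus_param (c * t') t' a' b').1.1| <= d,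
      `|(torus_param (c * t) t a b).1.2 - (torus_param (c * t') t' a' b').1.2| <= d &
      `|(torus_param (c * t) t a b).2 - (torus_param (c * t') t' a' b').2| <= d].
Proof.
move=> /andP[c0 c1] t'0 d.
have key (u v v' : R) : `|v| <= 1 -> `|v'| <= 1 -> `|v - v'| <= `|b - b'| ->
    `|(t + c * t * cos a) * v - (t' + c * t' * cos a') * v'| <= d.
  move=> v1 v'1 vv'.
  have -> : (t + c * t * cos a) * v - (t' + c * t' * cos a') * v' =
     (t - t') * ((1 + c * cos a) * v) + t' * ((c * (cos a - cos a')) * v + (1 + c * cos a') * (v - v')) by ring.
  have k1 z : `|1 + c * cos z| <= 2.
    apply: le_trans (ler_normD _ _) _; rewrite normr1 normrM (ger0_norm c0).
    have := cos_max z => cz; have : c * `|cos z| <= 1 * 1 by apply: ler_pM.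
    lra.
  apply: le_trans (ler_normD _ _) _; rewrite /d; apply: lerD.
    rewrite normrM mulrC ler_wpM2r// normrM -[leRHS]mulr1; exact: ler_pM.
  rewrite normrM (ger0_norm t'0) ler_wpM2l//.
  apply: le_trans (ler_normD _ _) _; apply: lerD.
    rewrite !normrM (ger0_norm c0) -[leRHS]mulr1; apply: ler_pM => //; first by rewrite mulr_ge0.
    by rewrite -[leRHS]mul1r; apply: ler_pM => //; exact: cos_lipschitz.
  by rewrite normrM; exact: ler_pM.
rewrite /torus_param/=; split.
- by apply: key; rewrite ?cos_max ?cos_lipschitz.
- by apply: key; rewrite ?sin_max ?sin_lipschitz.
- have -> : c * t * sin a - c * t' * sin a' = c * ((t - t') * sin a + t' * (sin a - sin a')) by ring.
  rewrite normrM (ger0_norm c0).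
  apply: (@le_trans _ _ `|(t - t') * sin a + t' * (sin a - sin a')|); first by rewrite ler_piMl.
  apply: le_trans (ler_normD _ _) _; rewrite /d; apply: lerD.
    rewrite normrM mulrC ler_pM//.
    by apply: le_trans (sin_max a) _; lra.
  rewrite normrM (ger0_norm t'0) ler_wpM2l//.
  apply: le_trans (sin_lipschitz _ _) _.
  by rewrite lerDl mulr_ge0.
Qed.

Definition box3 (d : R) (c : W) : set W :=
  (`[c.1.1 - d, c.1.1 + d]%classic `*` `[c.1.2 - d, c.1.2 + d]%classic)
   `*` `[c.2 - d, c.2 + d]%classic.

Lemma box3P (d : R) (c v : W) : box3 d c v <->
  [/\ `|v.1.1 - c.1.1| <= d, `|v.1.2 - c.1.2| <= d & `|v.2 - c.2| <= d].
Proof.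
rewrite /box3/= !in_itv/= !ler_distl; split; first by case=> -[].
by case.
Qed.

Lemma measurable_box3 (d : R) (c : W) : measurable (box3 d c).
Proof. by apply: measurableX => //; exact: measurableX. Qed.

Lemma leb3_box3 (d : R) (c : W) : 0 <= d -> leb3 (box3 d c) = ((2 * d) ^+ 3)%:E.
Proof.
move=> d0.
have l (u : R) : mu `[u - d, u + d]%classic = (2 * d)%:E.
  rewrite [LHS]lebesgue_measure_itv/= lte_fin.
  have [h|h] := ltP (u - d) (u + d); first by rewrite -EFinB; congr EFin; ring.
  by have -> : d = 0; [apply/eqP; rewrite eq_le d0 andbT; lra|rewrite mulr0].
rewrite /leb3 product_measure1E//; last exact: measurableX.
have e2 : leb2 (`[c.1.1 - d, c.1.1 + d]%classic `*` `[c.1.2 - d, c.1.2 + d]%classic) =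
    ((2 * d) * (2 * d))%:E.
  by rewrite /leb2 product_measure1E// EFinM; congr (_ * _)%E; exact: l.
rewrite [X in (X * _)%E]e2 [X in (_ * X)%E]l -EFinM; congr EFin; ring.
Qed.

Lemma cLnorm_indic (p c : R) (f : W -> R[i]) (E : set W) : 0 < p ->
  (forall v, Normc.normc (f v) = \1_E v) -> measurable E -> leb3 E = c%:E ->
  cLnorm leb3 p%:E f = (c `^ p^-1)%:E.
Proof.
move=> p0 fE mE cE; rewrite /cLnorm unlock.
have -> : (\int[leb3]_x `|(Normc.normc (f x))%:E| `^ p)%E = (\int[leb3]_x (\1_E x)%:E)%E.
  apply: eq_integral => x _ /=; rewrite fE ger0_norm//.
  by rewrite indicE; case: (x \in E); rewrite ?powR1 ?powR0 ?gt_eqF.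
by rewrite integral_indic// setIT [X in (X `^ _)%E]cE poweR_EFin.
Qed.

(** A nonzero value requires a point of the reflected torus about [x.1] in the box, so each space
    coordinate is at most [L + 2 T]. This is the bounded support asked for by
    [tempered_cintegrable]. *)
Lemma torus_avg_support (chi : R -> R[i]) (c T L : R) (f : W -> R[i]) :
  0 <= c <= 1 -> (forall t, chi t != 0 -> 0 < t <= T) ->
  (forall v, f v != 0 -> box3 L 0 v) ->
  forall x : R * R * R * R, 3 * (L + 2 * T) ^+ 2 + T ^+ 2 < dot4 x x ->
  chi x.2 * torus_avg (c * x.2) x.2 f x.1 = 0.
Proof.
move=> /andP[c0 c1] chiT fL x; apply: contraTeq => F0; rewrite -leNgt.
have chi0 : chi x.2 != 0 by apply: contraNneq F0 => ->; rewrite mul0r.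
have /andP[t0 tT] := chiT _ chi0.
have [w fw] : exists w : R * R, f (x.1 - torus_param (c * x.2) x.2 w.1 w.2) != 0.
  apply: contrapT => /forallNP h; move: F0; rewrite torus_avg_eq0 ?mulr0 ?eqxx// => w.
  by move: (h w) => /negP; rewrite negbK => /eqP.
have st : 0 <= c * x.2 <= x.2 by rewrite mulr_ge0 ?(ltW t0)//= ler_piMl// ltW.
have [p1 p2 p3] := torus_param_le w.1 w.2 st tT.
move/fL/box3P : fw => /= [].
rewrite !subr0 => f1 f2 f3.
have T0 : 0 <= T by lra.
have key (u q : R) : `|q| <= 2 * T -> `|u - q| <= L -> u * u <= (L + 2 * T) ^+ 2.
  move=> hq hu; rewrite -expr2 -real_normK ?num_real// lerXn2r ?nnegrE//.
    by have := normr_ge0 (u - q); lra.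
  have -> : u = (u - q) + q by ring.
  by apply: le_trans (ler_normD _ _) _; exact: lerD.
rewrite /dot4.
have := key _ _ p1 f1; have := key _ _ p2 f2; have := key _ _ p3 f3.
have : x.2 * x.2 <= T ^+ 2 by rewrite -expr2 lerXn2r ?nnegrE ?(ltW t0).
lra.
Qed.

End TorusAverage.

(** * The assumed bound, tested on modulated Gaussians *)

Section OperatorBound.
Context {R : realType}.
Notation V := (R * R * R * R)%type.
Notation W := (R * R * R)%type.
Lemma cintegrable_mul_cis_gauss4 (F : V -> R[i]) (y z : V) (a : R) : 0 < a ->
  cintegrable leb4 F -> cintegrable leb4
    (fun x => F x * (cis (dot4 (y - x) z) * real_complex R (gauss4 a y x))).
Proof.
move=> a0 iF; have /integrableP[/measurable_EFinP mg _] := integrable_gauss4 y a0.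
apply: (@cintegrable_le _ _ _ leb4 _ (fun x => Normc.normc (F x))).
- apply: cmeasurableM; first exact: cintegrable_measurable iF.
  apply: cmeasurableM; last exact: cmeasurable_real.
  by apply/cmeasurable_cis/measurable_dot4 => //; exact: measurable_sub4.
- move=> x; rewrite !Normc.normcM normc_cis mul1r normc_real ger0_norm ?gauss4_ge0//.
  rewrite ler_piMr ?normc_ge0// expR_le1 oppr_le0 mulr_ge0 ?dot4_ge0//.
  exact: ltW.
- exact: cintegrable_normc.
Qed.

Variables (chi : R -> R[i]) (p c alpha T C : R).
Hypothesis p1 : 1 < p.
Hypothesis alpha0 : 0 < alpha.
Hypothesis c01 : 0 <= c <= 1.
Hypothesis chiT : forall t, chi t != 0 -> 0 < t <= T.

Definition torus_op (f : W -> R[i]) (xt : V) : R[i] :=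
  chi xt.2 * torus_avg (c * xt.2) xt.2 f xt.1.

Hypothesis C_bound : forall f, inLp leb3 p%:E f ->
  (sobolev_norm p%:E alpha (torus_op f) <= C%:E * cLnorm leb3 p%:E f)%E.

(** The form in which boundedness enters both examples: Sobolev norms and functionals are gone, and
    only an explicit integral of the output remains. *)
Lemma operator_dual_bound (f : W -> R[i]) (L n M : R) (y zeta : V) (tau : R) :
  inLp leb3 p%:E f -> (forall v, f v != 0 -> box3 L 0 v) ->
  cLnorm leb3 p%:E f = n%:E -> C * n < M -> 0 < tau ->
  cintegrable leb4 (torus_op f) /\
  Normc.normc (cintegral leb4 setT (fun x => torus_op f x *
    (cis (dot4 (y - x) zeta) * real_complex R (gauss4 (4 * tau)^-1 y x)))) <=
  dual_const p alpha * tau ^+ 2 * M * decay_integral (alpha / 2) p tau (dot4 zeta zeta).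
Proof.
move=> fp fL fn CM t0.
have [|G [tF iG FG GM]] := @bounded_representative R p alpha C (torus_op f) _ M%:E (C_bound fp).
  by rewrite fn -EFinM lte_fin.
have iF : cintegrable leb4 (torus_op f).
  exact: (tempered_cintegrable tF (torus_avg_support c01 chiT fL)).
split => //; apply: le_trans (sobolev_dual_bound p1 alpha0 y zeta t0 iF iG FG) _.
have d0 : 0 <= decay_integral (alpha / 2) p tau (dot4 zeta zeta).
  by apply: Rintegral_ge0 => v _; apply: mulr_ge0; [exact: wexp_ge0|exact: decay_weight_ge0].
rewrite ler_wpM2r// ler_wpM2l//.
  by rewrite mulr_ge0 ?sqr_ge0 ?dual_const_ge0.
rewrite -lee_fin fineK//; have [_ Gfin] := iG.
by rewrite ge0_fin_numE// Lnorm_ge0.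
Qed.

End OperatorBound.

Section Asymptotics.
Context {R : realType}.

Lemma archimedean_contra (c C : R) (j0 : nat) : 0 < c ->
  ~ (forall j, (j0 <= j)%N -> c <= C / j.+1%:R).
Proof.
move=> c0 H; have C0 : 0 < C.
  have := H _ (leqnn j0); rewrite ler_pdivlMr ?ltr0n// => h.
  by apply: lt_le_trans h; rewrite mulr_gt0// ltr0n.
have := archi_boundP (ltW (divr_gt0 C0 c0)); set k := Num.bound _ => hk.
have := H _ (leq_maxl j0 k); apply/negP; rewrite -ltNge.
rewrite ltr_pdivrMr ?ltr0n// mulrC -ltr_pdivrMr//; apply: lt_le_trans hk _.
by rewrite ler_nat (leq_trans (leq_maxr j0 k)).
Qed.

(** The [(k + 1)]-st power of [e^(-s) <= 1 / s] at [s = x / (k + 1)]: decay of any polynomial order,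
    to beat the growth of the number of waves. *)
Lemma expRN_le_exprVn (x : R) (k : nat) : 0 < x -> expR (- x) <= (k.+1%:R / x) ^+ k.+1.
Proof.
move=> x0; have k0 : 0 < k.+1%:R :> R by rewrite ltr0n.
have -> : - x = k.+1%:R * - (x / k.+1%:R) by field; rewrite gt_eqF.
rewrite expRM_natl lerXn2r ?nnegrE ?expR_ge0 ?divr_ge0 ?(ltW x0)//.
have y0 : 0 < x / k.+1%:R by rewrite divr_gt0.
rewrite expRN -[leRHS]invf_div lef_pV2 ?posrE ?expR_gt0//.
by apply: le_trans (expR_ge1Dx _); rewrite lerDr.
Qed.

End Asymptotics.

(** * Neighbourhoods of a torus *)

Section TorusNeighborhood.
Context {R : realType}.
Notation V := (R * R * R * R)%type.
Notation W := (R * R * R)%type.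

Lemma measure_bigsetU_le d (T : measurableType d) (m : {measure set T -> \bar R})
  (A : nat -> set T) (c : R) (n : nat) : (forall i, measurable (A i)) ->
  (forall i, (m (A i) <= c%:E)%E) ->
  (m (\big[setU/set0]_(i < n) A i) <= (n%:R * c)%:E)%E.
Proof.
move=> mA mc; elim: n => [|n ih]; first by rewrite big_ord0 measure0 mul0r.
rewrite big_ord_recr/=; apply: le_trans (measureU2 _ _ _) _ => //.
  by apply: bigsetU_measurable => i _.
by rewrite -natr1 mulrDl mul1r EFinD; apply: leeD; [exact: ih|exact: mc].
Qed.

Lemma grid_point (n : nat) (theta : R) : 0 <= theta < 2 * pi ->
  exists2 i : nat, (i < n.+1)%N &
  `|theta - 2 * pi * i%:R / n.+1%:R| <= 2 * pi / n.+1%:R.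
Proof.
move=> /andP[t0 t1]; have p0 : 0 < 2 * pi :> R by rewrite mulr_gt0// pi_gt0.
have n0 : 0 < n.+1%:R :> R by rewrite ltr0n.
have floor (m : nat) (u : R) : 0 <= u < m%:R -> exists2 i, (i < m)%N & i%:R <= u <= i.+1%:R.
  elim: m => [|m ih] /andP[u0 um]; first by have := le_lt_trans u0 um; rewrite ltxx.
  have [um'|mu] := ltP u m%:R.
    have [|i im iu] := ih; first by rewrite u0.
    by exists i => //; exact: ltnW.
  by exists m => //; rewrite mu ltW.
have [|i im /andP[i1 i2]] := floor n.+1 (theta * n.+1%:R / (2 * pi)).
  apply/andP; split; first by apply: divr_ge0; [exact: mulr_ge0|exact: ltW].
  by rewrite ltr_pdivrMr// mulrC ltr_pM2l.
exists i => //.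
have e : theta - 2 * pi * i%:R / n.+1%:R =
    (theta * n.+1%:R / (2 * pi) - i%:R) * (2 * pi / n.+1%:R).
  move: (gt_eqF (pi_gt0 R)) (gt_eqF n0); move: (pi : R) (n.+1%:R) (i%:R) => P m k P0 m0.
  by field; rewrite P0 m0.
rewrite e normrM (ger0_norm (ltW (divr_gt0 p0 n0))) ler_piMl ?(ltW (divr_gt0 p0 n0))//.
by rewrite ger0_norm ?subr_ge0// lerBlDl natr1.
Qed.

Variables (c t0 : R).
Hypothesis c01 : 0 <= c <= 1.
Hypothesis t0_gt0 : 0 < t0.

(** With [N = n + 1], the radius [K / N] covers a spatial displacement [1 / N], twice a time
    displacement [1 / N], and [t0] times three angular steps [2 pi / N], as counted by
    [torus_param_lipschitz]. *)
Let K := 3 + 6 * pi * t0.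

Let node (n i j : nat) : W :=
  - torus_param (c * t0) t0 (2 * pi * i%:R / n.+1%:R) (2 * pi * j%:R / n.+1%:R).

(** A neighbourhood of width about [1 / N] of the reflected torus at time [t0], with [N = n + 1],
    encoded as a union of cubes around grid points: it is visibly measurable, and [N^2] cubes of
    volume [(2 K / N)^3] bound its measure by [8 K^3 / N]. *)
Definition torus_nbhs (n : nat) : set W :=
  \big[setU/set0]_(i < n.+1) \big[setU/set0]_(j < n.+1) box3 (K / n.+1%:R) (node n i j).

Let K0 : 0 < K.
Proof. by rewrite ltr_pwDl// mulr_ge0 ?mulr_ge0 ?pi_ge0 ?(ltW t0_gt0). Qed.

Lemma measurable_torus_nbhs n : measurable (torus_nbhs n).
Proof.
apply: bigsetU_measurable => i _; apply: bigsetU_measurable => j _.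
exact: measurable_box3.
Qed.

Lemma leb3_torus_nbhs n : (leb3 (torus_nbhs n) <= (8 * K ^+ 3 / n.+1%:R)%:E)%E.
Proof.
have n0 : 0 < n.+1%:R :> R by rewrite ltr0n.
have -> : 8 * K ^+ 3 / n.+1%:R = n.+1%:R * (n.+1%:R * (2 * (K / n.+1%:R)) ^+ 3).
  by field; rewrite gt_eqF.
apply: (@measure_bigsetU_le _ _ leb3
  (fun i => \big[setU/set0]_(j < n.+1) box3 (K / n.+1%:R) (node n i j))) => [i|i].
  by apply: bigsetU_measurable => j _; exact: measurable_box3.
apply: (@measure_bigsetU_le _ _ leb3 (fun j => box3 (K / n.+1%:R) (node n i j))) => [j|j].
  exact: measurable_box3.
by rewrite [X in (X <= _)%E]leb3_box3// divr_ge0// ltW.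
Qed.

Let torus_nbhsE n : torus_nbhs n =
  \bigcup_(i in `I_n.+1) \bigcup_(j in `I_n.+1) box3 (K / n.+1%:R) (node n i j).
Proof.
rewrite /torus_nbhs bigcup_mkord; apply: eq_bigr => i _.
by rewrite bigcup_mkord.
Qed.

Let torus_nbhsP n (v : W) (i j : nat) : (i < n.+1)%N -> (j < n.+1)%N ->
  box3 (K / n.+1%:R) (node n i j) v -> torus_nbhs n v.
Proof. by move=> i1 j1 bv; rewrite torus_nbhsE; exists i => //; exists j. Qed.

(** For [x] near 0 and [t] near [t0] the entire reflected torus about [x] stays in the
    neighbourhood, so the average of the indicator takes its full value there. *)
Lemma torus_nbhs_contains n (x : W) (t a b : R) :
  0 <= a < 2 * pi -> 0 <= b < 2 * pi ->
  `|x.1.1| <= n.+1%:R^-1 -> `|x.1.2| <= n.+1%:R^-1 -> `|x.2| <= n.+1%:R^-1 ->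
  `|t - t0| <= n.+1%:R^-1 -> torus_nbhs n (x - torus_param (c * t) t a b).
Proof.
move=> ha hb x1 x2 x3 tt.
have [i i1 hi] := grid_point n ha.
have [j j1 hj] := grid_point n hb.
apply: (torus_nbhsP i1 j1); apply/box3P.
have [] := torus_param_lipschitz t a (2 * pi * i%:R / n.+1%:R) b (2 * pi * j%:R / n.+1%:R) c01 (ltW t0_gt0).
set d := 2 * `|t - t0| + _ => h1 h2 h3.
have dle : d + n.+1%:R^-1 <= K / n.+1%:R.
  have -> : K / n.+1%:R = 2 * n.+1%:R^-1 + t0 * (2 * pi / n.+1%:R + 2 * (2 * pi / n.+1%:R)) + n.+1%:R^-1.
    by rewrite /K; ring.
  rewrite lerD2r /d; apply: lerD; first by rewrite ler_wpM2l.
  by rewrite ler_wpM2l ?(ltW t0_gt0)// lerD// ler_wpM2l.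
have key (u a' b' : R) : `|u| <= n.+1%:R^-1 -> `|a' - b'| <= d -> `|u - a' - - b'| <= K / n.+1%:R.
  move=> hu hab; have -> : u - a' - - b' = u - (a' - b') by ring.
  by apply: le_trans (ler_normB _ _) _; apply: le_trans dle; rewrite addrC lerD.
split; [exact: (key _ _ _ x1 h1)|exact: (key _ _ _ x2 h2)|exact: (key _ _ _ x3 h3)].
Qed.

Lemma torus_nbhs_bounded n v : torus_nbhs n v -> box3 (2 * t0 + K) 0 v.
Proof.
have n1 : n.+1%:R^-1 <= 1 :> R by rewrite invf_le1 ?ltr0n// ler1n.
have /andP[c0 c1] := c01.
have st : 0 <= c * t0 <= t0 by rewrite mulr_ge0 ?(ltW t0_gt0)//= ler_piMl// ltW.
rewrite torus_nbhsE => -[i _ [j _ /box3P[h1 h2 h3]]].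
have [p1 p2 p3] := torus_param_le (2 * pi * i%:R / n.+1%:R) (2 * pi * j%:R / n.+1%:R) st (lexx t0).
have key (u q : R) : `|q| <= 2 * t0 -> `|u - - q| <= K / n.+1%:R -> `|u - 0| <= 2 * t0 + K.
  move=> hq hu; have -> : u - 0 = - q + (u - - q) by ring.
  apply: le_trans (ler_normD _ _) _; apply: lerD; first by rewrite normrN.
  by apply: le_trans hu _; rewrite ler_piMr// ltW.
apply/box3P; split; [exact: (key _ _ p1 h1)|exact: (key _ _ p2 h2)|exact: (key _ _ p3 h3)].
Qed.

End TorusNeighborhood.

(** * The indicator of a neighbourhood of the torus: unboundedness for [alpha > 3/p] *)

Section NeighborhoodExample.
Context {R : realType}.
Notation V := (R * R * R * R)%type.
Notation W := (R * R * R)%type.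

Let measurable_avg_indic (E : set W) (s t : R) (x : W) : measurable E ->
  measurable_fun setT (fun w : R * R => \1_E (x - torus_param s t w.1 w.2) : R).
Proof. by move=> mE; apply: (measurableT_comp (measurable_indic mE)); exact: measurable_torus. Qed.

Definition avg_indic (c : R) (E : set W) (x : V) : R :=
  Rintegral leb2 angles (fun w => \1_E (x.1 - torus_param (c * x.2) x.2 w.1 w.2)).

Lemma torus_op_indic chi c (E : set W) (x : V) :
  torus_op chi c (fun v => real_complex R (\1_E v)) x =
  chi x.2 * real_complex R (avg_indic c E x).
Proof.
by rewrite /torus_op /torus_avg (cintegral_real leb2 _
  (fun w => \1_E (x.1 - torus_param (c * x.2) x.2 w.1 w.2))).
Qed.

Lemma avg_indic_bounds c (E : set W) (x : V) : measurable E ->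
  0 <= avg_indic c E x <= (2 * pi) ^+ 2.
Proof.
move=> mE; rewrite Rintegral_ge0//= -[leRHS]mul1r.
apply: Rintegral_angles_le; first exact: measurable_avg_indic.
by move=> w; rewrite indicE ger0_norm ?ler0n// lern1 leq_b1.
Qed.

Lemma avg_indic_full c (E : set W) (x : V) : measurable E ->
  (forall w, angles w -> E (x.1 - torus_param (c * x.2) x.2 w.1 w.2)) ->
  (2 * pi) ^+ 2 <= avg_indic c E x.
Proof.
move=> mE h; have -> : (2 * pi) ^+ 2 = 1 * fine (leb2 angles) :> R by rewrite leb2_angles mul1r.
apply: (@Rintegral_angles_ge R _ 1) => //.
- exact: measurable_avg_indic.
- by move=> w; rewrite indicE ler0n lern1 leq_b1.
- exact: measurable_angles.
- by move=> w /h Ew; rewrite indicE mem_set.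
Qed.

Lemma torus_op_unbounded_neighborhood (chi : R -> R[i]) (p c alpha : R) :
  Cc_smooth_pos chi -> (exists t, chi t != 0) -> 2 <= p -> 0 <= c <= 1 ->
  3 / p < alpha -> ~ bounded_Lp_sobolev p%:E alpha (torus_op chi c).
Proof.
move=> chis chin p2 c01 ap [C hC].
have p0 : 0 < p by apply: lt_le_trans p2.
have p1 : 1 < p by apply: lt_le_trans p2; rewrite ltr1n.
have alpha0 : 0 < alpha by apply: lt_trans ap; rewrite divr_gt0.
have [t0 [T [Mchi [r [ct0 t00 r0 Mchi0 [chiT chiM chir]]]]]] := Cc_smooth_pos_cutoff chis chin.
set n0 := Normc.normc (chi t0).
have n0_gt0 : 0 < n0.
  rewrite lt_neqAle normc_ge0 andbT eq_sym.
  by apply: contra ct0 => /eqP/Normc.eq0_normc ->.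
pose K := 3 + 6 * pi * t0.
have K0 : 0 < K by rewrite ltr_pwDl// mulr_ge0 ?mulr_ge0 ?pi_ge0 ?(ltW t00).
(* Half of the available room: the first term leaves [B < alpha / 2], the second keeps [A]
   nonnegative. The final gain is the factor [tau^e]. *)
pose e := Num.min (alpha / 2 - 3 / (2 * p)) (1 / (2 * p)) / 2.
have m0 : 0 < Num.min (alpha / 2 - 3 / (2 * p)) (1 / (2 * p)).
  rewrite lt_min divr_gt0 ?mulr_gt0// andbT subr_gt0.
  have -> : 3 / (2 * p) = (3 / p) / 2 by field; rewrite gt_eqF.
  by rewrite ltr_pM2r.
have e0 : 0 < e by rewrite divr_gt0.
have e1 : 2 * e <= alpha / 2 - 3 / (2 * p).
  by rewrite /e mulrC divfK// ge_min lexx.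
have e2 : 2 * e <= 1 / (2 * p) by rewrite /e mulrC divfK// ge_min lexx orbT.
have p21 : 1 / (2 * p) <= 1 / 4 :> R by rewrite ler_pM2l// lef_pV2 ?posrE ?mulr_gt0//; lra.
pose A := 1 / (2 * p) - e. pose B := 3 / (2 * p) + e.
have A0 : 0 <= A by rewrite /A; lra.
have p30 : 0 < 3 / (2 * p) by rewrite divr_gt0// mulr_gt0.
have B0 : 0 <= B by rewrite /B; lra.
have AB : A + B = 2 / p by rewrite /A /B; field; rewrite gt_eqF.
have Ba : B < alpha / 2 by rewrite /B; lra.
set Wt := Rintegral (@lebesgue_measure R) setT (wexp (alpha / 2 - B) 1).
have Wt0 : 0 <= Wt by apply: Rintegral_ge0 => v _; exact: wexp_ge0.
(* Chosen so that [tau = (j + 1)^(-2 q)] satisfies [tau^e <= 1 / (j + 1)]. *)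
pose q := Num.bound (1 / (2 * e)).
have qe : 1 <= q%:R * (2 * e).
  have := archi_boundP (ltW (divr_gt0 ltr01 (mulr_gt0 (ltr0Sn R 1) e0))).
  by rewrite ltr_pdivrMr ?mulr_gt0// => /ltW.
pose Dc := dual_const p alpha.
have Dc0 : 0 <= Dc by apply: dual_const_ge0.
pose c1 := (2 * pi) ^+ 2 * (n0 ^+ 2 / 2) * expR (-1) * 16.
have pi0 := pi_gt0 R.
have c10 : 0 < c1 by rewrite !mulr_gt0 ?expR_gt0 ?exprn_gt0 ?mulr_gt0 ?invr_gt0.
pose C2 := n0 * Mchi * (2 * pi) ^+ 2 * (8 * pi) ^+ 2.
have C20 : 0 <= C2.
  apply: mulr_ge0; last exact: sqr_ge0.
  by apply: mulr_ge0; [apply: mulr_ge0 => //; exact: ltW|exact: sqr_ge0].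
pose C3 := n0 * (Dc * ((`|C| + 1) * (8 * K ^+ 3) `^ p^-1) * Wt).
have C30 : 0 <= C3.
  apply: mulr_ge0; first exact: ltW.
  apply: mulr_ge0 => //; apply: mulr_ge0 => //.
  by apply: mulr_ge0; [rewrite addr_ge0|exact: powR_ge0].
pose C4 := C2 * (8 / r ^+ 2) + C3.
apply: (@archimedean_contra R c1 C4 (Num.bound r^-1)) => // j jr.
pose n := (j.+1 ^ q)%N.
have n_gt0 : (0 < n)%N by rewrite expn_gt0.
have nE : n.-1.+1 = n by rewrite prednK.
set X : R := n%:R^-1.
have j0 : 0 < j.+1%:R :> R by rewrite ltr0n.
have X0 : 0 < X by rewrite invr_gt0 ltr0n.
have q_gt0 : (0 < q)%N.
  by rewrite lt0n; apply/eqP => q0; move: qe; rewrite q0 mul0r ler10.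
have XE : X = (j.+1%:R^-1) ^+ q by rewrite /X natrX exprVn.
have Xj : X <= j.+1%:R^-1.
  rewrite XE -[leRHS]expr1 ler_wiXn2l ?invr_ge0 ?(ltW j0)// invf_le1// ler1n//.
have X1 : X <= 1 by apply: le_trans Xj _; rewrite invf_le1// ler1n.
have Xr : X < r.
  apply: le_lt_trans Xj _; rewrite invf_plt ?posrE//.
  apply: lt_le_trans (archi_boundP _) _; first by rewrite invr_ge0 ltW.
  by rewrite ler_nat leqW.
pose tau := X ^+ 2.
have tau0 : 0 < tau by rewrite exprn_gt0.
have stau : Num.sqrt tau = X by rewrite sqrtr_sqr ger0_norm// ltW.
have tau_e : tau `^ e <= j.+1%:R^-1.
  have -> : tau `^ e = j.+1%:R^-1 `^ (q%:R * (2 * e)).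
    rewrite /tau -powR_mulrn ?(ltW X0)// -powRrM XE -powR_mulrn ?invr_ge0 ?(ltW j0)//.
    by rewrite -powRrM.
  rewrite -[leRHS]powRr1 ?invr_ge0 ?(ltW j0)//.
  by apply: ger_powR => //; rewrite invr_gt0 j0 invf_le1// ler1n.
have tau_le_e : tau <= tau `^ e.
  apply: ger1_powR; last by lra.
  by rewrite tau0 expr_le1// ltW.
(* [torus_nbhs] at index [k] has mesh [1 / (k + 1)]; the predecessor gives exactly the width
   [X = 1 / n = sqrt tau]. *)
pose E := torus_nbhs c t0 n.-1.
have mE : measurable E := measurable_torus_nbhs c t0 n.-1.
have Ele : (leb3 E <= (8 * K ^+ 3 * X)%:E)%E.
  by have := leb3_torus_nbhs c t00 n.-1; rewrite nE.
have Efin : leb3 E = (fine (leb3 E))%:E.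
  by rewrite fineK// ge0_fin_numE//; apply: le_lt_trans Ele _; rewrite ltry.
pose f (v : W) := real_complex R (\1_E v).
have nf v : Normc.normc (f v) = \1_E v by rewrite normc_real ger0_norm.
have fN := cLnorm_indic p0 nf mE Efin.
have fp : inLp leb3 p%:E f.
  by split; [exact/cmeasurable_real/measurable_indic|rewrite fN ltry].
have fL v : f v != 0 -> box3 (2 * t0 + K) 0 v.
  rewrite /f indicE; case: (boolP (v \in E)) => [|_]; last by rewrite eqxx.
  by rewrite inE => vE _; exact: (torus_nbhs_bounded c01 t00 vE).
set nn := fine (leb3 E) `^ p^-1 in fN.
(* The summand 1 makes the comparison with [C * nn] strict, and the absolute value covers a negative
   [C]. *)
pose M := (`|C| + 1) * (8 * K ^+ 3 * X) `^ p^-1.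
have KX0 : 0 < 8 * K ^+ 3 * X by rewrite !mulr_gt0 ?exprn_gt0.
have nnle : nn <= (8 * K ^+ 3 * X) `^ p^-1.
  apply: ge0_ler_powR; rewrite ?nnegrE ?invr_ge0 ?(ltW p0) ?(ltW KX0) ?fine_ge0//.
  by rewrite -lee_fin -Efin.
have CM : C * nn < M.
  apply: (@le_lt_trans _ _ (`|C| * (8 * K ^+ 3 * X) `^ p^-1)).
    apply: (@le_trans _ _ (`|C| * nn)); first by rewrite ler_wpM2r ?powR_ge0// ler_norm.
    by rewrite ler_wpM2l.
  rewrite [ltRHS](mulrDl `|C| 1) mul1r ltrDl.
  exact: powR_gt0.
pose y : V := (0, 0, 0, t0).
have [iF] := operator_dual_bound p1 alpha0 c01 chiT hC y 0 fp fL fN CM tau0.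
have FE (x : V) : torus_op chi c f x * (cis (dot4 (y - x) 0) * real_complex R (gauss4 (4 * tau)^-1 y x)) =
  chi x.2 * real_complex R (avg_indic c E x * gauss4 (4 * tau)^-1 y x).
  by rewrite dot40r cis0 mul1r torus_op_indic -mulrA -rmorphM.
under eq_cintegral do rewrite FE.
have k0 : 0 < (4 * tau)^-1 by rewrite invr_gt0 mulr_gt0.
have iFg : cintegrable leb4 (fun x => chi x.2 * real_complex R (avg_indic c E x * gauss4 (4 * tau)^-1 y x)).
  by rewrite -(funext FE); exact: cintegrable_mul_cis_gauss4.
have Blow x : `|x.1.1.1 - y.1.1.1| <= Num.sqrt tau -> `|x.1.1.2 - y.1.1.2| <= Num.sqrt tau ->
     `|x.1.2 - y.1.2| <= Num.sqrt tau -> `|x.2 - y.2| <= Num.sqrt tau ->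
     (2 * pi) ^+ 2 <= avg_indic c E x.
  rewrite stau /= !subr0 => h1 h2 h3 h4.
  apply: avg_indic_full => // w [/=]; rewrite !in_itv/= => w1 w2.
  by apply: torus_nbhs_contains; rewrite ?nE.
have st : Num.sqrt tau < r by rewrite stau.
have sq4 : 0 <= (2 * pi) ^+ 2 :> R by rewrite sqr_ge0.
have := @gaussian_average_lower R chi t0 r Mchi chiM chir (avg_indic c E) y tau ((2 * pi) ^+ 2) ((2 * pi) ^+ 2)
  erefl tau0 st (fun x => avg_indic_bounds c x mE) sq4 Blow iFg.
rewrite -/n0; set I := Normc.normc (cintegral _ _ _) => low up.
have dec := decay_integral_le (divr_gt0 alpha0 (ltr0Sn R 1)) p1 tau0 (dot4_ge0 (0 : V)) A0 B0 AB Ba.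
rewrite -/Wt in dec.
have t2 : 0 < tau ^+ 2 by rewrite exprn_gt0.
have M0 : 0 <= M by rewrite /M mulr_ge0 ?powR_ge0// addr_ge0.
(* The balance of exponents: [X^(1/p) = tau^(1/(2p))] exceeds the loss [tau^(-A)] by exactly
   [tau^e]. *)
have ME : M * tau `^ (- A) = (`|C| + 1) * (8 * K ^+ 3) `^ p^-1 * tau `^ e.
  have K30 : 0 <= 8 * K ^+ 3 by rewrite mulr_ge0// exprn_ge0// ltW.
  rewrite /M powRM ?(ltW X0)//.
  have -> : X `^ p^-1 = tau `^ (1 / (2 * p)).
    rewrite /tau -powR_mulrn ?(ltW X0)// -powRrM; congr (_ `^ _).
    by field; rewrite gt_eqF.
  have -> : tau `^ e = tau `^ (1 / (2 * p)) * tau `^ (- A).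
    rewrite -powRD; last by rewrite (gt_eqF tau0) implybT.
    by congr (_ `^ _); rewrite /A; ring.
  by rewrite !mulrA.
have up' : n0 * I <= C3 * tau `^ e * tau ^+ 2.
  have -> : C3 * tau `^ e * tau ^+ 2 = n0 * (Dc * tau ^+ 2 * M * (tau `^ (- A) * Wt)).
    have -> : n0 * (Dc * tau ^+ 2 * M * (tau `^ (- A) * Wt)) =
      n0 * Dc * Wt * tau ^+ 2 * (M * tau `^ (- A)) by ring.
    by rewrite ME /C3; ring.
  rewrite ler_wpM2l ?(ltW n0_gt0)//; apply: le_trans up _.
  by rewrite ler_wpM2l// mulr_ge0// mulr_ge0// ltW.
have expo : expR (- (r ^+ 2 / (8 * tau))) <= 8 / r ^+ 2 * tau.
  have x0 : 0 < r ^+ 2 / (8 * tau) by rewrite divr_gt0 ?exprn_gt0// mulr_gt0.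
  have b01 : 0 < (1 : R) <= 1 by rewrite ltr01 lexx.
  apply: le_trans (expRN_le_powRN x0 b01) _.
  rewrite powR_inv1 ?(ltW x0)// le_eqVlt; apply/orP; left; apply/eqP.
  by field; rewrite !gt_eqF.
have main : c1 * tau ^+ 2 <= C4 * tau `^ e * tau ^+ 2.
  have h1 : c1 * tau ^+ 2 - C2 * expR (- (r ^+ 2 / (8 * tau))) * tau ^+ 2 <= n0 * I.
    apply: le_trans low; rewrite le_eqVlt; apply/orP; left; apply/eqP.
    by rewrite /c1 /C2; ring.
  have h2 : C2 * expR (- (r ^+ 2 / (8 * tau))) * tau ^+ 2 <= C2 * (8 / r ^+ 2) * tau `^ e * tau ^+ 2.
    rewrite ler_wpM2r ?(ltW t2)// -mulrA ler_wpM2l//.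
    apply: le_trans expo _; rewrite ler_wpM2l//.
    by rewrite divr_ge0// sqr_ge0.
  have -> : C4 * tau `^ e * tau ^+ 2 = C2 * (8 / r ^+ 2) * tau `^ e * tau ^+ 2 + C3 * tau `^ e * tau ^+ 2.
    by rewrite /C4; ring.
  by lra.
have C40 : 0 <= C4 by rewrite /C4 addr_ge0// mulr_ge0// divr_ge0// sqr_ge0.
have := main; rewrite ler_pM2r// => /le_trans; apply.
by rewrite ler_wpM2l.
Qed.

End NeighborhoodExample.

(** * Waves and Dirichlet kernels *)

Section DirichletSums.
Context {R : realType}.

(** The squared modulus of the sum of [e^(i j u)] over [j < n], that is, [n] times the Fejer
    kernel. *)
Definition dirichlet_sq (n : nat) (u : R) : R :=
  (\sum_(j < n) cos (j%:R * u)) ^+ 2 + (\sum_(j < n) sin (j%:R * u)) ^+ 2.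

Let sum_cis n (u : R) : \sum_(j < n) cis (j%:R * u) =
  Complex (\sum_(j < n) cos (j%:R * u)) (\sum_(j < n) sin (j%:R * u)).
Proof.
elim: n => [|n ih]; first by rewrite !big_ord0.
rewrite !big_ord_recr/= ih; apply/eqP.
by rewrite eq_complex/= !eqxx.
Qed.

Lemma dirichlet_sqE n (u : R) :
  \sum_(j < n) \sum_(k < n) cis ((j%:R - k%:R) * u) = real_complex R (dirichlet_sq n u).
Proof.
have -> : \sum_(j < n) \sum_(k < n) cis ((j%:R - k%:R) * u) =
  (\sum_(j < n) cis (j%:R * u)) * (\sum_(k < n) cis (k%:R * (- u))).
  rewrite big_distrlr/=; apply: eq_bigr => j _; apply: eq_bigr => k _.
  by rewrite -cisD; congr cis; ring.
rewrite !sum_cis /dirichlet_sq.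
under [X in _ * Complex X _]eq_bigr do rewrite mulrN cosN.
under [X in _ * Complex _ X]eq_bigr do rewrite mulrN sinN.
rewrite sumrN; set a := \sum_(_ < _) _; set b := \sum_(_ < _) sin _.
by apply/eqP; rewrite eq_complex cReM cImM/=; apply/andP; split; apply/eqP; ring.
Qed.

Lemma dirichlet_sq_bounds n (u : R) : 0 <= dirichlet_sq n u <= 2 * n%:R ^+ 2.
Proof.
have key (g : R -> R) : (forall x, `|g x| <= 1) -> (\sum_(j < n) g (j%:R * u)) ^+ 2 <= n%:R ^+ 2.
  move=> g1; rewrite -[leLHS]real_normK ?num_real// lerXn2r ?nnegrE//.
  apply: le_trans (ler_norm_sum _ _ _) _.
  apply: (@le_trans _ _ (\sum_(j < n) (1 : R))); first by apply: ler_sum.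
  by rewrite sumr_const card_ord.
rewrite addr_ge0 ?sqr_ge0//= mulr_natl mulr2n.
by apply: lerD; apply: key => x; [exact: cos_max|exact: sin_max].
Qed.

(** All angles [j u] lie in [[0, 1]], where the cosine is at least [1/2]: the real part of the sum
    has no cancellation. *)
Lemma dirichlet_sq_ge n (u : R) : 0 <= u -> n%:R * u <= 1 ->
  n%:R ^+ 2 / 4 <= dirichlet_sq n u.
Proof.
move=> u0 nu.
have h : n%:R / 2 <= \sum_(j < n) cos (j%:R * u).
  have -> : n%:R / 2 = \sum_(j < n) (2^-1 : R).
    by rewrite sumr_const cardT size_enum_ord mulrC mulr_natr.
  apply: ler_sum => j _.
  have ju0 : 0 <= j%:R * u by rewrite mulr_ge0.
  have ju1 : j%:R * u <= 1.
    by apply: le_trans nu; rewrite ler_wpM2r// ler_nat ltnW.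
  have : (j%:R * u) ^+ 2 <= 1 by rewrite expr_le1.
  have := cos_ge_quad (j%:R * u); lra.
rewrite /dirichlet_sq.
have : n%:R ^+ 2 / 4 <= (\sum_(j < n) cos (j%:R * u)) ^+ 2.
  have -> : n%:R ^+ 2 / 4 = (n%:R / 2) ^+ 2 :> R by field.
  by rewrite lerXn2r ?nnegrE// ?divr_ge0//; apply: le_trans h; rewrite divr_ge0.
by have := sqr_ge0 (\sum_(j < n) sin (j%:R * u)); lra.
Qed.

Lemma measurable_dirichlet_sq n : measurable_fun setT (dirichlet_sq n).
Proof.
have mc : measurable_fun setT (@cos R).
  by apply: continuous_measurable_fun; exact: continuous_cos.
have ms : measurable_fun setT (@sin R).
  by apply: continuous_measurable_fun; exact: continuous_sin.
apply: measurable_funD; apply: measurable_funX; apply: measurable_sum => j.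
- by apply: (measurableT_comp mc); apply: measurable_funM.
- by apply: (measurableT_comp ms); apply: measurable_funM.
Qed.

(* Bernoulli's inequality for exponents in (0,1), from Young's inequality. *)
Let powR_le_affine (x d : R) : 0 < d < 1 -> 0 <= x -> x `^ d <= d * x + (1 - d).
Proof.
move=> /andP[d0 d1] x0.
have d10 : 0 < 1 - d by rewrite subr_gt0.
have := @conjugate_powR R (x `^ d) 1 d^-1 (1 - d)^-1 (powR_ge0 _ _) ler01.
rewrite !invr_gt0 !invrK powR1 mulr1 -powRrM divff ?gt_eqF// powRr1// mul1r mulrC.
by apply => //; ring.
Qed.

(** Comparison with the integral of [t^(-g)]; the inductive step is the tangent bound at [n + 1] for
    the concave function [t^(1 - g)]. *)
Lemma sum_powRN_le (g : R) n : 0 < g < 1 ->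
  \sum_(i < n) i.+1%:R `^ (- g) <= n%:R `^ (1 - g) / (1 - g).
Proof.
move=> /andP[g0 g1]; have d0 : 0 < 1 - g by rewrite subr_gt0.
elim: n => [|n ih]; first by rewrite big_ord0 divr_ge0 ?powR_ge0 ?(ltW d0).
rewrite big_ord_recr/=.
have n0 : 0 < n.+1%:R :> R by rewrite ltr0n.
have step : n%:R `^ (1 - g) <= n.+1%:R `^ (1 - g) - (1 - g) * n.+1%:R `^ (- g).
  have x0 : 0 <= n%:R / n.+1%:R :> R by rewrite divr_ge0.
  have d01 : 0 < 1 - g < 1 by rewrite d0/=; lra.
  have h := powR_le_affine d01 x0.
  have -> : n%:R = n.+1%:R * (n%:R / n.+1%:R) :> R by rewrite mulrC divfK// gt_eqF.
  rewrite powRM ?(ltW n0)//.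
  have -> : n.+1%:R `^ (- g) = n.+1%:R `^ (1 - g) / n.+1%:R.
    rewrite -[X in _ / X](powRr1 (ltW n0)) -powRN -powRD; last by rewrite (gt_eqF n0) implybT.
    by congr (_ `^ _); ring.
  have -> : n.+1%:R `^ (1 - g) - (1 - g) * (n.+1%:R `^ (1 - g) / n.+1%:R) =
     n.+1%:R `^ (1 - g) * ((1 - g) * (n%:R / n.+1%:R) + (1 - (1 - g))).
    have -> : n%:R = n.+1%:R - 1 :> R by rewrite -natr1 addrK.
    by field; rewrite gt_eqF.
  by rewrite ler_wpM2l ?powR_ge0.
apply: le_trans (lerD ih (lexx _)) _.
rewrite -[X in _ + X](mulfK (lt0r_neq0 d0)) -mulrDl ler_wpM2r ?invr_ge0 ?(ltW d0)//.
by move: step; rewrite [in X in _ -> X]mulrC; lra.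
Qed.

(** The distance [|j - k|], at least one of the truncated differences being 0. *)
Definition natdist (j k : nat) : nat := ((j - k) + (k - j))%N.

Lemma natdistE j k : `|j%:R - k%:R| = (natdist j k)%:R :> R.
Proof.
rewrite /natdist; have [jk|kj] := leqP j k.
  have /eqP -> : (j - k)%N == 0%N by rewrite subn_eq0.
  by rewrite add0n natrB// distrC ger0_norm// subr_ge0 ler_nat.
have kj' := ltnW kj; have /eqP -> : (k - j)%N == 0%N by rewrite subn_eq0.
by rewrite addn0 natrB// ger0_norm// subr_ge0 ler_nat.
Qed.

(** For fixed [j] a distance is attained at most once with [k <= j] and at most once with [k > j];
    each half is compared with the full sum. *)
Lemma sum_natdist_le (h : nat -> R) n (j : nat) : (forall i, 0 <= h i) -> (j < n)%N ->
  \sum_(k < n) h (natdist j k) <= 2 * \sum_(i < n) h i.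
Proof.
move=> h0 jn.
have sub a b : (a <= b)%N -> \sum_(0 <= i < a) h i <= \sum_(0 <= i < b) h i.
  move=> ab; rewrite (@big_cat_nat _ _ _ a 0 b)//= lerDl.
  by apply: sumr_ge0 => i _.
rewrite -(big_mkord xpredT (fun k => h (natdist j k))) -(big_mkord xpredT h).
rewrite (@big_cat_nat _ _ _ j.+1 0 n)//= mulr_natl mulr2n; apply: lerD.
  rewrite big_nat_rev/=; apply: le_trans (sub _ _ jn).
  apply: ler_sum_nat => i /andP[_ ij]; rewrite add0n subSS /natdist.
  have -> : (j - (j - i) + (j - i - j))%N = i by lia.
  by [].
apply: (@le_trans _ _ (\sum_(0 <= i < n - j) h i)); last exact/sub/leq_subr.
rewrite -[X in X <= _]/(\sum_(1 + j <= k < n) h (natdist j k)) big_addn.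
rewrite [leRHS](@big_cat_nat _ _ _ 1%N)//=; last by rewrite subn_gt0.
rewrite [leRHS]addrC; apply: ler_wpDr; first exact: sumr_ge0.
by apply: ler_sum_nat => i _; rewrite (_ : natdist j (i + j) = i)// /natdist; lia.
Qed.

End DirichletSums.

(** * Torus averages of truncated plane waves *)

Section WaveAverages.
Context {R : realType}.
Notation V := (R * R * R * R)%type.
Notation W := (R * R * R)%type.

Lemma cintegrable_angles_cis (a b : R * R -> R) : measurable_fun setT a ->
  (forall w, 0 <= a w <= 1) -> measurable_fun setT b ->
  cintegrable leb2 (fun w => real_complex R (\1_angles w) * (real_complex R (a w) * cis (b w))).
Proof.
move=> ma a01 mb.
have m1 : measurable_fun setT (\1_angles : R * R -> R).
  by apply: measurable_indic; exact: measurable_angles.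
apply: (@cintegrable_le _ _ _ leb2 _ (\1_angles : R * R -> R)).
- apply: cmeasurableM; first exact: cmeasurable_real.
  by apply: cmeasurableM; [exact: cmeasurable_real|exact: cmeasurable_cis].
- move=> w; rewrite !Normc.normcM !normc_real normc_cis mulr1.
  have /andP[a0 a1] := a01 w.
  by rewrite (ger0_norm a0) ger0_norm// ler_piMr.
- apply/integrableP; split; first exact/measurable_EFinP.
  under eq_integral do rewrite /= ger0_norm//.
  rewrite integral_indic//; last exact: measurable_angles.
  by rewrite setIT [X in (X < _)%E]leb2_angles ltry.
Qed.

Lemma sum_cintegral_dirichlet (a b : R * R -> R) n : measurable_fun setT a ->
  (forall w, 0 <= a w <= 1) -> measurable_fun setT b ->
  \sum_(j < n) \sum_(k < n) cintegral leb2 angles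
    (fun w => real_complex R (a w) * cis ((j%:R - k%:R) * b w)) =
  real_complex R (Rintegral leb2 angles (fun w => a w * dirichlet_sq n (b w))).
Proof.
move=> ma a01 mb.
have int (l : R) := cintegrable_angles_cis ma a01 (measurable_funM (measurable_cst l) mb).
under eq_bigr do under eq_bigr do rewrite cintegral_mkcond.
pose F (j k : 'I_n) w := real_complex R (\1_angles w) *
  (real_complex R (a w) * cis ((j%:R - k%:R) * b w)).
have iF j k : cintegrable leb2 (F j k) by exact: int.
rewrite (eq_bigr (fun j => cintegral leb2 setT (fun w => \sum_k F j k w))); last first.
  by move=> j _; rewrite (cintegral_sum _ (iF j)).
rewrite -cintegral_sum => [|j]; last exact: cintegrable_sum.
rewrite -(cintegral_real leb2 _ (fun w => a w * dirichlet_sq n (b w))) [RHS]cintegral_mkcond.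
apply: eq_cintegral => w _.
have -> : real_complex R (a w * dirichlet_sq n (b w)) = real_complex R (a w) *
    \sum_(j < n) \sum_(k < n) cis ((j%:R - k%:R) * b w).
  by rewrite dirichlet_sqE -rmorphM.
rewrite !mulr_sumr.
by apply: eq_bigr => j _; rewrite !mulr_sumr.
Qed.

(** The cutoff to a box puts the wave in [L^p] with a norm that does not depend on [lambda]. *)
Definition wave (L lambda : R) (v : W) : R[i] :=
  real_complex R (\1_(box3 L 0) v) * cis (lambda * v.2).

Lemma normc_wave L lambda v : Normc.normc (wave L lambda v) = \1_(box3 L 0) v.
Proof. by rewrite Normc.normcM normc_real normc_cis mulr1 ger0_norm. Qed.

Lemma cmeasurable_wave L lambda : cmeasurable (wave L lambda).
Proof.
apply: cmeasurableM.
  by apply: cmeasurable_real; apply: measurable_indic; exact: measurable_box3.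
by apply: cmeasurable_cis; apply: measurable_funM.
Qed.

Let avg_box L c (x : V) (w : R * R) : R :=
  \1_(box3 L 0) (x.1 - torus_param (c * x.2) x.2 w.1 w.2).

(** Nonnegative when [c * x.2] is, and vanishing to second order at [theta = pi/2]: it stays below a
    multiple of [1/n] on an interval of length of order [n^(-1/2)]. *)
Let phase c (x : V) (w : R * R) : R := c * x.2 * (1 - sin w.1).

Let measurable_avg_box L c x : measurable_fun setT (avg_box L c x).
Proof.
have mi : measurable_fun setT (\1_(box3 L 0) : W -> R).
  by apply: measurable_indic; exact: measurable_box3.
by apply: (measurableT_comp mi); exact: measurable_torus.
Qed.

Let measurable_phase c x : measurable_fun setT (phase c x).
Proof.
apply: measurable_funM => //; apply: measurable_funB => //.
have ms : measurable_fun setT (@sin R).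
  by apply: continuous_measurable_fun; exact: continuous_sin.
exact: (measurableT_comp ms).
Qed.

Let avg_box01 L c x w : 0 <= avg_box L c x w <= 1.
Proof. by rewrite /avg_box indicE ler0n lern1 leq_b1. Qed.

Definition dirichlet_avg (n : nat) (L c : R) (x : V) : R :=
  Rintegral leb2 angles (fun w => avg_box L c x w * dirichlet_sq n (phase c x w)).

(* The test frequency (0, 0, lambda, - lambda c) is conormal to the graph
   x.1.2 = c x.2 of the height of the top circle theta = pi/2, so that the phase
   is stationary there. *)
Lemma torus_op_wave chi c L lambda (y x : V) (g : R) : y.1.2 = c * y.2 ->
  torus_op chi c (wave L lambda) x *
    (cis (dot4 (y - x) (0, 0, lambda, - (lambda * c))) * real_complex R g) =
  chi x.2 * real_complex R g * cintegral leb2 angles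
    (fun w => real_complex R (avg_box L c x w) * cis (lambda * phase c x w)).
Proof.
move=> yc; set z := cis (dot4 _ _).
have -> : z = cis (lambda * (c * x.2 - x.1.2)).
  by rewrite /z; congr cis; rewrite /dot4/= yc; ring.
have ml (d : R) : measurable_fun setT (fun w : R * R => lambda * phase c x w + d).
  by apply: measurable_funD => //; apply: measurable_funM.
rewrite /torus_op /torus_avg.
have -> : cintegral leb2 angles (fun w => wave L lambda (x.1 - torus_param (c * x.2) x.2 w.1 w.2)) =
  cintegral leb2 angles (fun w => real_complex R (avg_box L c x w) *
    cis (lambda * phase c x w + - (lambda * (c * x.2 - x.1.2)))).
  apply: eq_cintegral => w _; rewrite /wave; congr (_ * cis _).
  by rewrite /phase /=; ring.
rewrite mulrCA mulrC -!mulrA; congr (chi x.2 * _); rewrite mulrC -mulrA; congr (_ * _).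
rewrite [X in _ * X]cintegral_mkcond -cintegralZl; last exact: cintegrable_angles_cis.
rewrite [RHS]cintegral_mkcond; apply: eq_cintegral => w _.
rewrite mulrCA; congr (_ * _); rewrite mulrCA; congr (_ * _).
by rewrite -cisD; congr cis; ring.
Qed.

Lemma sum_torus_op_wave chi c L n (y x : V) (g : R) : y.1.2 = c * y.2 ->
  \sum_(j < n) \sum_(k < n) torus_op chi c (wave L (j%:R - k%:R)) x *
    (cis (dot4 (y - x) (0, 0, j%:R - k%:R, - ((j%:R - k%:R) * c))) * real_complex R g) =
  chi x.2 * real_complex R (dirichlet_avg n L c x * g).
Proof.
move=> yc; under eq_bigr do under eq_bigr do rewrite torus_op_wave//.
under eq_bigr do rewrite -mulr_sumr.
rewrite -mulr_sumr sum_cintegral_dirichlet// -mulrA; congr (_ * _).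
by rewrite mulrC -rmorphM.
Qed.

Let measurable_dirichlet_integrand n L c x :
  measurable_fun setT (fun w => avg_box L c x w * dirichlet_sq n (phase c x w)).
Proof.
apply: measurable_funM => //.
by apply: (measurableT_comp (measurable_dirichlet_sq n)).
Qed.

Let dirichlet_integrand_bounds n L c x w :
  0 <= avg_box L c x w * dirichlet_sq n (phase c x w) <= 2 * n%:R ^+ 2.
Proof.
have /andP[a0 a1] := avg_box01 L c x w.
have /andP[d0 d1] := dirichlet_sq_bounds n (phase c x w).
by rewrite mulr_ge0//=; apply: le_trans d1; rewrite ler_piMl.
Qed.

Lemma dirichlet_avg_bounds n L c (x : V) :
  0 <= dirichlet_avg n L c x <= 2 * n%:R ^+ 2 * (2 * pi) ^+ 2.
Proof.
apply/andP; split.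
  by apply: Rintegral_ge0 => w _; have /andP[] := dirichlet_integrand_bounds n L c x w.
apply: Rintegral_angles_le => // w.
by have /andP[h0 h1] := dirichlet_integrand_bounds n L c x w; rewrite ger0_norm.
Qed.

Lemma dirichlet_avg_ge (m : nat) (L c T : R) (x : V) :
  (0 < m)%N -> 0 <= c <= 1 -> 1 <= T -> 0 <= x.2 <= T ->
  (forall w, angles w -> box3 L 0 (x.1 - torus_param (c * x.2) x.2 w.1 w.2)) ->
  pi / T * m%:R ^+ 3 <= dirichlet_avg (m ^ 2) L c x.
Proof.
move=> m0 /andP[c0 c1] T1 /andP[x0 xT] hE.
have m1 : 1 <= m%:R :> R by rewrite ler1n.
have mm : 0 < m%:R :> R by rewrite ltr0n.
have T0 : 0 < T by apply: lt_le_trans T1.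
(* For [|theta - pi/2| <= k] the phase is at most [T k^2 / 2 = 1 / (2 T m^2)], so that with
   [n = m^2] the product of [n] and the phase is at most 1. Taking [n] to be a square turns
   [n^(-1/2)] into [1/m]. Also [k <= 1 <= pi/2] keeps the interval inside [[0, 2 pi)]. *)
pose k := T^-1 / m%:R.
have k0 : 0 < k by rewrite divr_gt0 ?invr_gt0.
have k1 : k <= 1.
  by rewrite /k -invfM invf_le1 ?mulr_gt0//; nra.
have pih : 1 <= pi / 2 :> R := pihalf_ge1 R.
pose A : set (R * R) := `[pi / 2 - k, pi / 2 + k[%classic `*` `[0, 2 * pi[%classic.
have mA : measurable A by apply: measurableX.
have AE : leb2 A = (2 * k * (2 * pi))%:E.
  rewrite [LHS]leb2_rect ?subr0; first by congr EFin; congr (_ * _); ring.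
    by lra.
  by rewrite mulr_ge0// pi_ge0.
have AS : A `<=` angles.
  move=> w [/=]; rewrite !in_itv/= => /andP[h1 h2] h3; split => //=.
  by rewrite in_itv/=; apply/andP; split; lra.
(* The kernel is at least [m^4 / 4] on a rectangle of area [2 k * 2 pi = 4 pi / (T m)]. *)
have -> : pi / T * m%:R ^+ 3 = ((m ^ 2)%:R ^+ 2 / 4) * fine (leb2 A).
  rewrite AE/= /k natrX; move: (pi : R) => P.
  by field; rewrite !gt_eqF.
apply: (@Rintegral_angles_ge R _ (2 * (m ^ 2)%:R ^+ 2)) => // w Aw.
rewrite {1}/avg_box indicE mem_set ?mul1r; last exact/hE/AS.
have ct : 0 <= c * x.2 <= T by apply/andP; split; nra.
have /andP[ct0 ct1] := ct.
have s0 : 0 <= 1 - sin w.1 by rewrite subr_ge0 sin_le1.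
apply: dirichlet_sq_ge; first exact: mulr_ge0.
have s1 : 1 - sin w.1 <= k ^+ 2 / 2.
  have -> : sin w.1 = cos (w.1 - pi / 2) by rewrite cosB cos_pihalf sin_pihalf; ring.
  have := cos_ge_quad (w.1 - pi / 2).
  have : (w.1 - pi / 2) ^+ 2 <= k ^+ 2.
    case: Aw => /=; rewrite in_itv/= => /andP[h1 h2] _; nra.
  lra.
apply: (@le_trans _ _ ((m ^ 2)%:R * (T * (k ^+ 2 / 2)))).
  by rewrite ler_wpM2l//; apply: ler_pM.
have -> : (m ^ 2)%:R * (T * (k ^+ 2 / 2)) = (2 * T)^-1.
  by rewrite /k natrX; field; rewrite !gt_eqF.
by rewrite invf_le1 ?mulr_gt0//; lra.
Qed.

End WaveAverages.

(** * Sums of waves: unboundedness for [alpha > 1/2] *)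

Section WaveExample.
Context {R : realType}.
Notation V := (R * R * R * R)%type.
Notation W := (R * R * R)%type.
Notation mu := (@lebesgue_measure R).

Definition decay_const (a b : R) : R :=
  Rintegral mu setT (wexp a 1) +
  2 * (2 * Rintegral mu setT (wexp (a - b) 1) + Rintegral mu setT (wexp (a - b + 1) 1)).

(** The shift to [i + 1] lets one bound cover the zero frequency of the diagonal [j = k], where no
    decay is available and [decay_integral_le] is used. For positive [i], [|zeta|^2 >= i^2], and
    replacing [i] by [i + 1] costs at most [2^(2b) <= 2], which explains the 2 in [decay_const]. *)
Lemma decay_integral_wave (a p tau b c lambda : R) (i : nat) :
  0 < a -> 1 < p -> 0 < tau <= 1 -> 0 < b < 1 / 2 -> b < a -> `|lambda| = i%:R ->
  decay_integral a p tau (dot4 (0, 0, lambda, - (lambda * c)) (0, 0, lambda, - (lambda * c))) <=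
  decay_const a b * tau `^ (- (2 / p) - b) * i.+1%:R `^ (- (2 * b)).
Proof.
move=> a0 p1 /andP[t0 t1] /andP[b0 b1] ba li.
have p0 : 0 < p by apply: lt_trans p1.
set W0 := Rintegral mu setT (wexp a 1).
set W1 := 2 * Rintegral mu setT (wexp (a - b) 1) + Rintegral mu setT (wexp (a - b + 1) 1).
have wi0 u : 0 <= Rintegral mu setT (wexp u 1) by apply: Rintegral_ge0 => v _; exact: wexp_ge0.
have W00 : 0 <= W0 by exact: wi0.
have W10 : 0 <= W1 by rewrite addr_ge0 ?mulr_ge0 ?wi0.
have tb0 : 0 <= tau `^ (- (2 / p) - b) by exact: powR_ge0.
rewrite -[decay_const a b]/(W0 + 2 * W1).
case: i li => [/eqP|i li].
  rewrite normr_eq0 => /eqP ->; rewrite powR1 mulr1 mul0r oppr0.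
  have Ap : 0 <= 2 / p by rewrite divr_ge0// ltW.
  have := decay_integral_le a0 p1 t0 (dot4_ge0 (0 : V)) Ap (lexx 0) (addr0 _) a0.
  rewrite subr0 -/W0 => h; apply: le_trans h _; rewrite mulrC.
  apply: (@le_trans _ _ (W0 * tau `^ (- (2 / p) - b))).
    by rewrite ler_wpM2l// ger_powR ?t0// gerBl ltW.
  by rewrite ler_wpM2r// lerDl mulr_ge0.
set Z := dot4 _ _.
have i0 : 0 < i.+1%:R :> R by rewrite ltr0n.
have Zi : i.+1%:R ^+ 2 <= Z.
  rewrite -li real_normK ?num_real// /Z /dot4/=.
  have := sqr_ge0 (lambda * c); rewrite !expr2; lra.
have Z0 : 0 < Z by apply: lt_le_trans Zi; rewrite exprn_gt0.
have b01 : 0 < b <= 1 by rewrite b0/=; lra.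
have := decay_integral_freq_le a0 p1 t0 t1 Z0 b01 ba; rewrite -/W1 => h.
apply: le_trans h _; rewrite mulrAC.
have Zb : Z `^ (- b) <= 2 * i.+2%:R `^ (- (2 * b)).
  apply: (@le_trans _ _ ((i.+1%:R ^+ 2) `^ (- b))).
    rewrite !powRN lef_pV2 ?posrE ?powR_gt0 ?exprn_gt0//.
    by apply: ge0_ler_powR; rewrite ?nnegrE ?(ltW b0) ?exprn_ge0 ?(ltW Z0).
  have -> : (i.+1%:R ^+ 2) `^ (- b) = i.+1%:R `^ (- (2 * b)).
    by rewrite -powR_mulrn ?(ltW i0)// -powRrM; congr (_ `^ _); ring.
  have i2 : i.+2%:R <= 2 * i.+1%:R :> R by rewrite -natrM ler_nat mul2n -addnn addnS addSn !ltnS leq_addr.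
  rewrite !powRN -[leRHS]invf_div lef_pV2 ?posrE ?divr_gt0 ?powR_gt0 ?ltr0n//.
  rewrite ler_pdivrMr// [leRHS]mulrC; apply: (@le_trans _ _ ((2 * i.+1%:R) `^ (2 * b))).
    by apply: ge0_ler_powR => //; rewrite ?nnegrE//; apply: mulr_ge0 => //; exact: ltW.
  rewrite powRM// ?(ltW i0)// ler_wpM2r ?powR_ge0//.
  by rewrite -[leRHS](@powRr1 R 2)// ler_powR//; lra.
apply: (@le_trans _ _ (tau `^ (- (2 / p) - b) * W1 * (2 * i.+2%:R `^ (- (2 * b))))).
  by rewrite ler_wpM2l// mulr_ge0.
have -> : tau `^ (- (2 / p) - b) * W1 * (2 * i.+2%:R `^ (- (2 * b))) =
  2 * W1 * tau `^ (- (2 / p) - b) * i.+2%:R `^ (- (2 * b)) by ring.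
by rewrite ler_wpM2r ?powR_ge0// ler_wpM2r// lerDr.
Qed.

Lemma normc_sum_le (I : Type) (s : seq I) (F : I -> R[i]) :
  Normc.normc (\sum_(i <- s) F i) <= \sum_(i <- s) Normc.normc (F i).
Proof.
apply: (big_ind2 (fun x y => Normc.normc x <= y)) => [|x1 y1 x2 y2 h1 h2|//].
  by rewrite Normc.normc0.
by apply: le_trans (le_normcD _ _) _; exact: lerD.
Qed.

Lemma sum_natdist_powRN_le (n : nat) (g : R) : 0 < g < 1 ->
  \sum_(j < n) \sum_(k < n) (natdist j k).+1%:R `^ (- g) <=
  2 / (1 - g) * n%:R `^ (2 - g).
Proof.
move=> g01; have /andP[g0 g1] := g01.
case: n => [|n]; first by rewrite big_ord0 mulr_ge0 ?powR_ge0// divr_ge0// subr_ge0 ltW.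
apply: (@le_trans _ _ (\sum_(j < n.+1) 2 * (n.+1%:R `^ (1 - g) / (1 - g)))).
  apply: ler_sum => j _.
  apply: le_trans (@sum_natdist_le R (fun i => i.+1%:R `^ (- g)) _ _ _ (ltn_ord j)) _.
    by move=> i; exact: powR_ge0.
  by rewrite ler_wpM2l// sum_powRN_le.
rewrite sumr_const card_ord -[leLHS]mulr_natl.
have n0 : 0 < n.+1%:R :> R by rewrite ltr0n.
have -> : n.+1%:R `^ (2 - g) = n.+1%:R * n.+1%:R `^ (1 - g).
  rewrite -{2}[n.+1%:R](powRr1 (ltW n0)) -powRD; last by rewrite (gt_eqF n0) implybT.
  by congr (_ `^ _); ring.
by rewrite le_eqVlt; apply/orP; left; apply/eqP; field; rewrite gt_eqF// subr_gt0.
Qed.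

Lemma torus_translate_box (c t0 s : R) (x : V) : 0 <= c <= 1 -> 0 <= t0 ->
  s <= 1 -> s <= t0 -> `|x.1.1.1| <= s -> `|x.1.1.2| <= s ->
  `|x.1.2 - c * t0| <= s -> `|x.2 - t0| <= s ->
  0 <= x.2 <= t0 + 1 /\ forall w : R * R,
  box3 (c * t0 + 1 + 2 * (t0 + 1)) 0 (x.1 - torus_param (c * x.2) x.2 w.1 w.2).
Proof.
move=> /andP[c0 c1] t00 s1 st h1 h2 h3; rewrite ler_distl => /andP[u1 u2].
have x0 : 0 <= x.2 by lra.
have xT : x.2 <= t0 + 1 by lra.
have cx : 0 <= c * x.2 <= x.2 by rewrite mulr_ge0//= ler_piMl.
have ct : 0 <= c * t0 by rewrite mulr_ge0.
split=> [|w]; first by rewrite x0.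
have [q1 q2 q3] := torus_param_le w.1 w.2 cx xT.
have key (u v : R) : `|u| <= c * t0 + 1 -> `|v| <= 2 * (t0 + 1) ->
    `|u - v - 0| <= c * t0 + 1 + 2 * (t0 + 1).
  by move=> hu hv; rewrite subr0; apply: le_trans (ler_normB _ _) _; exact: lerD.
have s1' : s <= c * t0 + 1 by lra.
apply/box3P; split.
- exact: (key _ _ (le_trans h1 s1') q1).
- exact: (key _ _ (le_trans h2 s1') q2).
- apply: (key _ _ _ q3); rewrite -[x.1.2](subrK (c * t0)) addrC.
  apply: le_trans (ler_normD _ _) _.
  by rewrite (ger0_norm ct) lerD2l; exact: le_trans h3 s1.
Qed.

Lemma torus_op_unbounded_wave (chi : R -> R[i]) (p c alpha : R) :
  Cc_smooth_pos chi -> (exists t, chi t != 0) -> 2 <= p -> 0 <= c <= 1 ->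
  1 / 2 < alpha -> ~ bounded_Lp_sobolev p%:E alpha (torus_op chi c).
Proof.
move=> chis chin p2 c01 ap [C hC].
have p0 : 0 < p by apply: lt_le_trans p2.
have p1 : 1 < p by apply: lt_le_trans p2; rewrite ltr1n.
have alpha0 : 0 < alpha by apply: lt_trans ap; rewrite divr_gt0.
have [t0 [T [Mchi [r [ct0 t00 r0 Mchi0 [chiT chiM chir]]]]]] := Cc_smooth_pos_cutoff chis chin.
have /andP[c0 c1] := c01.
set n0 := Normc.normc (chi t0).
have n0_gt0 : 0 < n0.
  rewrite lt_neqAle normc_ge0 andbT eq_sym.
  by apply: contra ct0 => /eqP/Normc.eq0_normc ->.
(* The midpoint of an interval that is nonempty because [alpha > 1/2]. Being above [1/4] makes the
   frequency decay [g = 2 b] beat the stationary phase exponent [1/2]; [b < alpha / 2] is required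
   by the decay integral, and [b < 1/2] by the summation with [g < 1]. *)
pose b := (1 / 4 + Num.min (alpha / 2) (1 / 2)) / 2.
have [b4 b2 ba] : [/\ 1 / 4 < b, b < 1 / 2 & b < alpha / 2].
  rewrite /b; case: (leP (alpha / 2) (1 / 2)) => h; split; lra.
have b0 : 0 < b by lra.
have b02 : 0 < b < 1 / 2 by rewrite b0.
pose g := 2 * b.
have g01 : 0 < g < 1 by rewrite /g; apply/andP; split; lra.
(* The gain over the lower bound [m^3]: with [n = m^2],
   [n^(2 - g) = m^(4 - 2 g) = m^3 * m^(- k')]. *)
pose k' := 2 * g - 1.
have k'0 : 0 < k' by rewrite /k' /g; lra.
pose b' := 2 / p + b.
have b'0 : 0 < b' by rewrite addr_gt0// divr_gt0.
(* With [tau = 1 / J] and [m = J^q] the loss [tau^(- b')] times the gain [m^(- k')] is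
   [J^(b' - q k')], at most [1 / J] for this [q]. *)
pose q := Num.bound ((b' + 1) / k').
have qk : b' + 1 <= q%:R * k'.
  have := archi_boundP (ltW (divr_gt0 (addr_gt0 b'0 ltr01) k'0)).
  by rewrite ltr_pdivrMr// => /ltW.
pose T0 := t0 + 1.
have T01 : 1 <= T0 by rewrite lerDr ltW.
have T00 : 0 < T0 by apply: lt_le_trans T01.
pose L := c * t0 + 1 + 2 * T0.
have ct : 0 <= c * t0 by rewrite mulr_ge0// ltW.
have L0 : 0 <= L by rewrite /L; lra.
pose y : V := (0, 0, c * t0, t0).
pose nn := ((2 * L) ^+ 3) `^ p^-1.
pose M := `|C| * nn + 1.
have nn0 : 0 <= nn by exact: powR_ge0.
have M0 : 0 <= M by rewrite addr_ge0// mulr_ge0.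
have CM : C * nn < M.
  apply: (@le_lt_trans _ _ (`|C| * nn)); last by rewrite /M ltrDl.
  by rewrite ler_wpM2r// ler_norm.
have fN l : cLnorm leb3 p%:E (wave L l) = nn%:E.
  apply: cLnorm_indic p0 (normc_wave L l) _ _; first exact: measurable_box3.
  exact: leb3_box3.
have fp l : inLp leb3 p%:E (wave L l) by split; [exact: cmeasurable_wave|rewrite fN ltry].
have fL l v : wave L l v != 0 -> box3 L 0 v.
  move=> h; apply: contrapT => nv; move: h; rewrite /wave indicE memNset//.
  by rewrite mul0r eqxx.
pose Dc := dual_const p alpha.
have Dc0 : 0 <= Dc by apply: dual_const_ge0.
pose D := decay_const (alpha / 2) b.
have D0 : 0 <= D.
  have wi0 u : 0 <= Rintegral mu setT (wexp u 1) by apply: Rintegral_ge0 => v _; exact: wexp_ge0.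
  by rewrite /D /decay_const !addr_ge0// mulr_ge0// addr_ge0// mulr_ge0.
have pi0 := pi_gt0 R.
pose c1' := pi / T0 * (n0 ^+ 2 / 2) * expR (-1) * 16.
have c10 : 0 < c1'.
  by rewrite /c1' !mulr_gt0 ?expR_gt0 ?exprn_gt0 ?invr_gt0.
pose C2 := n0 * Mchi * (2 * (2 * pi) ^+ 2) * (8 * pi) ^+ 2.
have C20 : 0 <= C2.
  apply: mulr_ge0; last exact: sqr_ge0.
  apply: mulr_ge0; last by apply: mulr_ge0 => //; exact: sqr_ge0.
  by apply: mulr_ge0 => //; exact: ltW.
pose C3 := n0 * (Dc * M * (D * (2 / (1 - g)))).
have C30 : 0 <= C3.
  have /andP[_ g1] := g01.
  apply: mulr_ge0; first exact: ltW.
  apply: mulr_ge0; first exact: mulr_ge0.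
  by apply: mulr_ge0 => //; rewrite divr_ge0// subr_ge0 ltW.
(* The Gaussian tail is estimated to order [q + 1] in [1 / J]: order [q] cancels the factor
   [m = J^q] and the remaining one gives [1 / J]. *)
pose E := (q.+1%:R * 8 / r ^+ 2) ^+ q.+1.
(* Beyond this threshold [sqrt tau] lies below [r], as the Gaussian lower bound requires, and below
   [t0], so that [x.2] stays nonnegative on the cube. *)
apply: (@archimedean_contra R c1' (C2 * E + C3) (Num.bound (r ^- 2 + t0 ^- 2 + 1))) => // j jr.
set J : R := j.+1%:R.
have J0 : 0 < J by rewrite ltr0n.
have J1 : 1 <= J by rewrite ler1n.
have r2 : 0 < r ^- 2 by rewrite invr_gt0 exprn_gt0.
have t2 : 0 < t0 ^- 2 by rewrite invr_gt0 exprn_gt0.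
have Jr : r ^- 2 + t0 ^- 2 + 1 < J.
  apply: lt_le_trans (archi_boundP _) _; first by rewrite !addr_ge0// ltW.
  by rewrite ler_nat leqW.
pose tau := J^-1.
have tau0 : 0 < tau by rewrite invr_gt0.
have tau1 : tau <= 1 by rewrite invf_le1.
have tau01 : 0 < tau <= 1 by rewrite tau0.
have sq (u : R) : 0 < u -> u ^- 2 < J -> Num.sqrt tau < u.
  move=> u0 uJ; rewrite -[ltRHS]ger0_norm ?(ltW u0)// -sqrtr_sqr ltr_sqrt ?exprn_gt0//.
  by rewrite invf_plt ?posrE ?exprn_gt0.
have str : Num.sqrt tau < r.
  by apply: sq => //; apply: le_lt_trans Jr; rewrite -addrA lerDl addr_ge0// ltW.
have stt : Num.sqrt tau < t0.
  by apply: sq => //; apply: le_lt_trans Jr; rewrite addrAC lerDr addr_ge0// ltW.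
have st1 : Num.sqrt tau <= 1 by rewrite -sqrtr1 ler_sqrt.
pose m := (j.+1 ^ q)%N.
have m_gt0 : (0 < m)%N by rewrite expn_gt0.
have mJ : m%:R = J ^+ q :> R by rewrite natrX.
set m' : R := m%:R in mJ.
have m0 : 0 < m' by rewrite ltr0n.
pose n := (m ^ 2)%N.
pose zeta (l : R) : V := (0, 0, l, - (l * c)).
pose kk : R := (4 * tau)^-1.
have kk0 : 0 < kk by rewrite invr_gt0 mulr_gt0.
pose lam (i k : 'I_n) : R := i%:R - k%:R.
pose F (i k : 'I_n) (x : V) := torus_op chi c (wave L (lam i k)) x *
  (cis (dot4 (y - x) (zeta (lam i k))) * real_complex R (gauss4 kk y x)).
have bnd i k : cintegrable leb4 (F i k) /\ Normc.normc (cintegral leb4 setT (F i k)) <=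
    Dc * tau ^+ 2 * M * (D * tau `^ (- b') * (natdist i k).+1%:R `^ (- g)).
  have [iF hF] := operator_dual_bound p1 alpha0 c01 chiT hC y (zeta (lam i k))
    (fp _) (fL _) (fN (lam i k)) CM tau0.
  split; first exact: cintegrable_mul_cis_gauss4.
  apply: le_trans hF _; apply: ler_wpM2l.
    by apply: mulr_ge0 => //; apply: mulr_ge0 => //; exact: sqr_ge0.
  have := decay_integral_wave c (divr_gt0 alpha0 (ltr0Sn R 1)) p1 tau01 b02 ba (natdistE i k).
  by rewrite /b' opprD.
have iF i k := (bnd i k).1.
have sumE x : \sum_i \sum_k F i k x =
    chi x.2 * real_complex R (dirichlet_avg n L c x * gauss4 kk y x).
  exact: sum_torus_op_wave.
have iS : cintegrable leb4 (fun x => chi x.2 * real_complex R (dirichlet_avg n L c x * gauss4 kk y x)).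
  rewrite -(funext sumE); apply: cintegrable_sum => i; exact: cintegrable_sum.
have upI : Normc.normc (cintegral leb4 setT
    (fun x => chi x.2 * real_complex R (dirichlet_avg n L c x * gauss4 kk y x))) <=
    Dc * tau ^+ 2 * M * (D * tau `^ (- b')) * (2 / (1 - g) * n%:R `^ (2 - g)).
  rewrite -(funext sumE) cintegral_sum; last by move=> i; exact: cintegrable_sum.
  apply: le_trans (normc_sum_le _ _) _.
  apply: le_trans (ler_wpM2l _ (sum_natdist_powRN_le n g01)); last first.
    apply: mulr_ge0; last by apply: mulr_ge0 => //; exact: powR_ge0.
    by apply: mulr_ge0 => //; apply: mulr_ge0 => //; exact: sqr_ge0.
  rewrite mulr_sumr; apply: ler_sum => i _.
  rewrite cintegral_sum//; apply: le_trans (normc_sum_le _ _) _.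
  by rewrite mulr_sumr; apply: ler_sum => k _; apply: le_trans (bnd i k).2 _; rewrite !mulrA.
have Blow x : `|x.1.1.1 - y.1.1.1| <= Num.sqrt tau -> `|x.1.1.2 - y.1.1.2| <= Num.sqrt tau ->
     `|x.1.2 - y.1.2| <= Num.sqrt tau -> `|x.2 - y.2| <= Num.sqrt tau ->
     pi / T0 * m' ^+ 3 <= dirichlet_avg n L c x.
  rewrite /y/= !subr0 => h1 h2 h3 h4.
  have [x0T hw] := torus_translate_box c01 (ltW t00) st1 (ltW stt) h1 h2 h3 h4.
  by apply: dirichlet_avg_ge.
have cB0 : 0 <= pi / T0 * m' ^+ 3.
  by apply: mulr_ge0; [apply: divr_ge0; exact: ltW|apply: exprn_ge0; exact: ltW].
have := @gaussian_average_lower R chi t0 r Mchi chiM chir (dirichlet_avg n L c) y tau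
  (2 * n%:R ^+ 2 * (2 * pi) ^+ 2) (pi / T0 * m' ^+ 3) erefl tau0 str
  (fun x => dirichlet_avg_bounds n L c x) cB0 Blow iS.
rewrite -/n0; move: upI; set I := Normc.normc _ => upI low.
have nE : n%:R = m' ^+ 2 :> R by rewrite natrX.
have npow : n%:R `^ (2 - g) = m' ^+ 3 * m' `^ (- k').
  rewrite nE -powR_mulrn ?(ltW m0)// -powRrM -powR_mulrn ?(ltW m0)//.
  rewrite -powRD; last by rewrite (gt_eqF m0) implybT.
  by congr (_ `^ _); rewrite /k'; ring.
have small : tau `^ (- b') * m' `^ (- k') <= J^-1.
  have -> : tau `^ (- b') = J `^ b' by rewrite /tau -powR_inv1 ?(ltW J0)// -powRrM mulN1r opprK.
  have -> : m' `^ (- k') = J `^ (- (q%:R * k')).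
    by rewrite mJ -powR_mulrn ?(ltW J0)// -powRrM mulrN.
  rewrite -powRD; last by rewrite (gt_eqF J0) implybT.
  rewrite -powR_inv1 ?(ltW J0)// ler_powR//; lra.
have expo : m' * expR (- (r ^+ 2 / (8 * tau))) <= E / J.
  have x0 : 0 < r ^+ 2 / (8 * tau) by rewrite divr_gt0 ?exprn_gt0// mulr_gt0.
  apply: le_trans (ler_wpM2l (ltW m0) (expRN_le_exprVn q x0)) _.
  have -> : q.+1%:R / (r ^+ 2 / (8 * tau)) = (q.+1%:R * 8 / r ^+ 2) * J^-1.
    by rewrite /tau; field; rewrite !gt_eqF// invr_gt0.
  rewrite exprMn -/E mJ exprVn exprS le_eqVlt; apply/orP; left; apply/eqP.
  by field; rewrite !gt_eqF// exprn_gt0.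
have m3 : 0 < m' ^+ 3 * tau ^+ 2 by rewrite mulr_gt0 ?exprn_gt0.
rewrite -(ler_pM2r m3).
have up : n0 * I <= C3 * (tau `^ (- b') * m' `^ (- k')) * (m' ^+ 3 * tau ^+ 2).
  apply: le_trans (ler_wpM2l (ltW n0_gt0) upI) _.
  by rewrite npow /C3 le_eqVlt; apply/orP; left; apply/eqP; ring.
have low' : c1' * (m' ^+ 3 * tau ^+ 2) -
   C2 * (m' * expR (- (r ^+ 2 / (8 * tau)))) * (m' ^+ 3 * tau ^+ 2) <= n0 * I.
  apply: le_trans low; rewrite nE /c1' /C2 le_eqVlt; apply/orP; left; apply/eqP; ring.
have h2 : C2 * (m' * expR (- (r ^+ 2 / (8 * tau)))) * (m' ^+ 3 * tau ^+ 2) <=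
    C2 * (E / J) * (m' ^+ 3 * tau ^+ 2).
  by rewrite ler_wpM2r ?(ltW m3)// ler_wpM2l.
have h3 : C3 * (tau `^ (- b') * m' `^ (- k')) * (m' ^+ 3 * tau ^+ 2) <=
    C3 * J^-1 * (m' ^+ 3 * tau ^+ 2).
  by rewrite ler_wpM2r ?(ltW m3)// ler_wpM2l.
have -> : (C2 * E + C3) / J * (m' ^+ 3 * tau ^+ 2) =
  C2 * (E / J) * (m' ^+ 3 * tau ^+ 2) + C3 * J^-1 * (m' ^+ 3 * tau ^+ 2) by ring.
apply: le_trans (lerD h2 (le_trans up h3)).
by rewrite -lerBlDl.
Qed.

End WaveExample.

Theorem mainTheorem7 (R : realType) (chi0 : R -> R[i]) (p c0 alpha : R)
  (chi0_test : Cc_smooth_pos chi0) (chi0_neq0 : exists t, chi0 t != 0)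
  (p_ge2 : 2 <= p) (c0_gt0 : 0 < c0) (c0_lt1 : c0 < 1)
  (alpha_gt : Num.min (1 / 2) (3 / p) < alpha) :
  ~ bounded_Lp_sobolev p%:E alpha
      (fun (f : R * R * R -> R[i]) (xt : R * R * R * R) =>
         chi0 xt.2 * torus_avg (c0 * xt.2) xt.2 f xt.1).
Proof.
have c01 : 0 <= c0 <= 1 by rewrite !ltW.
move: alpha_gt; rewrite gt_min => /orP[alpha_gt|alpha_gt].
- exact: (torus_op_unbounded_wave chi0_test chi0_neq0 p_ge2 c01 alpha_gt).
- exact: (torus_op_unbounded_neighborhood chi0_test chi0_neq0 p_ge2 c01 alpha_gt).
Qed.
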